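(* Let $0<\alpha<1$. Then there does not exist any sequence $(X_k)$ of diffeomorphisms of $\mathbb S^3$ canonically extended to $A_2$ such that each $M_k=X_k(T)$ is a torus minimally embedded in $\mathbb S^3$ noncongruent to the Clifford torus $T$ and $\lim_{k\to\infty}\|X_k-I\|_{C^{2,\alpha}}=0$.
   Context: $\mathbb S^3\subset\mathbb R^4$ is the unit sphere. The Clifford torus is $T=\{(u,v)\in\mathbb C^2:|u|=|v|=\sqrt2/2\}\subset\mathbb S^3$. Tori are $C^{2,\alpha}$ maps $S^1\times S^1\to\mathbb S^3$, embedded when injective immersions, minimal when the mean curvature vanishes identically. Congruent means related by an isometry of $\mathbb S^3$. $A_2=\{x\in\mathbb R^4:1/2<|x|<2\}$. A $C^{2,\alpha}$ diffeomorphism $\xi$ of $\mathbb S^3$ is canonically extended to a $C^{2,\alpha}$ diffeomorphism $X$ of $A_2$ by $X(rv)=r\xi(v)$ for $v\in\mathbb S^3$, $1/2<r<2$ (diffeomorphisms canonically extended to $A_2$ are understood to be of this class). $I:A_2\to A_2$ is the identity. For a map $F$ on $A_2$ with values in $\mathbb R^4$, with $D^j=\partial/\partial x_j$, $D^{jk}=\partial^2/\partial x_j\partial x_k$, $$[F]_\alpha=\sup_{x\ne y\in A_2}\frac{|F(x)-F(y)|}{|x-y|^\alpha},$$ $$\|F\|_{C^{2,\alpha}}=\sup_{A_2}|F|+\max_{1\le j\le4}\sup_{A_2}|D^jF|+\max_{1\le j,k\le4}\sup_{A_2}|D^{jk}F|+\max_{1\le j,k\le4}[D^{jk}F]_\alpha.$$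 *)

(* Defs.v *)
From HB Require Import structures.
From mathcomp Require Import all_boot all_order all_algebra.
From mathcomp Require Import all_classical all_reals all_analysis.
Import Order.TTheory GRing.Theory Num.Theory.
Import numFieldNormedType.Exports.

Set Implicit Arguments.
Unset Strict Implicit.
Unset Printing Implicit Defensive.

Local Open Scope classical_set_scope.
Local Open Scope ring_scope.

Section Euclidean.
Variables (R : realType) (n : nat).

Definition dot (u v : 'rV[R]_n) : R := \sum_(i < n) u 0 i * v 0 i.

(* The library norm on row vectors is the sup norm; it induces the same
   topology and derivatives, but |.| in the statement is Euclidean. *)
Definition enorm (u : 'rV[R]_n) : R := Num.sqrt (dot u u).

End Euclidean.

Section C2alpha.
Variables (R : realType) (n m : nat).
Implicit Types (U : set 'rV[R]_n) (F : 'rV[R]_n -> 'rV[R]_m).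

Definition partial (j : 'I_n) F (x : 'rV[R]_n) : 'rV[R]_m :=
  'D_(delta_mx 0 j) F x.

Definition sup_norm U F : \bar R := ereal_sup [set (enorm (F x))%:E | x in U].

Definition holder_seminorm (alpha : R) U F : \bar R :=
  ereal_sup [set (enorm (F z.1 - F z.2) / enorm (z.1 - z.2) `^ alpha)%:E
            | z in [set z | [/\ U z.1, U z.2 & z.1 <> z.2]]].

Definition C2alpha_norm (alpha : R) U F : \bar R :=
  (sup_norm U F
   + \big[maxe/-oo]_(j < n) sup_norm U (partial j F)
   + \big[maxe/-oo]_(j < n) \big[maxe/-oo]_(k < n)
       sup_norm U (partial j (partial k F))
   + \big[maxe/-oo]_(j < n) \big[maxe/-oo]_(k < n)
       holder_seminorm alpha U (partial j (partial k F)))%E.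

Definition C1 U F : Prop :=
  forall x, U x -> {for x, continuous F} /\
    forall j, derivable F x (delta_mx 0 j) /\ {for x, continuous (partial j F)}.

(* Meant for open U. *)
Definition C2alpha (alpha : R) U F : Prop :=
  [/\ C1 U F,
      forall j, C1 U (partial j F) &
      forall j k, (holder_seminorm alpha U (partial j (partial k F)) < +oo)%E].

(* Regularity along a subset S that need not be open: local extendability to
   open sets of the ambient space. *)
Definition C2alpha_along (alpha : R) (S : set 'rV[R]_n) F : Prop :=
  forall p, S p -> exists U G,
    [/\ open U, U p, C2alpha alpha U G & forall x, S x -> U x -> G x = F x].

End C2alpha.

Definition diffeo_of (T : Type) (regular : (T -> T) -> Prop) (S : set T)
    (f : T -> T) : Prop :=
  exists g : T -> T,
    [/\ set_fun S S f, set_fun S S g,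
        (forall x, S x -> g (f x) = x), (forall x, S x -> f (g x) = x) &
        regular f /\ regular g].

Section ThreeSphere.
Variable R : realType.

Definition S3 : set 'rV[R]_4 := [set x | enorm x = 1].

Definition A2 : set 'rV[R]_4 := [set x | 2^-1 < enorm x < 2].

(* R^4 is identified with C^2 by u = x_0 + i x_1, v = x_2 + i x_3. *)
Definition clifford_torus : set 'rV[R]_4 :=
  [set x | Num.sqrt (x 0 (inord 0) ^+ 2 + x 0 (inord 1) ^+ 2) = Num.sqrt 2 / 2
        /\ Num.sqrt (x 0 (inord 2) ^+ 2 + x 0 (inord 3) ^+ 2) = Num.sqrt 2 / 2].

Definition canonically_extended_diffeo (alpha : R)
    (X : 'rV[R]_4 -> 'rV[R]_4) : Prop :=
  diffeo_of (C2alpha alpha A2) A2 X /\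
  exists xi : 'rV[R]_4 -> 'rV[R]_4,
    diffeo_of (C2alpha_along alpha S3) S3 xi /\
    forall r v, 2^-1 < r < 2 -> S3 v -> X (r *: v) = r *: xi v.

(* Chordal and geodesic distances on the unit sphere determine each other
   monotonically, so they have the same isometries. *)
Definition S3_isometry (phi : 'rV[R]_4 -> 'rV[R]_4) : Prop :=
  set_surj S3 S3 phi /\ set_fun S3 S3 phi /\
  forall x y, S3 x -> S3 y -> enorm (phi x - phi y) = enorm (x - y).

Definition congruent (M N : set 'rV[R]_4) : Prop :=
  exists2 phi, S3_isometry phi & phi @` M = N.

(* A map S^1 x S^1 -> S^3 is a map of the plane that is 2pi-periodic in each
   coordinate. *)
Definition torus (alpha : R) (f : 'rV[R]_2 -> 'rV[R]_4) : Prop :=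
  [/\ forall p, S3 (f p),
      forall p j, f (p + (2 * pi) *: delta_mx 0 j) = f p &
      C2alpha alpha setT f].

Definition immersion (f : 'rV[R]_2 -> 'rV[R]_4) : Prop :=
  forall p, row_free (\matrix_(i < 2) partial i f p).

Definition torus_injective (f : 'rV[R]_2 -> 'rV[R]_4) : Prop :=
  forall p q, f p = f q ->
    forall j, exists z : int, p 0 j - q 0 j = z%:~R * (2 * pi).

Definition first_form (f : 'rV[R]_2 -> 'rV[R]_4) (p : 'rV[R]_2) : 'M[R]_2 :=
  \matrix_(i, j) dot (partial i f p) (partial j f p).

(* For nu tangent to S^3 at f p the component of the second derivatives along
   f p drops out, so this is the second fundamental form in S^3, not in R^4. *)
Definition second_form (f : 'rV[R]_2 -> 'rV[R]_4) (p : 'rV[R]_2)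
    (nu : 'rV[R]_4) : 'M[R]_2 :=
  \matrix_(i, j) dot (partial i (partial j f) p) nu.

Definition unit_normal (f : 'rV[R]_2 -> 'rV[R]_4) (p : 'rV[R]_2)
    (nu : 'rV[R]_4) : Prop :=
  [/\ enorm nu = 1, dot nu (f p) = 0 & forall i, dot nu (partial i f p) = 0].

Definition mean_curvature (f : 'rV[R]_2 -> 'rV[R]_4) (p : 'rV[R]_2)
    (nu : 'rV[R]_4) : R :=
  \tr (invmx (first_form f p) *m second_form f p nu) / 2.

(* There are two choices of nu at each p, giving opposite mean curvatures. *)
Definition minimal (f : 'rV[R]_2 -> 'rV[R]_4) : Prop :=
  forall p nu, unit_normal f p nu -> mean_curvature f p nu = 0.

Definition minimally_embedded_torus (alpha : R) (M : set 'rV[R]_4) : Prop :=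
  exists f, [/\ torus alpha f, immersion f, torus_injective f, minimal f &
                range f = M].

End ThreeSphere.

Arguments S3 {R}.
Arguments A2 {R}.
Arguments clifford_torus {R}.

(* Main.v *)
Require Import Defs.
From HB Require Import structures.
From mathcomp Require Import all_boot all_order all_algebra.
From mathcomp Require Import all_classical all_reals all_analysis.
From mathcomp Require Import ring lra.
Import Order.TTheory GRing.Theory Num.Theory.
Import numFieldNormedType.Exports.

Set Implicit Arguments.
Unset Strict Implicit.
Unset Printing Implicit Defensive.

Local Open Scope classical_set_scope.
Local Open Scope ring_scope.

(** The Clifford torus is the zero set in the sphere of the quadratic form
    [q x = x_0 ^ 2 + x_1 ^ 2 - x_2 ^ 2 - x_3 ^ 2] (called [qf] below).  Let [c] be its
    standard parametrization and let [y = X o c] parametrize a minimal torus, with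
    [X] close to the identity.  The proof shows that, after a suitable rotation of
    the sphere, [s = q (y)] vanishes identically.  The rotated torus then lies in
    the Clifford torus, and it covers it; hence the two are congruent.  Only the
    closeness of [y] to [c] together with first derivatives is ever used.

    Minimality says that the coordinates of [y] satisfy [Laplacian y = - 2 y]
    ([laplace_position]); hence [Laplacian s + 4 s = 2 K], where [K] is the trace of
    [q] over the tangent plane.  On the Clifford torus [K] vanishes, and nearby it is
    bounded by a multiple of the squared gradient of [s] ([trace_small]).  In the
    coordinates [(a, b)] the metric of the Clifford torus is half the flat one, so
    [s] almost satisfies [s_aa + s_bb + 2 s = 0].  The eigenvalue [2] of the flat
    Laplacian has the eigenfunctions [cos a cos b], [cos a sin b], [sin a cos b],
    [sin a sin b]; below it are [0] and [1], and above it there is a gap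
    ([torus_gap]).  The components of [s] on the eigenvalues [0] and [1] are small
    by the equation.  If those on the eigenvalue [2] are small as well, the energy
    identity contradicts the gap unless [s = 0] ([nearly_flat_rigidity],
    [nearby_minimal_torus]).

    The four eigenfunctions are the products [c_i c_j] with [i < 2 <= j] up to a
    factor, and correspond to the infinitesimal rotations that move the Clifford
    torus.  So the rotation is chosen to minimize the mean of [q ^ 2] over the
    torus: the first variation makes [s] orthogonal to the products [y_i y_j]
    ([balanced_of_min]), which are close to the eigenfunctions.  Minimizing rotations
    exist since the orthogonal group is compact.  Along the sequence they accumulate
    at one that preserves the Clifford torus, and undoing this one leaves
    minimizing rotations close to the identity ([near_identity_minimizer]).

    The torus is assumed minimal in some parametrization, of which only the image
    is known.  Minimality passes to [y] because both surfaces lie in the zero set of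
    [q o X ^ -1]: the trace of its Hessian over the common tangent plane expresses
    the mean curvature in either parametrization ([minimal_parametrization]).

    The gap on the circle is obtained without Fourier series in the limit: up to a
    factor, a function without low modes is the convolution of its derivative with a
    truncated sawtooth, whose norm is explicit ([kernel_gap]); modes above the gap
    are then put back one frequency at a time ([has_gap_pred]). *)

(** * Calculus of one and two real variables *)

Section Calculus.
Variable R : realType.
Implicit Types (f g F G : R -> R) (a b x t d : R).

Definition der f x d : Prop := is_derive x 1 f d.

Lemma der_cst c x : der (fun=> c) x 0.
Proof. exact: is_derive_cst. Qed.

Lemma der_id x : der (fun t => t) x 1.
Proof. exact: is_derive_id. Qed.

Lemma derD f g x d e : der f x d -> der g x e ->
  der (fun t => f t + g t) x (d + e).
Proof. by move=> df dg; exact: is_deriveD. Qed.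

Lemma derN f x d : der f x d -> der (fun t => - f t) x (- d).
Proof. by move=> df; exact: is_deriveN. Qed.

Lemma derM f g x d e : der f x d -> der g x e ->
  der (fun t => f t * g t) x (d * g x + f x * e).
Proof.
move=> df dg; have := @is_deriveM _ _ f g x 1 d e df dg.
by rewrite /GRing.scale /= addrC [g x * d]mulrC.
Qed.

Lemma derV f x d : f x != 0 -> der f x d ->
  der (fun t => (f t)^-1) x (- d / f x ^+ 2).
Proof.
move=> f0 df; have := is_deriveV f0 df.
by rewrite /GRing.scale /= mulNr mulrC mulNr.
Qed.

Lemma der_comp f g x d e : der f (g x) d -> der g x e ->
  der (fun t => f (g t)) x (d * e).
Proof. by move=> df dg; exact: (is_derive1_comp df dg). Qed.

Lemma der_eq f g x d e : der f x d -> (forall t, f t = g t) -> d = e ->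
  der g x e.
Proof. by move=> df /funext <- <-. Qed.

Lemma der_unique f x d e : der f x d -> der f x e -> d = e.
Proof. by move=> [_ <-] [_ <-]. Qed.

Lemma der_cts f x d : der f x d -> {for x, continuous f}.
Proof.
by move=> [df _]; apply: differentiable_continuous; apply/derivable1_diffP.
Qed.

Lemma der_near f g x d : der f x d -> (\forall t \near x, f t = g t) -> der g x d.
Proof. by move=> df fg; apply: near_eq_is_derive fg df. Qed.

Lemma mean_value f (f' : R -> R) a b : a <= b ->
  (forall x, a <= x <= b -> der f x (f' x)) ->
  exists2 c, a <= c <= b & f b - f a = f' c * (b - a).
Proof.
move=> ab df.
have [x||c /itvP cab ->] := @MVT_segment R f f' a b ab.
- by move=> /itvP xab; apply: df; rewrite !xab.
- apply: continuous_in_subspaceT => x; rewrite inE /= => /itvP xab.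
  by apply: (@der_cts _ _ (f' x)); apply: df; rewrite !xab.
by exists c => //; rewrite !cab.
Qed.

Lemma der0_cst f a b : a <= b -> (forall x, a <= x <= b -> der f x 0) -> f b = f a.
Proof.
move=> ab df; have [c _ /eqP] := mean_value ab df.
by rewrite mul0r subr_eq0 => /eqP.
Qed.

Lemma der_ge0_le f (f' : R -> R) a b : a <= b ->
  (forall x, a <= x <= b -> der f x (f' x)) ->
  (forall x, a <= x <= b -> 0 <= f' x) -> f a <= f b.
Proof.
move=> ab df f0; have [c cab e] := mean_value ab df.
by rewrite -subr_ge0 e mulr_ge0 ?subr_ge0 // f0.
Qed.

Lemma mean_value_near f (f' : R -> R) x h :
  (forall t, der f t (f' t)) ->
  exists2 c, `|c - x| <= `|h| & f (x + h) - f x = f' c * h.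
Proof.
move=> df; have [h0|h0] := leP 0 h.
  have [||c /andP[c1 c2] e] := @mean_value f f' x (x + h); first by rewrite lerDl.
    by move=> t _; exact: df.
  exists c; first by rewrite ger0_norm ?subr_ge0 // ger0_norm // lerBlDl.
  by rewrite e addrC addKr.
have [||c /andP[c1 c2] e] := @mean_value f f' (x + h) x; first by rewrite gerDl ltW.
  by move=> t _; exact: df.
exists c.
  by rewrite ler0_norm ?subr_le0 // ltr0_norm //; lra.
by rewrite -opprB e opprD addrA subrr sub0r mulrN opprK.
Qed.

(** The interval starts to the left of the origin so that this is differentiable
    on all of the closed half line to the right of the origin. *)
Definition prim f x : R := \int[@lebesgue_measure R]_(t in `[-20, x]) f t.

Lemma der_prim f x : continuous f -> -20 < x -> der (prim f) x (f x).
Proof.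
move=> cf x0; have xu : x < x + 1 by rewrite ltrDl.
have I : (@lebesgue_measure R).-integrable `[-20, x + 1] (EFin \o f).
  apply: continuous_compact_integrable; first exact: segment_compact.
  exact: continuous_subspaceT.
have [d e] := @continuous_FTC1_closed R f (-20) x (x + 1) xu I x0 (cf x).
apply: DeriveDef; first exact: d.
by rewrite -derive1E; exact: e.
Qed.

Definition cint f : R := prim f (2 * pi) - prim f 0.

Lemma tau_gt0 : 0 < 2 * pi :> R. Proof. by rewrite mulr_gt0 ?pi_gt0. Qed.
Lemma tau_ge0 : 0 <= 2 * pi :> R. Proof. exact: ltW tau_gt0. Qed.

(** Two primitives on the period differ by a constant. *)
Lemma cint_FTC f F : continuous f ->
  (forall t, 0 <= t <= 2 * pi -> der F t (f t)) -> cint f = F (2 * pi) - F 0.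
Proof.
move=> cf dF; rewrite /cint; apply/eqP; rewrite subr_eq -addrA -subr_eq addrC.
rewrite eq_sym -subr_eq eq_sym opprK; apply/eqP.
have := @der0_cst (fun t => F t - prim f t) 0 (2 * pi) tau_ge0.
move=> H; have {H} : F (2 * pi) - prim f (2 * pi) = F 0 - prim f 0.
  apply: H => t t0; apply: (der_eq (derD (dF _ t0) (derN (der_prim cf _)))) => //.
    by move: t0 => /andP[t0 _]; apply: lt_le_trans t0; rewrite oppr_lt0.
  by rewrite subrr.
lra.
Qed.

Lemma cint_der f : continuous f -> exists2 F, cint f = F (2 * pi) - F 0 &
  forall t, 0 <= t <= 2 * pi -> der F t (f t).
Proof.
move=> cf; exists (prim f) => // t /andP[t0 _]; apply: der_prim => //.
by apply: lt_le_trans t0; rewrite oppr_lt0.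
Qed.

Lemma cintD f g : continuous f -> continuous g ->
  cint (fun t => f t + g t) = cint f + cint g.
Proof.
move=> cf cg; have [F -> dF] := cint_der cf; have [G -> dG] := cint_der cg.
rewrite (@cint_FTC _ (fun t => F t + G t)); first by lra.
  by move=> x; apply: cvgD; [exact: cf|exact: cg].
by move=> t t0; apply: derD; [exact: dF|exact: dG].
Qed.

Lemma cintZ c f : continuous f -> cint (fun t => c * f t) = c * cint f.
Proof.
move=> cf; have [F -> dF] := cint_der cf.
rewrite (@cint_FTC _ (fun t => c * F t)); first by rewrite mulrBr.
  by move=> x; apply: cvgM; [exact: cvg_cst|exact: cf].
move=> t t0; apply: (der_eq (derM (der_cst c t) (dF _ t0))) => //.
by rewrite mul0r add0r.
Qed.

Lemma cint_ge0 f : continuous f -> (forall t, 0 <= f t) -> 0 <= cint f.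
Proof.
move=> cf f0; have [F -> dF] := cint_der cf.
by rewrite subr_ge0; apply: (der_ge0_le tau_ge0 dF) => t _; exact: f0.
Qed.

(** A primitive of a nonnegative function with zero total increase is
    constant, hence has zero derivative. *)
Lemma cint_eq0 f : continuous f -> (forall t, 0 <= f t) -> cint f = 0 ->
  forall t, 0 <= t <= 2 * pi -> f t = 0.
Proof.
move=> cf f0; have [F -> dF] := cint_der cf => /eqP; rewrite subr_eq0 => /eqP e.
have mono s t : 0 <= s -> s <= t -> t <= 2 * pi -> F s <= F t.
  move=> s0 st t2; apply: (@der_ge0_le _ f) => // x /andP[x1 x2].
  by apply: dF; rewrite (le_trans s0 x1) (le_trans x2 t2).
have cst t : 0 <= t <= 2 * pi -> F t = F 0.
  move=> /andP[t0 t2]; apply/eqP; rewrite eq_le (mono 0 t) // andbT -e.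
  by rewrite (mono t _) // tau_ge0.
have in0 t : 0 < t < 2 * pi -> f t = 0.
  move=> /andP[t0 t2]; have dFt : der F t (f t) by apply: dF; rewrite !ltW.
  have N : \forall s \near t, F s = F 0.
    have : \forall s \near t, s \in `]0, 2 * pi[.
      by apply: near_in_itvoo; rewrite in_itv /= t0 t2.
    by apply: filterS => s /itvP s0; apply: cst; rewrite !s0.
  exact: der_unique (der_near dFt N) (der_cst (F 0) t).
move=> t /andP[t0 t2]; apply/eqP; rewrite eq_le f0 andbT leNgt; apply/negP => ft.
have N : \forall s \near t, 0 < f s.
  by have := cf t; move/cvgr_gt; apply.
have [e0 e0p H] := N.
pose h := Num.min (e0 / 2) (pi / 2).
have h0 : 0 < h by rewrite lt_min !divr_gt0 ?pi_gt0.
have he : h < e0 by rewrite gt_min; apply/orP; left; rewrite ltr_pdivrMr // ltr_pMr // ltr1n.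
have hpi : h <= pi / 2 by rewrite ge_min lexx orbT.
have pi0 : 0 < pi :> R := pi_gt0 R.
have [tpi|tpi] := leP t pi.
  have := H (t + h); rewrite /= in0; last by apply/andP; split; lra.
  rewrite ltxx => X; suff: false by [].
  by apply: X; rewrite /ball /= opprD addrA subrr add0r normrN gtr0_norm.
have := H (t - h); rewrite /= in0; last by apply/andP; split; lra.
rewrite ltxx => X; suff: false by [].
by apply: X; rewrite /ball /= opprB addrC subrK gtr0_norm.
Qed.

(** The increase of a primitive over a period has derivative
    [f (t + 2 pi) - f t = 0]. *)
Lemma cint_shift f x : continuous f -> (forall t, f (t + 2 * pi) = f t) -> 0 <= x ->
  cint (fun t => f (x + t)) = cint f.
Proof.
move=> cf pf x0; pose P := prim f.
have dP t : 0 <= t -> der P t (f t).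
  by move=> t0; apply: der_prim => //; apply: lt_le_trans t0; rewrite oppr_lt0.
have dS c t : 0 <= c + t -> der (fun s => P (c + s)) t (f (c + t)).
  move=> ct; apply: (der_eq (der_comp (dP _ ct) (derD (der_cst c t) (der_id t)))) => //.
  by rewrite add0r mulr1.
rewrite (@cint_FTC _ (fun t => P (x + t))); last 2 first.
- move=> t; apply: (@cvg_comp _ _ _ (fun t => x + t) f); last exact: cf.
  by apply: cvgD; [exact: cvg_cst|exact: cvg_id].
- by move=> t /andP[t0 _]; apply: dS; rewrite addr_ge0.
have := @der0_cst (fun y => P (2 * pi + y) - P y) 0 x x0.
move=> H; have {H} : P (2 * pi + x) - P x = P (2 * pi + 0) - P 0.
  apply: H => y /andP[y0 _]; have y2 : 0 <= 2 * pi + y by rewrite addr_ge0 // tau_ge0.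
  apply: (der_eq (derD (dS _ _ y2) (derN (dP _ y0)))) => //.
  by rewrite [2 * pi + y]addrC pf subrr.
by rewrite /cint -/P !addr0 => <-; rewrite [x + _]addrC.
Qed.

End Calculus.

Section TwoVariables.
Variable R : realType.
Implicit Types (f g : R -> R) (F G H : R -> R -> R).

Definition cont2 F : Prop := continuous (fun z : R * R => F z.1 z.2).

Lemma cont2_cst (c : R) : cont2 (fun _ _ => c).
Proof. by move=> z; exact: cvg_cst. Qed.

Lemma cont2D F G : cont2 F -> cont2 G -> cont2 (fun a b => F a b + G a b).
Proof. by move=> cF cG z; apply: cvgD; [exact: cF|exact: cG]. Qed.

Lemma cont2N F : cont2 F -> cont2 (fun a b => - F a b).
Proof. by move=> cF z; apply: cvgN; exact: cF. Qed.

Lemma cont2M F G : cont2 F -> cont2 G -> cont2 (fun a b => F a b * G a b).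
Proof. by move=> cF cG z; apply: cvgM; [exact: cF|exact: cG]. Qed.

Lemma cont2V F : (forall a b, F a b != 0) -> cont2 F -> cont2 (fun a b => (F a b)^-1).
Proof. by move=> F0 cF z; apply: cvgV; [exact: F0|exact: cF]. Qed.

Lemma cont2_comp f F : continuous f -> cont2 F -> cont2 (fun a b => f (F a b)).
Proof.
move=> cf cF z.
by apply: (@cvg_comp _ _ _ (fun z : R * R => F z.1 z.2) f); [exact: cF|exact: cf].
Qed.

Lemma cont2X F n : cont2 F -> cont2 (fun a b => F a b ^+ n).
Proof. by move=> cF; exact: (cont2_comp (@exprn_continuous _ n) cF). Qed.

Lemma cont2_abs F : cont2 F -> cont2 (fun a b => `|F a b|).
Proof. by move=> cF; exact: (cont2_comp (@norm_continuous _ _) cF). Qed.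

Lemma cont2_fst f : continuous f -> cont2 (fun a _ => f a).
Proof.
move=> cf z; apply: (@cvg_comp _ _ _ (fun z : R * R => z.1) f); last exact: cf.
exact: cvg_fst.
Qed.

Lemma cont2_snd f : continuous f -> cont2 (fun _ b => f b).
Proof.
move=> cf z; apply: (@cvg_comp _ _ _ (fun z : R * R => z.2) f); last exact: cf.
exact: cvg_snd.
Qed.

Lemma cont2_sum (I : Type) (r : seq I) (F : I -> R -> R -> R) :
  (forall i, cont2 (F i)) -> cont2 (fun a b => \sum_(i <- r) F i a b).
Proof.
move=> cF; elim: r => [|i r IH].
  rewrite (_ : (fun _ => _) = (fun _ _ => 0)); first exact: cont2_cst.
  by apply/funext => a; apply/funext => b; rewrite big_nil.
rewrite (_ : (fun _ => _) = (fun a b => F i a b + \sum_(j <- r) F j a b)).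
  exact: cont2D.
by apply/funext => a; apply/funext => b; rewrite big_cons.
Qed.

Lemma cont2_ext F G : cont2 F -> (forall a b, F a b = G a b) -> cont2 G.
Proof.
by move=> cF e; rewrite (_ : G = F) //; apply/funext => a; apply/funext => b.
Qed.

Lemma cont2_row F a : cont2 F -> continuous (F a).
Proof.
move=> cF b; apply: (@cvg_comp _ _ _ (fun b => (a, b)) (fun z : R * R => F z.1 z.2)).
  apply: (@cvg_pair _ _ _ _ (nbhs a) (nbhs b) _ _ _ (fun=> a) id); last exact: cvg_id.
  exact: cvg_cst.
exact: (cF (a, b)).
Qed.

Lemma continuous2P F a b : cont2 F -> forall e, 0 < e ->
  exists2 d, 0 < d & forall x t, `|x - a| < d -> `|t - b| < d -> `|F x t - F a b| < e.
Proof.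
move=> cF e e0; have := cF (a, b) => /cvgrPdist_lt /(_ _ e0) [[U V] /= [U1 V1] UV].
have [d1 d10 H1] := U1; have [d2 d20 H2] := V1.
exists (Num.min d1 d2); first by rewrite lt_min d10.
move=> x t; rewrite !lt_min => /andP[xa _] /andP[_ tb].
rewrite distrC; apply: (UV (x, t)); split => /=.
  by apply: H1; rewrite /ball /= distrC.
by apply: H2; rewrite /ball /= distrC.
Qed.

(** Uniformity in the compact variable, by the tube lemma. *)
Lemma cont2_tube F a e : cont2 F -> 0 < e ->
  exists2 d, 0 < d & forall x t, `|x - a| < d -> 0 <= t <= 2 * pi ->
    `|F x t - F a t| < e.
Proof.
move=> cF e0; have e20 : 0 < e / 2 by rewrite divr_gt0.
have /compact_near_coveringP := @segment_compact R 0 (2 * pi).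
move=> /(_ R (nbhs a) (fun x t => `|F x t - F a t| < e) _) [].
  move=> t _; have [d d0 H] := continuous2P a t cF e20.
  exists (ball t d, ball a d) => /=; first by split; exact: nbhsx_ballx.
  move=> [s x] [/= bs bx].
  rewrite (_ : F x s - F a s = (F x s - F a t) - (F a s - F a t)); last by ring.
  apply: le_lt_trans (ler_normB _ _) _; rewrite (splitr e) ltrD // H //.
  - by rewrite distrC.
  - by rewrite distrC.
  - by rewrite subrr normr0.
  - by rewrite distrC.
move=> d d0 H; exists d => // x t xa t0.
by apply: (H x); [rewrite /ball /= distrC|rewrite /= in_itv].
Qed.

Lemma cint_bound f e : continuous f -> (forall t, 0 <= t <= 2 * pi -> `|f t| <= e) ->
  `|cint f| <= e * (2 * pi).
Proof.
move=> cf fe; have [P -> dP] := cint_der cf.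
have [c cc ->] := mean_value (tau_ge0 R) dP.
by rewrite subr0 normrM (ger0_norm (tau_ge0 R)) ler_wpM2r ?tau_ge0 ?fe.
Qed.

Lemma cint_ext f g : (forall t, f t = g t) -> cint f = cint g.
Proof. by move=> /funext ->. Qed.

Lemma cintN f : continuous f -> cint (fun t => - f t) = - cint f.
Proof. by move=> cf; rewrite -mulN1r -cintZ //; apply: cint_ext => t; rewrite mulN1r. Qed.

Lemma cintB f g : continuous f -> continuous g ->
  cint (fun t => f t - g t) = cint f - cint g.
Proof.
move=> cf cg; rewrite cintD ?cintN // => x.
by apply: cvgN; exact: cg.
Qed.

Lemma cint_continuous F : cont2 F -> continuous (fun a => cint (F a)).
Proof.
move=> cF a; apply/cvgrPdist_lt => e e0.
have k0 := tau_gt0 R.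
have e2 : 0 < e / (2 * pi) / 2 by rewrite !divr_gt0.
have [d d0 H] := cont2_tube a cF e2.
exists d => // x /= xa; rewrite -cintB; try exact: cont2_row.
apply: (@le_lt_trans _ _ (e / (2 * pi) / 2 * (2 * pi))).
  apply: cint_bound => [t|t t0].
    by apply: cvgB; exact: cont2_row.
  by rewrite distrC ltW // H // distrC.
by rewrite mulrAC divfK ?gt_eqF // ltr_pdivrMr // ltr_pMr // ltr1n.
Qed.

(** Differentiation under the integral sign: the mean value theorem writes the
    difference quotients as values of the derivative, which converge uniformly
    on the compact interval. *)
Lemma der_cint F G a : cont2 F -> cont2 G ->
  (forall x t, der (fun x => F x t) x (G x t)) ->
  der (fun x => cint (F x)) a (cint (G a)).
Proof.
move=> cF cG dF.
have k0 := tau_gt0 R.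
have L : (fun h => h^-1 *: (cint (F (h *: 1 + a)) - cint (F a))) @ (0 : R)^' --> cint (G a).
  apply/cvgrPdist_le => e e0.
  have e2 : 0 < e / (2 * pi) by rewrite divr_gt0.
  have [d d0 H] := cont2_tube a cG e2.
  near=> h.
  have h0 : h != 0 by near: h; exact: nbhs_dnbhs_neq.
  have hd : `|h| < d by near: h; apply: dnbhs0_lt.
  rewrite /GRing.scale /= mulr1 -cintB; try exact: cont2_row.
  rewrite -cintZ; last by move=> t; apply: cvgB; exact: cont2_row.
  rewrite -cintB; first last.
  - move=> t; apply: cvgM; first exact: cvg_cst.
    by apply: cvgB; exact: cont2_row.
  - exact: cont2_row.
  rewrite -[leRHS](@divfK _ (2 * pi)) ?gt_eqF //; apply: cint_bound => [t|t t0].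
    apply: cvgB; first exact: cont2_row.
    apply: cvgM; first exact: cvg_cst.
    by apply: cvgB; exact: cont2_row.
  have [c ch e1] := mean_value_near a h (fun x => dF x t).
  rewrite [h + a]addrC e1 mulrCA mulVf // mulr1 distrC ltW // H //.
  exact: le_lt_trans ch hd.
apply: DeriveDef; last exact: (cvg_lim _ L).
by apply/cvg_ex; exists (cint (G a)).
Unshelve. all: by end_near. Qed.

End TwoVariables.

(** * Doubly periodic functions and their integrals *)

Section Torus.
Variable R : realType.
Implicit Types (f g : R -> R) (F G H : R -> R -> R).

(** Continuously differentiable functions on the torus, carried together with
    their two partial derivatives so that closure properties compute the
    latter. *)
Record C1T F F1 F2 : Prop := MkC1T {
  C1T_cont : cont2 F;
  C1T_cont1 : cont2 F1;
  C1T_cont2 : cont2 F2;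
  C1T_der1 : forall a b, der (fun x => F x b) a (F1 a b);
  C1T_der2 : forall a b, der (F a) b (F2 a b);
  C1T_per1 : forall a b, F (a + 2 * pi) b = F a b;
  C1T_per2 : forall a b, F a (b + 2 * pi) = F a b }.

Lemma C1T_ext F F1 F2 G G1 G2 : C1T F F1 F2 ->
  (forall a b, F a b = G a b) -> (forall a b, F1 a b = G1 a b) ->
  (forall a b, F2 a b = G2 a b) -> C1T G G1 G2.
Proof.
move=> H e e1 e2.
have -> : G = F by apply/funext => a; apply/funext => b.
have -> : G1 = F1 by apply/funext => a; apply/funext => b.
by have -> : G2 = F2 by apply/funext => a; apply/funext => b.
Qed.

Lemma C1T_cst (c : R) : C1T (fun _ _ => c) (fun _ _ => 0) (fun _ _ => 0).
Proof. by split=> *; try exact: cont2_cst; try exact: der_cst. Qed.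

Lemma C1TD F F1 F2 G G1 G2 : C1T F F1 F2 -> C1T G G1 G2 ->
  C1T (fun a b => F a b + G a b) (fun a b => F1 a b + G1 a b)
      (fun a b => F2 a b + G2 a b).
Proof.
move=> [? ? ? d1 d2 p1 p2] [? ? ? e1 e2 q1 q2].
by split=> *; rewrite ?p1 ?p2 ?q1 ?q2 //; try exact: cont2D; apply: derD.
Qed.

Lemma C1TN F F1 F2 : C1T F F1 F2 ->
  C1T (fun a b => - F a b) (fun a b => - F1 a b) (fun a b => - F2 a b).
Proof.
move=> [? ? ? d1 d2 p1 p2].
by split=> *; rewrite ?p1 ?p2 //; try exact: cont2N; apply: derN.
Qed.

Lemma C1TM F F1 F2 G G1 G2 : C1T F F1 F2 -> C1T G G1 G2 ->
  C1T (fun a b => F a b * G a b) (fun a b => F1 a b * G a b + F a b * G1 a b)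
      (fun a b => F2 a b * G a b + F a b * G2 a b).
Proof.
move=> [? ? ? d1 d2 p1 p2] [? ? ? e1 e2 q1 q2].
split=> *; rewrite ?p1 ?p2 ?q1 ?q2 //; try exact: cont2M.
- by apply: cont2D; exact: cont2M.
- by apply: cont2D; exact: cont2M.
- by apply: derM; [exact: d1|exact: e1].
- by apply: derM; [exact: d2|exact: e2].
Qed.

Lemma C1TV F F1 F2 : (forall a b, F a b != 0) -> C1T F F1 F2 ->
  C1T (fun a b => (F a b)^-1) (fun a b => - F1 a b / F a b ^+ 2)
      (fun a b => - F2 a b / F a b ^+ 2).
Proof.
move=> F0 [? ? ? d1 d2 p1 p2].
have F20 a b : F a b ^+ 2 != 0 by rewrite expf_neq0.
split=> *; rewrite ?p1 ?p2 //; first exact: cont2V.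
- by apply: cont2M; [exact: cont2N|apply: cont2V => //; exact: cont2X].
- by apply: cont2M; [exact: cont2N|apply: cont2V => //; exact: cont2X].
- exact: (@derV _ (fun x => F x _)).
- exact: derV.
Qed.

Lemma C1T_sqrt F F1 F2 : (forall a b, 0 < F a b) -> C1T F F1 F2 ->
  C1T (fun a b => Num.sqrt (F a b)) (fun a b => F1 a b / (2 * Num.sqrt (F a b)))
      (fun a b => F2 a b / (2 * Num.sqrt (F a b))).
Proof.
move=> F0 [? ? ? d1 d2 p1 p2].
have c : cont2 (fun a b => Num.sqrt (F a b)) by exact: (cont2_comp (@sqrt_continuous R)).
have s0 a b : 2 * Num.sqrt (F a b) != 0.
  by rewrite mulf_neq0 ?pnatr_eq0 // gt_eqF // sqrtr_gt0.
have ci : cont2 (fun a b => (2 * Num.sqrt (F a b))^-1).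
  by apply: cont2V => //; apply: cont2M => //; exact: cont2_cst.
split=> *; rewrite ?p1 ?p2 //; try exact: cont2M.
- apply: (der_eq (der_comp (is_derive1_sqrt (F0 _ _)) (d1 _ _))) => //.
  by rewrite mulrC.
- apply: (der_eq (der_comp (is_derive1_sqrt (F0 _ _)) (d2 _ _))) => //.
  by rewrite mulrC.
Qed.

Lemma C1T_sum (I : Type) (r : seq I) (F F1 F2 : I -> R -> R -> R) :
  (forall i, C1T (F i) (F1 i) (F2 i)) ->
  C1T (fun a b => \sum_(i <- r) F i a b) (fun a b => \sum_(i <- r) F1 i a b)
      (fun a b => \sum_(i <- r) F2 i a b).
Proof.
move=> H; elim: r => [|i r IH].
  by apply: (C1T_ext (C1T_cst 0)) => a b; rewrite big_nil.
by apply: (C1T_ext (C1TD (H i) IH)) => a b; rewrite big_cons.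
Qed.

Definition iint F : R := cint (fun a => cint (F a)).

Lemma iint_ext F G : (forall a b, F a b = G a b) -> iint F = iint G.
Proof. by move=> e; apply: cint_ext => a; apply: cint_ext. Qed.

Lemma iintD F G : cont2 F -> cont2 G ->
  iint (fun a b => F a b + G a b) = iint F + iint G.
Proof.
move=> cF cG; rewrite /iint -cintD; try exact: cint_continuous.
by apply: cint_ext => a; apply: cintD; exact: cont2_row.
Qed.

Lemma iintZ c F : cont2 F -> iint (fun a b => c * F a b) = c * iint F.
Proof.
move=> cF; rewrite /iint -cintZ; last exact: cint_continuous.
by apply: cint_ext => a; apply: cintZ; exact: cont2_row.
Qed.

Lemma iintN F : cont2 F -> iint (fun a b => - F a b) = - iint F.
Proof.
move=> cF; rewrite -mulN1r -(iintZ (-1) cF).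
by apply: iint_ext => a b; rewrite mulN1r.
Qed.

Lemma iintB F G : cont2 F -> cont2 G ->
  iint (fun a b => F a b - G a b) = iint F - iint G.
Proof. by move=> cF cG; rewrite iintD ?iintN //; exact: cont2N. Qed.

Lemma iint_ge0 F : cont2 F -> (forall a b, 0 <= F a b) -> 0 <= iint F.
Proof.
move=> cF F0; apply: cint_ge0; first exact: cint_continuous.
by move=> a; apply: cint_ge0 => //; exact: cont2_row.
Qed.

Lemma iint_le F G : cont2 F -> cont2 G -> (forall a b, F a b <= G a b) ->
  iint F <= iint G.
Proof.
move=> cF cG FG; rewrite -subr_ge0 -iintB //; apply: iint_ge0.
  by apply: cont2D => //; exact: cont2N.
by move=> a b; rewrite subr_ge0.
Qed.

Lemma iint_abs F G : cont2 F -> cont2 G -> (forall a b, `|F a b| <= G a b) ->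
  `|iint F| <= iint G.
Proof.
move=> cF cG FG; rewrite ler_norml -(iintN cG); apply/andP; split.
  apply: iint_le => //; first exact: cont2N.
  by move=> a b; have := FG a b; rewrite ler_norml => /andP[].
by apply: iint_le => // a b; exact: le_trans (ler_norm _) (FG a b).
Qed.

Lemma cint_cst (c : R) : cint (fun=> c) = c * (2 * pi).
Proof.
rewrite (@cint_FTC _ _ (fun t => c * t)); first by rewrite mulr0 subr0.
  by move=> t; exact: cvg_cst.
move=> t _; apply: (der_eq (derM (der_cst c t) (der_id t))) => //.
by rewrite mul0r add0r mulr1.
Qed.

Lemma iint_cst (c : R) : iint (fun _ _ => c) = c * (2 * pi) ^+ 2.
Proof. by rewrite /iint !cint_cst -mulrA expr2. Qed.

Lemma in_period f : (forall t, f (t + 2 * pi) = f t) ->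
  forall x, exists2 t, 0 <= t <= 2 * pi & f t = f x.
Proof.
move=> pf x; have k0 := tau_gt0 R.
have pn (n : nat) y : f (y + n%:R * (2 * pi)) = f y.
  elim: n y => [|n IH] y; first by rewrite mul0r addr0.
  by rewrite -natr1 mulrDl mul1r addrA pf IH.
pose z := Num.floor (x / (2 * pi)).
exists (x - z%:~R * (2 * pi)).
  have /andP[z1 z2] := floor_itv (x / (2 * pi)); rewrite -/z in z1 z2.
  rewrite subr_ge0 -ler_pdivlMr // z1 /= lerBlDr.
  by have := ltW z2; rewrite ler_pdivrMr // intrD mulrDl mul1r addrC.
case: z => n; first by rewrite -(pn n (x - _)) subrK.
by rewrite NegzE mulrNz mulNr opprK pn.
Qed.

Lemma iint_eq0 F : cont2 F -> (forall a b, 0 <= F a b) ->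
  (forall a b, F (a + 2 * pi) b = F a b) -> (forall a b, F a (b + 2 * pi) = F a b) ->
  iint F = 0 -> forall a b, F a b = 0.
Proof.
move=> cF F0 p1 p2 e a b.
have [b' b0 <-] := in_period (p2 a) b.
have [a' a0 <-] := @in_period (fun x => F x b') (fun x => p1 x b') a.
have H : cint (F a') = 0.
  apply: (cint_eq0 (cint_continuous cF)) => // x.
  by apply: cint_ge0 => //; exact: cont2_row.
by apply: (cint_eq0 _ _ H) => //; exact: cont2_row.
Qed.

Lemma iint_d1 F F1 F2 : C1T F F1 F2 -> iint F1 = 0.
Proof.
move=> [cF cF1 _ d1 _ p1 _].
rewrite /iint (@cint_FTC _ _ (fun a => cint (F a))).
- apply/eqP; rewrite subr_eq0; apply/eqP; apply: cint_ext => b.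
  by rewrite -(p1 0) add0r.
- exact: cint_continuous.
- by move=> a _; exact: der_cint.
Qed.

Lemma iint_d2 F F1 F2 : C1T F F1 F2 -> iint F2 = 0.
Proof.
move=> [_ _ cF2 _ d2 _ p2]; rewrite /iint.
transitivity (@cint R (fun=> 0)); last by rewrite cint_cst mul0r.
apply: cint_ext => a; rewrite (@cint_FTC _ _ (F a)).
- by rewrite -(p2 a 0) add0r subrr.
- exact: cont2_row.
- by [].
Qed.

End Torus.

(** * Fourier modes on the circle *)

Section Circle.
Variable R : realType.
Implicit Types (f g h u v : R -> R).

Lemma ctsD f g : continuous f -> continuous g -> continuous (fun t : R => f t + g t).
Proof. by move=> cf cg t; apply: cvgD; [exact: cf|exact: cg]. Qed.

Lemma ctsN f : continuous f -> continuous (fun t : R => - f t).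
Proof. by move=> cf t; apply: cvgN; exact: cf. Qed.

Lemma ctsM f g : continuous f -> continuous g -> continuous (fun t : R => f t * g t).
Proof. by move=> cf cg t; apply: cvgM; [exact: cf|exact: cg]. Qed.

Lemma cts_cst (c : R) : continuous (fun _ : R => c).
Proof. by move=> t; exact: cvg_cst. Qed.

Lemma cts_id : continuous (fun t : R => t).
Proof. by move=> t; exact: cvg_id. Qed.

Lemma cts_shift f (x : R) : continuous f -> continuous (fun t : R => f (x + t)).
Proof.
move=> cf t; apply: (@cvg_comp _ _ _ (fun t : R => x + t) f); last exact: cf.
by apply: cvgD; [exact: cvg_cst|exact: cvg_id].
Qed.

Record C1per f f' : Prop := MkC1per {
  C1per_cts : continuous f;
  C1per_cts' : continuous f';
  C1per_der : forall t, der f t (f' t);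
  C1per_per : forall t, f (t + 2 * pi) = f t }.

Lemma C1per_per' f f' : C1per f f' -> forall t, f' (t + 2 * pi) = f' t.
Proof.
move=> [_ _ df pf] t; apply: (der_unique (f := f) _ (df t)).
apply: (der_eq (der_comp (df _) (derD (der_id t) (der_cst (2 * pi) t)))) => //.
by rewrite addr0 mulr1.
Qed.

Lemma C1perD f f' g g' : C1per f f' -> C1per g g' ->
  C1per (fun t => f t + g t) (fun t => f' t + g' t).
Proof.
move=> [? ? df pf] [? ? dg pg].
by split=> *; rewrite ?pf ?pg //; try exact: ctsD; apply: derD.
Qed.

Lemma C1perM f f' g g' : C1per f f' -> C1per g g' ->
  C1per (fun t => f t * g t) (fun t => f' t * g t + f t * g' t).
Proof.
move=> [? ? df pf] [? ? dg pg].
split=> *; rewrite ?pf ?pg //; try exact: ctsM.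
  by apply: ctsD; exact: ctsM.
by apply: derM; [exact: df|exact: dg].
Qed.

Lemma C1per_cst c : C1per (fun=> c) (fun=> 0).
Proof. by split=> [||t|//]; [exact: cts_cst|exact: cts_cst|exact: der_cst]. Qed.

Lemma C1per_ext f f' g g' : C1per f f' -> (forall t, f t = g t) ->
  (forall t, f' t = g' t) -> C1per g g'.
Proof. by move=> H /funext <- /funext <-. Qed.

Lemma C1perZ c f f' : C1per f f' -> C1per (fun t => c * f t) (fun t => c * f' t).
Proof.
move=> H; apply: (C1per_ext (C1perM (C1per_cst c) H)) => // t.
by rewrite mul0r add0r.
Qed.

Lemma C1perT f f' x : C1per f f' ->
  C1per (fun t => f (x + t)) (fun t => f' (x + t)).
Proof.
move=> [? ? df pf]; split; try exact: cts_shift.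
  move=> t; apply: (der_eq (der_comp (df _) (derD (der_cst x t) (der_id t)))) => //.
  by rewrite add0r mulr1.
by move=> t; rewrite addrA pf.
Qed.

Definition ip f g : R := cint (fun t => f t * g t).

Lemma ipC f g : ip f g = ip g f.
Proof. by apply: cint_ext => t; rewrite mulrC. Qed.

Lemma ipDr f g h : continuous f -> continuous g -> continuous h ->
  ip f (fun t => g t + h t) = ip f g + ip f h.
Proof.
move=> *; rewrite /ip -cintD; try exact: ctsM.
by apply: cint_ext => t; rewrite mulrDr.
Qed.

Lemma ipZr c f g : continuous f -> continuous g ->
  ip f (fun t => c * g t) = c * ip f g.
Proof.
move=> *; rewrite /ip -cintZ; last exact: ctsM.
by apply: cint_ext => t; rewrite mulrCA.
Qed.

Lemma ipDl f g h : continuous f -> continuous g -> continuous h ->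
  ip (fun t => f t + g t) h = ip f h + ip g h.
Proof. by move=> *; rewrite ipC ipDr // !(ipC h). Qed.

Lemma ipZl c f g : continuous f -> continuous g ->
  ip (fun t => c * f t) g = c * ip f g.
Proof. by move=> *; rewrite ipC ipZr // (ipC g). Qed.

Lemma ip_ge0 f : continuous f -> 0 <= ip f f.
Proof. by move=> *; apply: cint_ge0 => [|t]; [exact: ctsM|rewrite -expr2 sqr_ge0]. Qed.

Lemma ip_CauchySchwarz f g : continuous f -> continuous g ->
  ip f g ^+ 2 <= ip f f * ip g g.
Proof.
move=> cf cg.
have E x y : 0 <= x ^+ 2 * ip f f + 2 * x * y * ip f g + y ^+ 2 * ip g g.
  rewrite (_ : _ + _ = ip (fun t => x * f t + y * g t) (fun t => x * f t + y * g t)).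
    by apply: ip_ge0; apply: ctsD; apply: ctsM => //; exact: cts_cst.
  have c1 : continuous (fun t => x * f t) by apply: ctsM => //; exact: cts_cst.
  have c2 : continuous (fun t => y * g t) by apply: ctsM => //; exact: cts_cst.
  rewrite ipDl ?ipDr //; last exact: ctsD.
  by rewrite !ipZl // !ipZr // (ipC g f); ring.
have A0 := ip_ge0 cf; have C0 := ip_ge0 cg.
move: (ip f f) (ip g g) (ip f g) A0 C0 E => A C B A0 C0 E.
have [C1|C1] := eqVneq C 0; last first.
  have Cp : 0 < C by rewrite lt_neqAle eq_sym C1.
  have := E C (- B); rewrite (_ : _ + _ = C * (A * C - B ^+ 2)); last by ring.
  by rewrite pmulr_rge0 // subr_ge0.
have [A1|A1] := eqVneq A 0.
  have := E 1 (- B); rewrite A1 C1 mul0r => h.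
  have {h} := h; rewrite (_ : _ + _ = - 2 * B ^+ 2); last by ring.
  by rewrite mulNr oppr_ge0 pmulr_rle0.
have Ap : 0 < A by rewrite lt_neqAle eq_sym A1.
have := E (- B) A; rewrite C1 (_ : _ + _ = A * (- B ^+ 2)); last by ring.
by rewrite pmulr_rge0 // mulr0 oppr_ge0.
Qed.

Lemma cint_der0 f f' : C1per f f' -> cint f' = 0.
Proof.
move=> [_ cf' df pf]; rewrite (@cint_FTC _ _ f) //.
by rewrite -(pf 0) add0r subrr.
Qed.

Lemma ip_parts f f' g g' : C1per f f' -> C1per g g' -> ip f' g = - ip f g'.
Proof.
move=> Hf Hg; have := cint_der0 (C1perM Hf Hg).
rewrite cintD; first by move/eqP; rewrite addr_eq0 => /eqP.
- by apply: ctsM; [exact: C1per_cts' Hf|exact: C1per_cts Hg].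
- by apply: ctsM; [exact: C1per_cts Hf|exact: C1per_cts' Hg].
Qed.

Definition cs (n : nat) (t : R) : R := cos (n%:R * t).
Definition sn (n : nat) (t : R) : R := sin (n%:R * t).

Lemma pi2E : 2 * pi = pi *+ 2 :> R. Proof. by rewrite mulr_natl. Qed.

Let cs_per n t : cs n (t + 2 * pi) = cs n t.
Proof.
rewrite /cs mulrDr [n%:R * (2 * pi)]mulr_natl pi2E; exact: (periodicn (@cosD2pi R)).
Qed.

Let sn_per n t : sn n (t + 2 * pi) = sn n t.
Proof.
rewrite /sn mulrDr [n%:R * (2 * pi)]mulr_natl pi2E; exact: (periodicn (@sinD2pi R)).
Qed.

Lemma der_scale (c t : R) : der (fun t => c * t) t c.
Proof.
apply: (der_eq (derM (der_cst c t) (der_id t))) => //.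
by rewrite mul0r add0r mulr1.
Qed.

Lemma der_cs n t : der (cs n) t (- (n%:R * sn n t)).
Proof.
apply: (der_eq (der_comp (is_derive_cos _) (der_scale n%:R t))) => //.
by rewrite mulNr mulrC.
Qed.

Lemma der_sn n t : der (sn n) t (n%:R * cs n t).
Proof.
apply: (der_eq (der_comp (is_derive_sin _) (der_scale n%:R t))) => //.
by rewrite mulrC.
Qed.

Lemma cts_cs n : continuous (cs n).
Proof. by move=> t; exact: der_cts (der_cs n t). Qed.
Lemma cts_sn n : continuous (sn n).
Proof. by move=> t; exact: der_cts (der_sn n t). Qed.

Lemma C1per_cs n : C1per (cs n) (fun t => - (n%:R * sn n t)).
Proof.
split; [exact: cts_cs| |exact: der_cs|exact: cs_per].
by apply: ctsN; apply: ctsM; [exact: cts_cst|exact: cts_sn].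
Qed.

Lemma C1per_sn n : C1per (sn n) (fun t => n%:R * cs n t).
Proof.
split; [exact: cts_sn| |exact: der_sn|exact: sn_per].
by apply: ctsM; [exact: cts_cst|exact: cts_cs].
Qed.

(** The second derivative is self-adjoint, by two integrations by parts. *)
Lemma eigen_orth u u' v v' (x y : R) : x != y ->
  C1per u u' -> C1per u' (fun t => - x * u t) ->
  C1per v v' -> C1per v' (fun t => - y * v t) -> ip u v = 0.
Proof.
move=> xy Hu Hu' Hv Hv'.
have [cu _ _ _] := Hu; have [cv _ _ _] := Hv.
have : - x * ip u v = - y * ip u v.
  rewrite -(ipZr (- y)) // -(ipZl (- x)) //.
  by rewrite (ip_parts Hu' Hv) (ip_parts Hu Hv') opprK.
move/eqP; rewrite !mulNr eqr_opp -subr_eq0 -mulrBl mulf_eq0 subr_eq0 (negPf xy) /=.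
by move/eqP.
Qed.

Let cs'_C1 n : C1per (fun t => - (n%:R * sn n t)) (fun t => - n%:R ^+ 2 * cs n t).
Proof.
apply: (C1per_ext (C1perZ (- n%:R) (C1per_sn n))) => t; first by rewrite mulNr.
by ring.
Qed.

Let sn'_C1 n : C1per (fun t => n%:R * cs n t) (fun t => - n%:R ^+ 2 * sn n t).
Proof.
apply: (C1per_ext (C1perZ n%:R (C1per_cs n))) => // t.
by ring.
Qed.

Let sq_neq m n : m != n -> m%:R ^+ 2 != n%:R ^+ 2 :> R.
Proof. by move=> mn; rewrite -!natrX eqr_nat eqn_exp2r. Qed.

Lemma cs_cs0 m n : m != n -> ip (cs m) (cs n) = 0.
Proof.
move=> mn; exact: eigen_orth (sq_neq mn) (C1per_cs m) (cs'_C1 m) (C1per_cs n) (cs'_C1 n).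
Qed.

Lemma sn_sn0 m n : m != n -> ip (sn m) (sn n) = 0.
Proof.
move=> mn; exact: eigen_orth (sq_neq mn) (C1per_sn m) (sn'_C1 m) (C1per_sn n) (sn'_C1 n).
Qed.

Lemma cs_sn0 m n : ip (cs m) (sn n) = 0.
Proof.
have [<-|mn] := eqVneq m n; last first.
  exact: eigen_orth (sq_neq mn) (C1per_cs m) (cs'_C1 m) (C1per_sn n) (sn'_C1 n).
have [->|m0] := eqVneq m 0%N.
  rewrite /ip (@cint_ext _ _ (fun=> 0)) ?cint_cst ?mul0r // => t.
  by rewrite /sn mul0r sin0 mulr0.
have := ip_parts (C1per_sn m) (C1per_sn m).
rewrite (ipZl _ (@cts_cs m) (@cts_sn m)) (ipZr _ (@cts_sn m) (@cts_cs m)) (ipC (sn m)).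
move/eqP; rewrite -subr_eq0 opprK -mulr2n mulrn_eq0 /= mulf_eq0 pnatr_eq0 (negPf m0) /=.
by move/eqP.
Qed.

(** Differentiation exchanges the two modes, so their norms agree, and the sum
    of their squares is 1. *)
Lemma mode_norm n : (0 < n)%N -> ip (cs n) (cs n) = pi /\ ip (sn n) (sn n) = pi.
Proof.
move=> n0; have nz : (n%:R : R) != 0 by rewrite pnatr_eq0 -lt0n.
have e : ip (cs n) (cs n) = ip (sn n) (sn n).
  apply: (mulfI nz); have := ip_parts (C1per_sn n) (C1per_cs n).
  rewrite (ipZl _ (@cts_cs n) (@cts_cs n)) => ->.
  rewrite (_ : (fun t => _) = fun t => - n%:R * sn n t); last first.
    by apply/funext => t; rewrite mulNr.
  by rewrite (ipZr _ (@cts_sn n) (@cts_sn n)) mulNr opprK.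
have : ip (cs n) (cs n) + ip (sn n) (sn n) = 2 * pi.
  rewrite /ip -cintD; try by apply: ctsM; solve [exact: cts_cs|exact: cts_sn].
  rewrite (@cint_ext _ _ (fun=> 1)) ?cint_cst ?mul1r // => t.
  by rewrite -!expr2 cos2Dsin2.
by rewrite e; split; lra.
Qed.

Lemma cs0 t : cs 0 t = 1. Proof. by rewrite /cs mul0r cos0. Qed.
Lemma sn0 t : sn 0 t = 0. Proof. by rewrite /sn mul0r sin0. Qed.

End Circle.
(** * Spectral gap on the circle *)

Section CircleGap.
Variable R : realType.
Implicit Types (f g : R -> R).

(** The Fourier series of the sawtooth [t - pi] on [(0, 2 pi)] is
    [- sum_k 2 / k sin (k t)]; here its first [N] terms are removed. *)
Definition kernel (N : nat) (t : R) : R :=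
  t - pi + \sum_(k < N) 2 / k.+1%:R * sn k.+1 t.

Lemma kernelS N t : kernel N.+1 t = kernel N t + 2 / N.+1%:R * sn N.+1 t.
Proof. by rewrite /kernel big_ord_recr /= addrA. Qed.

Lemma kernel0 t : kernel 0 t = t - pi.
Proof. by rewrite /kernel big_ord0 addr0. Qed.

Lemma cts_saw : continuous (fun t : R => t - pi).
Proof. by apply: ctsD; [exact: cts_id|exact: cts_cst]. Qed.

Lemma cts_kernel N : continuous (kernel N).
Proof.
elim: N => [|N IH].
  by rewrite (_ : kernel 0 = fun t => t - pi); [exact: cts_saw|apply/funext; exact: kernel0].
rewrite (_ : kernel N.+1 = fun t => kernel N t + 2 / N.+1%:R * sn N.+1 t).
  by apply: ctsD => //; apply: ctsM; [exact: cts_cst|exact: cts_sn].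
by apply/funext; exact: kernelS.
Qed.

Let cts_csn (c : R) N : continuous (fun t : R => c * sn N t).
Proof. by apply: ctsM; [exact: cts_cst|exact: cts_sn]. Qed.

Let kernelSE N : kernel N.+1 = fun t => kernel N t + 2 / N.+1%:R * sn N.+1 t.
Proof. by apply/funext; exact: kernelS. Qed.

Let kernel0E : kernel 0 = fun t => t - pi.
Proof. by apply/funext; exact: kernel0. Qed.

Lemma sn_2pi n : sn n (2 * pi) = 0 :> R.
Proof. by rewrite -[2 * pi]add0r (C1per_per (C1per_sn R n)) /sn mulr0 sin0. Qed.

Lemma cs_2pi n : cs n (2 * pi) = 1 :> R.
Proof. by rewrite -[2 * pi]add0r (C1per_per (C1per_cs R n)) /cs mulr0 cos0. Qed.

Lemma kernel_sn N m : (N < m)%N -> ip (kernel N) (sn m) = - 2 * pi / m%:R.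
Proof.
elim: N => [|N IH] Nm; last first.
  rewrite kernelSE ipDl; [|exact: cts_kernel|exact: cts_csn|exact: cts_sn].
  rewrite IH 1?ltnW // ipZl; [|exact: cts_sn|exact: cts_sn].
  by rewrite sn_sn0 ?mulr0 ?addr0 // neq_ltn Nm.
have m0 : (m%:R : R) != 0 by rewrite pnatr_eq0 -lt0n.
pose P (t : R) := - (t - pi) * cs m t / m%:R + sn m t / m%:R ^+ 2.
rewrite kernel0E /ip (@cint_FTC _ _ P); last 2 first.
- by apply: ctsM; [exact: cts_saw|exact: cts_sn].
- move=> t _; rewrite /P.
  have d1 := derN (derD (der_id t) (der_cst (- pi) t)).
  have d2 := derM (derM d1 (der_cs m t)) (der_cst m%:R^-1 t).
  apply: (der_eq (derD d2 (derM (der_sn m t) (der_cst (m%:R^-1 ^+ 2) t)))) => [s|].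
    by rewrite exprVn.
  by field.
rewrite /P sn_2pi cs_2pi /cs /sn !mulr0 cos0 sin0.
by field.
Qed.

(** Each step of the induction is Pythagoras: the removed term is the orthogonal
    projection onto its mode. *)
Lemma kernel_norm N :
  ip (kernel N) (kernel N) = 2 * pi ^+ 3 / 3 - 4 * pi * \sum_(k < N) (k.+1%:R ^- 2).
Proof.
elim: N => [|N IH].
  rewrite big_ord0 mulr0 subr0 kernel0E /ip.
  rewrite (@cint_FTC _ _ (fun t => (t - pi) ^+ 3 / 3)); first by field.
    by apply: ctsM; exact: cts_saw.
  move=> t _; have d := derD (der_id t) (der_cst (- pi) t).
  by apply: (der_eq (derM (derM (derM d d) d) (der_cst 3^-1 t))) => [s|]; field.
have n0 : (N.+1%:R : R) != 0 by rewrite pnatr_eq0.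
have cK := @cts_kernel N; have cS : continuous (fun t : R => 2 / N.+1%:R * sn N.+1 t).
  exact: cts_csn.
rewrite kernelSE; set S := (fun t : R => 2 / N.+1%:R * sn N.+1 t) in cS *.
rewrite (@ipDl _ (kernel N) S) //; last exact: ctsD.
rewrite (@ipDr _ (kernel N) (kernel N) S) // (@ipDr _ S (kernel N) S) // /S.
rewrite IH (ipC _ (kernel N)) !ipZr //; try exact: cts_sn.
rewrite kernel_sn // ipZl; try exact: cts_sn.
have [_ ->] := mode_norm R (ltn0Sn N).
rewrite big_ord_recr /=.
by field.
Qed.

Definition perp (N : nat) f : Prop :=
  forall m, (m <= N)%N -> ip f (cs m) = 0 /\ ip f (sn m) = 0.

Lemma C1per_int f f' x : C1per f f' -> 0 <= x -> cint (fun t => f (x + t)) = cint f.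
Proof. by move=> [cf _ _ pf] x0; exact: cint_shift. Qed.

(** The sawtooth is a primitive of [1] minus a multiple of the Dirac mass at the
    ends of the period, so integrating by parts recovers the value of [f] there. *)
Lemma saw_rep f f' x : C1per f f' -> 0 <= x ->
  ip (fun t => t - pi) (fun t => f' (x + t)) = 2 * pi * f x - cint f.
Proof.
move=> Hf x0; have [cf cf' df pf] := C1perT x Hf.
have c2 : continuous (fun t : R => (t - pi) * f' (x + t)) by apply: ctsM; [exact: cts_saw|].
apply/eqP; rewrite eq_sym subr_eq -(C1per_int Hf x0); apply/eqP.
rewrite /ip -cintD // (@cint_FTC _ _ (fun t => (t - pi) * f (x + t))).
- by have := pf 0; rewrite add0r => ->; rewrite addr0; ring.
- exact: ctsD.
- move=> t _; apply: (der_eq (derM (derD (der_id t) (der_cst (- pi) t)) (df t))) => //.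
  by ring.
Qed.

Lemma perp_shift N f f' x m : C1per f f' -> perp N f -> (m <= N)%N -> 0 <= x ->
  ip (fun t => f (x + t)) (cs m) = 0.
Proof.
move=> Hf pf mN x0; have [pc ps] := pf _ mN; have [cf _ _ _] := Hf.
have Hcs : C1per (fun t => cs m (t - x)) (fun t => - (m%:R * sn m (t - x))).
  by apply: (C1per_ext (C1perT (- x) (C1per_cs R m))) => t; rewrite addrC.
have H := C1perM Hf Hcs.
rewrite /ip (@cint_ext _ _ (fun t => f (x + t) * cs m (x + t - x))); last first.
  by move=> t; rewrite [x + t]addrC addrK.
rewrite (C1per_int H x0).
rewrite (@cint_ext _ _ (fun t => f t * (cs m x * cs m t + sn m x * sn m t))).
  have c1 (c : R) : continuous (fun t : R => c * cs m t).
    by apply: ctsM; [exact: cts_cst|exact: cts_cs].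
  rewrite -/(ip f _) ipDr // !ipZr //; try solve [exact: cts_cs|exact: cts_sn].
  by rewrite pc ps !mulr0 addr0.
by move=> t; rewrite /cs /sn mulrBr cosB; ring.
Qed.

(** The removed terms do not contribute: the derivative of a function without
    low modes has no low modes either. *)
Lemma kernel_rep N f f' x : C1per f f' -> perp N f -> 0 <= x ->
  ip (kernel N) (fun t => f' (x + t)) = 2 * pi * f x.
Proof.
move=> Hf pf x0; have [cf cf' _ _] := C1perT x Hf.
have int0 : cint f = 0.
  have [e _] := pf 0%N isT; rewrite -e; apply: cint_ext => t; by rewrite cs0 mulr1.
suff H n : (n <= N)%N -> ip (kernel n) (fun t => f' (x + t)) = 2 * pi * f x by exact: H.
elim: n => [|n IH] nN; first by rewrite kernel0E (saw_rep Hf x0) int0 subr0.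
rewrite kernelSE ipDl //; try solve [exact: cts_kernel|exact: cts_csn].
rewrite IH 1?ltnW // ipZl //; last exact: cts_sn.
rewrite ipC (ip_parts (C1perT x Hf) (C1per_sn R n.+1)) ipZr //; last exact: cts_cs.
by rewrite (perp_shift Hf pf nN x0) mulr0 oppr0 mulr0 addr0.
Qed.

(** Cauchy-Schwarz in the representation formula bounds the supremum, hence
    the mean square. *)
Lemma kernel_gap N f f' : C1per f f' -> perp N f ->
  2 * pi * ip f f <= ip (kernel N) (kernel N) * ip f' f'.
Proof.
move=> Hf pf; have [cf cf' _ per] := Hf; have p0 := pi_gt0 R.
pose M := ip (kernel N) (kernel N) * ip f' f'; rewrite -/M.
have bnd x : (2 * pi * f x) ^+ 2 <= M.
  have [t /andP[t0 _] <-] := in_period per x.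
  have [_ c _ _] := C1perT t Hf.
  rewrite -(kernel_rep Hf pf t0); apply: (le_trans (ip_CauchySchwarz (@cts_kernel N) c)).
  suff -> : ip (fun s => f' (t + s)) (fun s => f' (t + s)) = ip f' f' by [].
  have c2 : continuous (fun s => f' s * f' s) by exact: ctsM.
  apply: (cint_shift c2 _ t0) => s; by rewrite !(C1per_per' Hf).
clearbody M; have cff : continuous (fun t : R => f t * f t) by exact: ctsM.
have : 0 <= cint (fun t => M + (- (2 * pi) ^+ 2) * (f t * f t)).
  apply: cint_ge0 => [|t].
    by apply: ctsD; [exact: cts_cst|apply: ctsM => //; exact: cts_cst].
  by have := bnd t; rewrite -subr_ge0; congr (_ <= _); ring.
rewrite cintD; try exact: cts_cst; last by apply: ctsM => //; exact: cts_cst.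
rewrite cintZ // cint_cst -/(ip f f).
have -> : M * (2 * pi) + - (2 * pi) ^+ 2 * ip f f = (2 * pi) * (M - 2 * pi * ip f f) by ring.
by rewrite pmulr_rge0 ?subr_ge0 // mulr_gt0.
Qed.

End CircleGap.
Section CircleModes.
Variable R : realType.
Implicit Types (f g u v : R -> R).

(** Only [gap > 2] matters, with [2] the eigenvalue studied later; the next
    eigenvalue is [4].  The value is what five removed modes and the bound
    [pi <= 16 / 5] allow. *)
Definition gap : R := 41 / 20.

Lemma sin_le_id (x : R) : 0 <= x -> sin x <= x.
Proof.
move=> x0; have := @der_ge0_le R (fun t => t - sin t) (fun t => 1 - cos t) 0 x x0.
rewrite sin0 subrr subr_ge0; apply => t _; last by rewrite subr_ge0 cos_le1.
by apply: (derD (der_id t)); apply: derN; exact: is_derive_sin.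
Qed.

Let derX (n : nat) (t : R) : der (fun t => t ^+ n.+1) t (n.+1%:R * t ^+ n).
Proof.
elim: n => [|n IH].
  by apply: (der_eq (der_id t)) => [s|]; rewrite ?expr1 // expr0 mulr1.
apply: (der_eq (derM (der_id t) IH)) => [s|]; first by rewrite [RHS]exprS.
by rewrite mul1r mulrCA -exprS -[in RHS]natr1 mulrDl mul1r addrC.
Qed.

Lemma cos_ge_taylor (x : R) : 0 <= x -> 1 - x ^+ 2 / 2 <= cos x.
Proof.
move=> x0; have := @der_ge0_le R (fun t => cos t + t ^+ 2 / 2) (fun t => t - sin t) 0 x x0.
rewrite cos0 expr0n /= mul0r addr0 lerBlDr; apply => t.
  move=> _; apply: (der_eq (derD (is_derive_cos t) (derM (derX 1 t) (der_cst 2^-1 t)))) => //.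
  by rewrite expr1; field.
by move=> /andP[t0 _]; rewrite subr_ge0 sin_le_id.
Qed.

Lemma sin_ge_taylor (x : R) : 0 <= x -> x - x ^+ 3 / 6 <= sin x.
Proof.
move=> x0; have := @der_ge0_le R (fun t => sin t + t ^+ 3 / 6 - t)
  (fun t => cos t + t ^+ 2 / 2 - 1) 0 x x0.
rewrite sin0 expr0n /= mul0r !addr0 subrr => H; suff : 0 <= sin x + x ^+ 3 / 6 - x by lra.
apply: H => t.
  move=> _; apply: (der_eq (derD (derD (is_derive_sin t) (derM (derX 2 t) (der_cst 6^-1 t)))
     (derN (der_id t)))) => //.
  by field.
by move=> /andP[t0 _]; have := cos_ge_taylor t0; lra.
Qed.

Lemma cos_le_taylor (x : R) : 0 <= x -> cos x <= 1 - x ^+ 2 / 2 + x ^+ 4 / 24.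
Proof.
move=> x0; have := @der_ge0_le R (fun t => 1 - t ^+ 2 / 2 + t ^+ 4 / 24 - cos t)
  (fun t => sin t - t + t ^+ 3 / 6) 0 x x0.
rewrite cos0 !expr0n /= !mul0r subr0 addr0 subrr => H.
suff : 0 <= 1 - x ^+ 2 / 2 + x ^+ 4 / 24 - cos x by lra.
apply: H => t.
  move=> _; apply: (der_eq (derD (derD (derD (der_cst 1 t)
    (derN (derM (derX 1 t) (der_cst 2^-1 t)))) (derM (derX 3 t) (der_cst 24^-1 t)))
     (derN (is_derive_cos t)))) => //.
  by field.
by move=> /andP[t0 _]; have := sin_ge_taylor t0; lra.
Qed.

(** Otherwise [8 / 5] would lie below [pi / 2] although the Taylor bound there is
    negative. *)
Lemma pi_le : pi <= 16 / 5 :> R.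
Proof.
rewrite leNgt; apply/negP => h.
have : cos (8 / 5 : R) <= 1 - (8 / 5) ^+ 2 / 2 + (8 / 5) ^+ 4 / 24 by apply: cos_le_taylor; lra.
have : 0 < cos (8 / 5 : R) by apply: cos_gt0_pihalf; apply/andP; split; lra.
lra.
Qed.

(** The component of [f] orthogonal to [u]. *)
Definition out f u : R -> R := fun t => f t + (- (ip f u / ip u u)) * u t.

Lemma cts_out f u : continuous f -> continuous u -> continuous (out f u).
Proof. by move=> cf cu; apply: ctsD => //; apply: ctsM => //; exact: cts_cst. Qed.

Lemma ip_out f u v : continuous f -> continuous u -> continuous v ->
  ip (out f u) v = ip f v - ip f u / ip u u * ip u v.
Proof.
move=> cf cu cv; have cau : continuous (fun t => (- (ip f u / ip u u)) * u t).
  by apply: ctsM => //; exact: cts_cst.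
by rewrite (ipDl cf cau cv) (ipZl _ cu cv) mulNr.
Qed.

Lemma out_norm f u : continuous f -> continuous u -> ip u u != 0 ->
  ip (out f u) (out f u) = ip f f - ip f u ^+ 2 / ip u u.
Proof.
move=> cf cu u0; rewrite ip_out ?(ipC f (out f u)) ?(ipC u (out f u)) //; last exact: cts_out.
by rewrite !ip_out // (ipC u f); field.
Qed.

Lemma C1per_out f f' u u' : C1per f f' -> C1per u u' ->
  C1per (out f u) (fun t => f' t + (- (ip f u / ip u u)) * u' t).
Proof. by move=> Hf Hu; exact: (C1perD Hf (C1perZ _ Hu)). Qed.

Definition out_modes n f : R -> R := out (out f (cs n)) (sn n).

Section Modes.
Variables (n : nat) (n0 : (0 < n)%N).

Let cc := (mode_norm R n0).1.
Let ss := (mode_norm R n0).2.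
Let p0 : (pi : R) != 0. Proof. by rewrite gt_eqF // pi_gt0. Qed.

Lemma cts_out_modes f : continuous f -> continuous (out_modes n f).
Proof.
by move=> cf; apply: cts_out (@cts_sn R n); exact: cts_out cf (@cts_cs R n).
Qed.

Lemma ip_out_modes f v : continuous f -> continuous v ->
  ip (out_modes n f) v =
  ip f v - ip f (cs n) / pi * ip (cs n) v - ip f (sn n) / pi * ip (sn n) v.
Proof.
move=> cf cv; have cC := @cts_cs R n; have cS := @cts_sn R n.
have c1 := cts_out cf cC.
by rewrite /out_modes (ip_out c1 cS cv) (ip_out cf cC cv) (ip_out cf cC cS) cc ss cs_sn0
           mulr0 subr0.
Qed.

Lemma out_modesE f t : continuous f ->
  out_modes n f t = f t + - (ip f (cs n) / pi) * cs n t + - (ip f (sn n) / pi) * sn n t.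
Proof.
move=> cf; have cC := @cts_cs R n; have cS := @cts_sn R n.
have e : ip (out f (cs n)) (sn n) = ip f (sn n).
  by rewrite (ip_out cf cC cS) cs_sn0 mulr0 subr0.
by rewrite /out_modes {1}/out e ss {1}/out cc.
Qed.

Lemma out_modes_norm f : continuous f ->
  ip (out_modes n f) (out_modes n f) =
  ip f f - (ip f (cs n) ^+ 2 + ip f (sn n) ^+ 2) / pi.
Proof.
move=> cf; have cC := @cts_cs R n; have cS := @cts_sn R n.
have c1 := cts_out cf cC.
rewrite /out_modes (out_norm c1 cS) ?ss // (ip_out cf cC cS) (out_norm cf cC) ?cc //.
by rewrite cs_sn0 mulr0 subr0 mulrDl opprD addrA.
Qed.

Lemma ip_der_cs f f' : C1per f f' -> ip f' (cs n) = n%:R * ip f (sn n).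
Proof.
move=> Hf; rewrite (ip_parts Hf (C1per_cs R n)).
rewrite (_ : (fun t => - _) = fun t => - n%:R * sn n t); last first.
  by apply/funext => t; rewrite mulNr.
rewrite ipZr; first by rewrite mulNr opprK.
  by have [] := Hf.
exact: cts_sn.
Qed.

Lemma ip_der_sn f f' : C1per f f' -> ip f' (sn n) = - n%:R * ip f (cs n).
Proof.
move=> Hf; rewrite (ip_parts Hf (C1per_sn R n)) ipZr ?mulNr //.
  by have [] := Hf.
exact: cts_cs.
Qed.

Lemma der_out_modes_norm f f' : C1per f f' ->
  ip (out_modes n f') (out_modes n f') =
  ip f' f' - ((n%:R * ip f (sn n)) ^+ 2 + (- n%:R * ip f (cs n)) ^+ 2) / pi.
Proof.
move=> Hf; have [_ cf' _ _] := Hf; apply: (etrans (out_modes_norm cf')).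
by congr (_ - (_ ^+ 2 + _ ^+ 2) / pi); [exact: ip_der_cs|exact: ip_der_sn].
Qed.

Lemma C1per_out_modes f f' : C1per f f' -> C1per (out_modes n f) (out_modes n f').
Proof.
move=> Hf; have [cf cf' _ _] := Hf; have cC := @cts_cs R n; have cS := @cts_sn R n.
apply: (C1per_ext (C1per_out (C1per_out Hf (C1per_cs R n)) (C1per_sn R n))) => // t.
rewrite out_modesE // cc ss (ip_out cf cC cS) cs_sn0 (ip_der_cs Hf) (ip_der_sn Hf).
by rewrite mulr0 subr0; move: p0; generalize (pi : R) => p p1; field.
Qed.

Lemma perp_out_modes m f : continuous f ->
  (m != n -> ip f (cs m) = 0 /\ ip f (sn m) = 0) ->
  ip (out_modes n f) (cs m) = 0 /\ ip (out_modes n f) (sn m) = 0.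
Proof.
move=> cf H; rewrite (ip_out_modes cf (@cts_cs R m)) (ip_out_modes cf (@cts_sn R m)).
rewrite cs_sn0 (ipC (sn n) (cs m)) cs_sn0 !mulr0 !subr0.
have [->|mn] := eqVneq m n; first by rewrite cc ss !divfK // !subrr.
have nm : n != m by rewrite eq_sym.
by have [-> ->] := H mn; rewrite cs_cs0 // sn_sn0 // !mulr0 !subr0.
Qed.

End Modes.

Definition has_gap N := forall f f', C1per f f' -> perp N f -> gap * ip f f <= ip f' f'.

(** The squared norm of the kernel is
    [2 pi (pi ^ 2 / 3 - 2 (1 + 1 / 4 + 1 / 9 + 1 / 16 + 1 / 25))]. *)
Lemma has_gap5 : has_gap 5.
Proof.
move=> f f' Hf pf; have [cf cf' _ _] := Hf.
have := kernel_gap Hf pf; rewrite kernel_norm !big_ord_recr big_ord0 /=.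
have := ip_ge0 cf'; have p0 := pi_gt0 R; have p1 := pi_le.
move: (ip f f) (ip f' f') => A B B0; move: p0 p1; generalize (pi : R) => p p0 p1.
set S := (X in 4 * p * X); have -> : S = 5269 / 3600 by rewrite /S; field.
rewrite (_ : 2 * p ^+ 3 / 3 - _ = (2 * p) * (p ^+ 2 / 3 - 5269 / 1800)); last by field.
rewrite -!mulrA ler_pM2l // ler_pM2l // => H.
have p2 : p ^+ 2 <= 256 / 25 by nra.
have : (p ^+ 2 / 3 - 5269 / 1800) * B <= (20 / 41) * B by apply: ler_wpM2r => //; lra.
rewrite /gap; lra.
Qed.

Let subst_gap (P : Prop) (x y x' y' : R) : x = x' -> y = y' ->
  (P -> gap * x <= y) -> P -> gap * x' <= y'.
Proof. by move=> -> ->. Qed.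

(** The modes of frequency [n] are themselves above the gap as soon as
    [n ^ 2 >= gap], so they may be put back. *)
Lemma has_gap_pred n : (1 < n)%N -> has_gap n -> has_gap n.-1.
Proof.
move=> n1 G f f' Hf pf; have n0 : (0 < n)%N by exact: ltnW.
have [cf cf' _ _] := Hf.
have {}G := subst_gap (out_modes_norm n0 cf) (der_out_modes_norm n0 Hf)
  (G _ _ (C1per_out_modes n0 Hf)).
have {G} := G _; rewrite (_ : (_ * ip f (sn n)) ^+ 2 + _ =
  n%:R ^+ 2 * (ip f (cs n) ^+ 2 + ip f (sn n) ^+ 2)); last by ring.
set Z := ip f (cs n) ^+ 2 + _; have Z0 : 0 <= Z / pi.
  by rewrite divr_ge0 ?pi_ge0 // addr_ge0 ?sqr_ge0.
have nn : 4 <= n%:R ^+ 2 :> R.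
  by rewrite -natrX ler_nat (@leq_exp2r 2 n 2).
rewrite -mulrA => G; have {}G := G _.
suff : gap * (ip f f - Z / pi) <= ip f' f' - n%:R ^+ 2 * (Z / pi).
  have : gap * (Z / pi) <= n%:R ^+ 2 * (Z / pi) by apply: ler_wpM2r => //; rewrite /gap; lra.
  rewrite mulrBr; lra.
apply: G => m mn; apply: perp_out_modes => // mn'.
by apply: pf; rewrite -ltnS prednK // ltn_neqAle mn'.
Qed.

Lemma has_gap1 : has_gap 1.
Proof. by do 4!apply: (@has_gap_pred _.+2) => //; exact: has_gap5. Qed.

Let c00 : ip (cs 0) (cs 0) = 2 * pi :> R.
Proof.
by rewrite /ip (@cint_ext _ _ (fun=> 1)) ?cint_cst ?mul1r // => t; rewrite cs0 mulr1.
Qed.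

Let c00N : ip (cs 0) (cs 0) != 0 :> R.
Proof. by rewrite c00 gt_eqF // tau_gt0. Qed.

Let out01 f (r := out_modes 1 (out f (cs 0))) : continuous f -> ip r r =
  ip f f - ip f (cs 0) ^+ 2 / (2 * pi) - (ip f (cs 1) ^+ 2 + ip f (sn 1) ^+ 2) / pi.
Proof.
move=> cf; have c0 := @cts_cs R 0; have c1 := cts_out cf c0.
rewrite /r (out_modes_norm (ltn0Sn 0) c1) (out_norm cf c0 c00N).
rewrite (ip_out cf c0 (@cts_cs R 1)) (ip_out cf c0 (@cts_sn R 1)) (@cs_cs0 R 0 1) // cs_sn0.
by rewrite !mulr0 !subr0 c00.
Qed.

Lemma circle_Bessel f : continuous f ->
  ip f (cs 0) ^+ 2 / (2 * pi) + (ip f (cs 1) ^+ 2 + ip f (sn 1) ^+ 2) / pi <= ip f f.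
Proof.
move=> cf; rewrite -subr_ge0 opprD addrA -out01 //; apply: ip_ge0.
by apply: cts_out_modes => //; apply: cts_out => //; exact: cts_cs.
Qed.

(** The frequencies 0 and 1 are split off and accounted for by Pythagoras; on
    them the derivative acts as multiplication by the frequency. *)
Lemma circle_gap f f' : C1per f f' ->
  gap * ip f f <= ip f' f' + gap / (2 * pi) * ip f (cs 0) ^+ 2
    + (gap - 1) / pi * (ip f (cs 1) ^+ 2 + ip f (sn 1) ^+ 2).
Proof.
move=> Hf; have [cf cf' _ _] := Hf; have c0 := @cts_cs R 0; have c1 := cts_out cf c0.
have Hr : C1per (out f (cs 0)) f'.
  apply: (C1per_ext (C1per_out Hf (C1per_cs R 0))) => // t.
  by rewrite mul0r oppr0 mulr0 addr0.
have := subst_gap (out01 cf) (der_out_modes_norm (ltn0Sn 0) Hf)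
  (has_gap1 (C1per_out_modes (ltn0Sn 0) Hr)).
rewrite mulN1r sqrrN mul1r [ip f (sn 1) ^+ 2 + _]addrC => H.
have e : ip f (cs 0) ^+ 2 / (2 * pi) * gap = gap / (2 * pi) * ip f (cs 0) ^+ 2 by ring.
have {}H := H _; set Z := ip f (cs 1) ^+ 2 + _ in H *.
have e2 : (gap - 1) / pi * Z = (gap - 1) * (Z / pi) by ring.
rewrite -e e2; set A := _ / (2 * pi) in H *; set B := Z / pi in H *.
suff : gap * (ip f f - A - B) <= ip f' f' - B by lra.
apply: H => m m1; apply: perp_out_modes => // mn.
have -> : m = 0%N by case: m m1 mn => [|[]].
rewrite (ip_out cf c0 c0) (ip_out cf c0 (@cts_sn R 0)) cs_sn0 divfK // subrr; split=> //.
rewrite mulr0 subr0 /ip (@cint_ext _ _ (fun=> 0)) ?cint_cst ?mul0r // => t.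
by rewrite sn0 mulr0.
Qed.

End CircleModes.
(** * Spectral gap on the torus *)

Section TorusGap.
Variable R : realType.

Definition md (i : nat) : R -> R :=
  match i with 0%N => cs 0 | 1%N => cs 1 | _ => sn 1 end.

Definition md' (i : nat) : R -> R :=
  match i with 0%N => fun=> 0 | 1%N => fun t => - sn 1 t | _ => cs 1 end.

Lemma C1per_md i : C1per (md i) (md' i).
Proof.
case: i => [|[|i]] /=.
- by apply: (C1per_ext (C1per_cs R 0)) => // t; rewrite mul0r oppr0.
- by apply: (C1per_ext (C1per_cs R 1)) => // t; rewrite mul1r.
- by apply: (C1per_ext (C1per_sn R 1)) => // t; rewrite mul1r.
Qed.

Lemma cts_md i : continuous (md i). Proof. by have [] := C1per_md i. Qed.

Lemma cint_le (f g : R -> R) : continuous f -> continuous g -> (forall t, f t <= g t) ->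
  cint f <= cint g.
Proof.
move=> cf cg fg; rewrite -subr_ge0 -cintB //; apply: cint_ge0 => [|t].
  by apply: ctsD => //; exact: ctsN.
by rewrite subr_ge0.
Qed.

Lemma circle_gap_crude (f f' : R -> R) : C1per f f' ->
  gap R * ip f f <= ip f' f' + \sum_(i < 3) ip f (md i) ^+ 2.
Proof.
move=> Hf; apply: (le_trans (circle_gap Hf)).
rewrite !big_ord_recr big_ord0 /= add0r.
have p2 := pi_ge2 R; have p0 := pi_gt0 R.
have g1 : gap R / (2 * pi) <= 1 by rewrite ler_pdivrMr /gap; lra.
have g2 : (gap R - 1) / pi <= 1 by rewrite ler_pdivrMr /gap; lra.
move: (ip f' f') (ip f (cs 0)) (ip f (cs 1)) (ip f (sn 1)) => A B C D.
rewrite -!addrA lerD2l; apply: lerD; first by rewrite ler_piMl // sqr_ge0.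
apply: ler_piMl => //.
by rewrite addr_ge0 ?sqr_ge0.
Qed.

Variables (s s1 s2 : R -> R -> R) (Hs : C1T s s1 s2).

Let cs_ := C1T_cont Hs.
Let cs1 := C1T_cont1 Hs.
Let cs2 := C1T_cont2 Hs.

Let slice a : C1per (s a) (s2 a).
Proof.
split; [exact: cont2_row|exact: cont2_row|exact: (C1T_der2 Hs)|exact: (C1T_per2 Hs)].
Qed.

Let cmd (F : R -> R -> R) j : cont2 F -> cont2 (fun a b => F a b * md j b).
Proof. by move=> cF; apply: cont2M => //; apply: cont2_snd; exact: cts_md. Qed.

Let coef_C1 j : C1per (fun a => ip (s a) (md j)) (fun a => ip (s1 a) (md j)).
Proof.
split.
- exact: (cint_continuous (@cmd _ j cs_)).
- exact: (cint_continuous (@cmd _ j cs1)).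
- move=> a; apply: (der_cint (F := fun a b => s a b * md j b)
                             (G := fun a b => s1 a b * md j b)).
  + exact: cmd.
  + exact: cmd.
  + move=> x t; apply: (der_eq (derM (C1T_der1 Hs x t) (der_cst (md j t) x))) => //.
    by rewrite mulr0 addr0.
- by move=> a; apply: cint_ext => b; rewrite (C1T_per1 Hs).
Qed.

Definition mode_coef i j : R := iint (fun a b => s a b * md i a * md j b).

Let coefE i j : ip (fun a => ip (s a) (md j)) (md i) = mode_coef i j.
Proof.
apply: cint_ext => a; rewrite mulrC -cintZ.
  by apply: cint_ext => b; ring.
by apply: (cont2_row (@cmd _ j cs_)).
Qed.

Let sq_row (F : R -> R -> R) a : ip (F a) (F a) = cint (fun b => F a b ^+ 2).
Proof. by apply: cint_ext => b; rewrite expr2. Qed.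

Let cint_lin3 (w0 w1 w2 : R) (f0 f1 f2 : R -> R) :
  continuous f0 -> continuous f1 -> continuous f2 ->
  cint (fun a => w0 * f0 a + (w1 * f1 a + w2 * f2 a)) =
  w0 * cint f0 + (w1 * cint f1 + w2 * cint f2).
Proof.
move=> c0 c1 c2.
have cZ (w : R) (g : R -> R) : continuous g -> continuous (fun a : R => w * g a).
  by move=> cg; apply: ctsM; [exact: cts_cst|exact: cg].
have z1 := cZ w1 _ c1; have z2 := cZ w2 _ c2.
rewrite (cintD (cZ w0 _ c0) (ctsD z1 z2)) (cintD z1 z2).
by rewrite (cintZ w0 c0) (cintZ w1 c1) (cintZ w2 c2).
Qed.

Let lin3_cts (w0 w1 w2 : R) (f0 f1 f2 : R -> R) :
  continuous f0 -> continuous f1 -> continuous f2 ->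
  continuous (fun a : R => w0 * f0 a + (w1 * f1 a + w2 * f2 a)).
Proof.
move=> c0 c1 c2.
have cZ (w : R) (g : R -> R) : continuous g -> continuous (fun a : R => w * g a).
  by move=> cg; apply: ctsM; [exact: cts_cst|exact: cg].
exact: (ctsD (cZ w0 _ c0) (ctsD (cZ w1 _ c1) (cZ w2 _ c2))).
Qed.

Let gap_arith (A0 A1 A2 B0 B1 B2 M0 M1 M2 I I1 I2 : R) :
  gap R * I <= I2 + (gap R / (2 * pi) * A0 + ((gap R - 1) / pi * A1 + (gap R - 1) / pi * A2)) ->
  1 / (2 * pi) * B0 + (1 / pi * B1 + 1 / pi * B2) <= I1 ->
  gap R * A0 <= B0 + M0 -> gap R * A1 <= B1 + M1 -> gap R * A2 <= B2 + M2 ->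
  0 <= A1 -> 0 <= A2 -> 0 <= M0 -> 0 <= M1 -> 0 <= M2 ->
  gap R * I <= I1 + I2 + (M0 + M1 + M2).
Proof.
have p2 := pi_ge2 R; have p0 := pi_gt0 R.
have i0 : 0 <= pi^-1 :> R by rewrite invr_ge0 ltW.
have i1 : pi^-1 <= 1 :> R by rewrite invf_le1 //; lra.
have -> : gap R / (2 * pi) * A0 = pi^-1 / 2 * (gap R * A0) by rewrite invfM; ring.
have e (A : R) : (gap R - 1) / pi * A = pi^-1 * (gap R * A) - pi^-1 * A by ring.
have -> : 1 / (2 * pi) = pi^-1 / 2 :> R by rewrite invfM mul1r mulrC.
rewrite !e !mul1r {e p2 p0}; generalize dependent (pi^-1 : R) => p i0 i1.
move: (gap R * I) (gap R * A0) (gap R * A1) (gap R * A2) => x a0 a1 a2 G B P0 P1 P2 A1p A2p m0 m1 m2.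
have h0 : p / 2 * a0 <= p / 2 * (B0 + M0) by apply: ler_wpM2l => //; rewrite divr_ge0.
have h1 : p * a1 <= p * (B1 + M1) by exact: ler_wpM2l.
have h2 : p * a2 <= p * (B2 + M2) by exact: ler_wpM2l.
have k1 : 0 <= p * A1 by exact: mulr_ge0.
have k2 : 0 <= p * A2 by exact: mulr_ge0.
have k3 : p * M0 <= M0 by exact: ler_piMl.
have k4 : p * M1 <= M1 by exact: ler_piMl.
have k5 : p * M2 <= M2 by exact: ler_piMl.
have k6 : 0 <= p * M0 by exact: mulr_ge0.
rewrite mulrDr in h0; rewrite mulrDr in h1; rewrite mulrDr in h2; lra.
Qed.

(** Apply the gap on the circle in the second variable, and once more in the
    first variable to the three coefficient functions that it leaves. *)
Theorem torus_gap :
  gap R * iint (fun a b => s a b ^+ 2) <=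
  iint (fun a b => s1 a b ^+ 2) + iint (fun a b => s2 a b ^+ 2)
  + \sum_(j < 3) \sum_(i < 3) mode_coef i j ^+ 2.
Proof.
pose f j a := ip (s a) (md j); pose f' j a := ip (s1 a) (md j).
pose M j := \sum_(i < 3) mode_coef i j ^+ 2.
have cf j : continuous (f j) by have [] := coef_C1 j.
have cf' j : continuous (f' j) by have [] := coef_C1 j.
have q (F : R -> R -> R) : cont2 F -> continuous (fun a => cint (fun b => F a b ^+ 2)).
  by move=> cF; exact: (cint_continuous (@cont2X _ F 2 cF)).
have sf j : continuous (fun a => f j a * f j a) by exact: (ctsM (cf j) (cf j)).
have sf' j : continuous (fun a => f' j a * f' j a) by exact: (ctsM (cf' j) (cf' j)).
have -> : \sum_(j < 3) \sum_(i < 3) mode_coef i j ^+ 2 = M 0%N + M 1%N + M 2%N.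
  by rewrite (eq_bigr (fun j : 'I_3 => M j)) // !big_ord_recr big_ord0 /= add0r.
have pos j : 0 <= M j by apply: sumr_ge0 => i _; rewrite sqr_ge0.
have fpos j : 0 <= ip (f j) (f j) by exact: (ip_ge0 (cf j)).
have P j : gap R * ip (f j) (f j) <= ip (f' j) (f' j) + M j.
  apply: (le_trans (circle_gap_crude (coef_C1 j))).
  by apply: lerD; [exact: lexx|apply: ler_sum => i _; rewrite coefE].
apply: (gap_arith _ _ (P 0%N) (P 1%N) (P 2%N)) => //.
  rewrite -[ip (f 0%N) _]/(cint (fun a => f 0%N a * f 0%N a)).
  rewrite -[ip (f 1%N) _]/(cint (fun a => f 1%N a * f 1%N a)).
  rewrite -[ip (f 2%N) _]/(cint (fun a => f 2%N a * f 2%N a)).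
  rewrite -(cint_lin3 _ _ _ (sf 0%N) (sf 1%N) (sf 2%N)) -(cintZ _ (q _ cs_)).
  have L := @lin3_cts (gap R / (2 * pi)) ((gap R - 1) / pi) ((gap R - 1) / pi)
    _ _ _ (sf 0%N) (sf 1%N) (sf 2%N).
  rewrite -(cintD (q _ cs2) L); apply: cint_le.
  - by apply: ctsM; [exact: cts_cst|exact: q].
  - exact: (ctsD (q _ cs2) L).
  move=> a; have := circle_gap (slice a); rewrite !sq_row.
  rewrite -/(f 0%N a) -/(f 1%N a) -/(f 2%N a).
  move: (cint _) (cint _) (f 0%N a) (f 1%N a) (f 2%N a) => x y z u v H.
  by apply: (le_trans H); rewrite le_eqVlt; apply/orP; left; apply/eqP; ring.
rewrite -[ip (f' 0%N) _]/(cint (fun a => f' 0%N a * f' 0%N a)).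
rewrite -[ip (f' 1%N) _]/(cint (fun a => f' 1%N a * f' 1%N a)).
rewrite -[ip (f' 2%N) _]/(cint (fun a => f' 2%N a * f' 2%N a)).
rewrite -(cint_lin3 _ _ _ (sf' 0%N) (sf' 1%N) (sf' 2%N)).
apply: cint_le; first exact: lin3_cts (sf' 0%N) (sf' 1%N) (sf' 2%N).
  exact: q.
move=> a; have := circle_Bessel (cont2_row (a := a) cs1); rewrite !sq_row.
rewrite -/(f' 0%N a) -/(f' 1%N a) -/(f' 2%N a).
move: (cint _) (f' 0%N a) (f' 1%N a) (f' 2%N a) => x z u v.
by apply: le_trans; rewrite le_eqVlt; apply/orP; left; apply/eqP; ring.
Qed.

End TorusGap.
(** * Rigidity for nearly flat equations *)

(** The difference between the integrands of the given equation and of the flat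
    one, for a test function bounded by 1 together with its derivatives. *)
Lemma pointwise_error (R : realFieldType) (d A B G D S S1 S2 K E0 E1 E2 : R) : 0 <= d ->
  `|A - 1| <= d -> `|B| <= d -> `|G - 1| <= d -> `|D - 1 / 2| <= d ->
  `|S1| <= d -> `|S2| <= d -> `|K| <= 2 * (S1 ^+ 2 + S2 ^+ 2) ->
  `|E0| <= 1 -> `|E1| <= 1 -> `|E2| <= 1 ->
  `|((A - 1) * S1 - B * S2) * E1 + ((G - 1) * S2 - B * S1) * E2
     - (4 * (D - 1 / 2) * S - 2 * K) * E0| <= 6 * d * (`|S| + `|S1| + `|S2|).
Proof.
move: (A - 1) (G - 1) (D - 1 / 2) => A1 G1 DD d0 kA kB kG kD k1 k2 kK h0 h1 h2.
rewrite -[S1 ^+ 2]real_normK ?num_real // -[S2 ^+ 2]real_normK ?num_real // in kK.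
have pr (x y u v : R) : `|x| <= u -> `|y| <= v -> `|x * y| <= u * v.
  by move=> xu yv; rewrite normrM; apply: ler_pM.
have q1 : `|A1 * S1 - B * S2| <= d * `|S1| + d * `|S2|.
  by apply: (le_trans (ler_normB _ _)); apply: lerD; exact: pr.
have q2 : `|G1 * S2 - B * S1| <= d * `|S2| + d * `|S1|.
  by apply: (le_trans (ler_normB _ _)); apply: lerD; exact: pr.
have n4 : `|4 : R| <= 4 by rewrite ger0_norm.
have n2 : `|2 : R| <= 2 by rewrite ger0_norm.
have q3 : `|4 * DD * S - 2 * K| <= 4 * d * `|S| + 2 * (2 * (d * `|S1| + d * `|S2|)).
  apply: (le_trans (ler_normB _ _)); apply: lerD; first exact: (pr _ _ _ _ (pr _ _ _ _ n4 kD)).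
  apply: (pr _ _ _ _ n2); apply: (le_trans kK); apply: ler_wpM2l => //.
  by rewrite !expr2; apply: lerD; apply: ler_wpM2r.
have t (x y z : R) : `|x + y - z| <= `|x| + `|y| + `|z|.
  by apply: (le_trans (ler_normB _ _)); rewrite lerD2r; exact: ler_normD.
apply: (le_trans (t _ _ _)).
have r1 := pr _ _ _ _ q1 h1; have r2 := pr _ _ _ _ q2 h2; have r3 := pr _ _ _ _ q3 h0.
move: r1 r2 r3; rewrite !mulr1 => r1 r2 r3.
apply: (le_trans (lerD (lerD r1 r2) r3)).
have : 0 <= d * `|S| by exact: mulr_ge0.
have -> : 6 * d * (`|S| + `|S1| + `|S2|) = 6 * (d * `|S|) + 6 * (d * `|S1|) + 6 * (d * `|S2|).
  by ring.
rewrite -(mulrA 4 d).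
by move: (d * `|S|) (d * `|S1|) (d * `|S2|) => x y z; lra.
Qed.

Lemma pointwise_energy (R : realFieldType) (d A B G x y : R) :
  `|A - 1| <= d -> `|B| <= d -> `|G - 1| <= d ->
  (1 - 2 * d) * (x ^+ 2 + y ^+ 2) <= (A * x - B * y) * x + (G * y - B * x) * y.
Proof.
rewrite !ler_norml => /andP[a1 _] /andP[b1 b2] /andP[g1 _].
have h1 : (- d) * x ^+ 2 <= (A - 1) * x ^+ 2 by apply: ler_wpM2r; rewrite ?sqr_ge0.
have h2 : (- d) * y ^+ 2 <= (G - 1) * y ^+ 2 by apply: ler_wpM2r; rewrite ?sqr_ge0.
have h3 : 0 <= (d - B) * (x + y) ^+ 2 by apply: mulr_ge0; rewrite ?sqr_ge0 //; lra.
have h4 : 0 <= (d + B) * (x - y) ^+ 2 by apply: mulr_ge0; rewrite ?sqr_ge0 //; lra.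
rewrite -subr_ge0 (_ : _ - _ = ((A - 1) * x ^+ 2 - - d * x ^+ 2)
  + ((G - 1) * y ^+ 2 - - d * y ^+ 2)
  + ((d - B) * (x + y) ^+ 2 + (d + B) * (x - y) ^+ 2) / 2); last by field.
apply: addr_ge0; first by apply: addr_ge0; rewrite subr_ge0.
by apply: divr_ge0 => //; exact: addr_ge0.
Qed.

Lemma pointwise_forcing (R : realFieldType) (d D S K q : R) :
  `|D - 1 / 2| <= d -> `|S| <= d -> `|K| <= 2 * q ->
  (4 * D * S - 2 * K) * S <= (2 + 4 * d) * S ^+ 2 + 4 * d * q.
Proof.
rewrite ler_norml => /andP[_ kD] ks kK.
have h1 : 4 * D * S ^+ 2 <= (2 + 4 * d) * S ^+ 2.
  by apply: ler_wpM2r; [exact: sqr_ge0|lra].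
have h2 : `|K * S| <= 2 * q * d by rewrite normrM; apply: ler_pM.
have h3 : - (K * S) <= 2 * q * d by apply: le_trans h2; rewrite -normrN ler_norm.
have -> : (4 * D * S - 2 * K) * S = 4 * D * S ^+ 2 + 2 * (- (K * S)) by ring.
have -> : 4 * d * q = 2 * (2 * q * d) by ring.
by apply: lerD => //; rewrite ler_pM2l.
Qed.

Lemma nine_times (R : pzRingType) (x : R) : \sum_(j < 3) \sum_(i < 3) x = 9 * x.
Proof. by rewrite !sumr_const !card_ord -mulrnA mulr_natl. Qed.

Lemma low_mode_arith (R : realFieldType) (d J N : R) : 0 <= d -> d <= 1 / 2000 ->
  0 <= J ^+ 2 -> J ^+ 2 <= 123 * N -> 9 * (6 * d * J) ^+ 2 <= 1 / 100 * N.
Proof.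
have -> : 9 * (6 * d * J) ^+ 2 = 324 * (d * (d * J ^+ 2)) by ring.
move: (J ^+ 2) => Q d0 d1 Q0 QN.
have h1 : d * Q <= 1 / 2000 * Q by exact: ler_wpM2r.
have h2 : d * (d * Q) <= 1 / 2000 * (d * Q) by apply: ler_wpM2r => //; exact: mulr_ge0.
move: (d * (d * Q)) (d * Q) h1 h2 => x y; lra.
Qed.

Lemma gap_contradiction (R : realType) (d x y S : R) : 0 <= d -> d <= 1 / 2000 ->
  0 <= x -> 0 <= y -> (1 - 6 * d) * y <= (2 + 4 * d) * x ->
  gap R * x <= y + S -> S <= 1 / 100 * (x + y) -> x <= 0.
Proof.
rewrite /gap => d0 d1 x0 y0 E G M.
have e1 : d * y <= 1 / 2000 * y by exact: ler_wpM2r.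
have e2 : d * x <= 1 / 2000 * x by exact: ler_wpM2r.
have q1 : (1 - 6 * d) * y = y - 6 * (d * y) by ring.
have q2 : (2 + 4 * d) * x = 2 * x + 4 * (d * x) by ring.
rewrite {}q1 {}q2 in E.
move: (d * x) (d * y) e1 e2 E => u v; lra.
Qed.

Section Rigidity.
Opaque iint.
Variable R : realType.
Variables (d : R) (s s1 s2 al be ga D K : R -> R -> R).
Hypotheses (d0 : 0 <= d) (dsmall : d <= 1 / 2000).
Hypothesis Hs : C1T s s1 s2.
Hypotheses (cal : cont2 al) (cbe : cont2 be) (cga : cont2 ga) (cD : cont2 D) (cK : cont2 K).
Hypotheses (al1 : forall a b, `|al a b - 1| <= d) (be0 : forall a b, `|be a b| <= d)
  (ga1 : forall a b, `|ga a b - 1| <= d) (D1 : forall a b, `|D a b - 1 / 2| <= d)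
  (sd : forall a b, `|s a b| <= d) (s1d : forall a b, `|s1 a b| <= d)
  (s2d : forall a b, `|s2 a b| <= d)
  (Kq : forall a b, `|K a b| <= 2 * (s1 a b ^+ 2 + s2 a b ^+ 2)).
Hypothesis weak : forall e e1 e2, C1T e e1 e2 ->
  iint (fun a b => (al a b * s1 a b - be a b * s2 a b) * e1 a b
                 + (ga a b * s2 a b - be a b * s1 a b) * e2 a b) =
  iint (fun a b => (4 * D a b * s a b - 2 * K a b) * e a b).
Hypothesis kernel_small : forall i j, (0 < i < 3)%N -> (0 < j < 3)%N ->
  `|mode_coef s i j| <= 4 * d * iint (fun a b => `|s a b|).

Let cs0 := C1T_cont Hs.
Let cs1 := C1T_cont1 Hs.
Let cs2 := C1T_cont2 Hs.
Let cB F G : cont2 F -> cont2 G -> cont2 (fun a b => F a b - G a b : R).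
Proof. by move=> cF cG; exact: (cont2D cF (cont2N cG)). Qed.
Let cZ (c : R) F : cont2 F -> cont2 (fun a b => c * F a b : R).
Proof. by move=> cF; exact: (cont2M (@cont2_cst R c) cF). Qed.
Let cX (F : R -> R -> R) n : cont2 F -> cont2 (fun a b => F a b ^+ n).
Proof. exact: cont2X. Qed.

Let h a b := `|s a b| + `|s1 a b| + `|s2 a b|.
Let J := iint h.
Let N0 := iint (fun a b => s a b ^+ 2).
Let N1 := iint (fun a b => s1 a b ^+ 2) + iint (fun a b => s2 a b ^+ 2).

Let ch : cont2 h.
Proof. exact: (cont2D (cont2D (cont2_abs cs0) (cont2_abs cs1)) (cont2_abs cs2)). Qed.

Let N0p : 0 <= N0. Proof. by apply: iint_ge0 => [|a b]; [exact: cX|exact: sqr_ge0]. Qed.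
Let N1p : 0 <= N1.
Proof. by apply: addr_ge0; apply: iint_ge0 => [|a b]; by [exact: cX|exact: sqr_ge0]. Qed.

Let N1E : N1 = iint (fun a b => s1 a b ^+ 2 + s2 a b ^+ 2).
Proof. by rewrite iintD //; exact: cX. Qed.

(** Cauchy-Schwarz; [123] is three summands times [41 >= (2 pi) ^ 2]. *)
Let mean_square : J ^+ 2 <= 123 * (N0 + N1).
Proof.
have t0 := tau_gt0 R; pose A := (2 * pi) ^+ 2 : R.
have A0 : 0 < A by rewrite exprn_gt0.
have A41 : A <= 41.
  rewrite /A; apply: (@le_trans _ _ ((32 / 5) ^+ 2)); last by lra.
  by rewrite lerXn2r ?nnegrE ?(ltW t0) //; have := pi_le R; lra.
have c2 : cont2 (fun a b => h a b ^+ 2) by exact: cX.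
have e : 0 <= iint (fun a b => A * h a b ^+ 2 + (- (2 * J) * h a b + J ^+ 2 / A)).
  apply: iint_ge0; first by apply: cont2D; [exact: cZ|apply: cont2D; [exact: cZ|exact: cont2_cst]].
  move=> a b; rewrite (_ : _ + _ = (A * h a b - J) ^+ 2 / A); last by field; rewrite gt_eqF.
  by rewrite divr_ge0 ?sqr_ge0 // ltW.
have {}e : J ^+ 2 <= A * iint (fun a b => h a b ^+ 2).
  move: e; rewrite iintD; [|exact: cZ|apply: cont2D; [exact: cZ|exact: cont2_cst]].
  rewrite iintD; [|exact: cZ|exact: cont2_cst].
  rewrite (iintZ A c2) (iintZ _ ch) -/J.
  have -> : iint (fun _ _ => J ^+ 2 / A) = J ^+ 2.
    by rewrite (@iint_cst R (J ^+ 2 / A)) -/A divfK ?gt_eqF.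
  move: (A * _) (J) => x j; lra.
apply: (le_trans e); have -> : 123 * (N0 + N1) = 41 * (3 * (N0 + N1)) by ring.
have {}e : iint (fun a b => h a b ^+ 2) <= 3 * (N0 + N1).
  rewrite N1E -iintD; [|exact: cX|by apply: cont2D; exact: cX].
  rewrite -iintZ; last by apply: cont2D; [exact: cX|apply: cont2D; exact: cX].
  apply: iint_le => //; first by apply: cZ; apply: cont2D; [exact: cX|apply: cont2D; exact: cX].
  move=> a b; rewrite /h -!(real_normK (num_real (_ a b))).
  move: `|s a b| `|s1 a b| `|s2 a b| => x y z.
  rewrite -subr_ge0 (_ : _ - _ = (x - y) ^+ 2 + (x - z) ^+ 2 + (y - z) ^+ 2); last by ring.
  by rewrite !addr_ge0 ?sqr_ge0.
have i0 : 0 <= iint (fun a b => h a b ^+ 2).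
  by apply: (iint_ge0 c2) => a b; exact: sqr_ge0.
exact: (ler_pM (ltW A0) i0 A41 e).
Qed.

Let C1T_mode i j : C1T (fun a b => md i a * md j b : R)
  (fun a b => md' i a * md j b) (fun a b => md i a * md' j b).
Proof.
have [c1 c1' d1 p1] := C1per_md R i; have [c2 c2' d2 p2] := C1per_md R j.
split.
- exact: (cont2M (cont2_fst c1) (cont2_snd c2)).
- exact: (cont2M (cont2_fst c1') (cont2_snd c2)).
- exact: (cont2M (cont2_fst c1) (cont2_snd c2')).
- move=> a b; apply: (der_eq (derM (d1 a) (der_cst (md j b) a))) => //.
  by rewrite mulr0 addr0.
- move=> a b; apply: (der_eq (derM (der_cst (md i a) b) (d2 b))) => //.
  by rewrite mul0r add0r.
- by move=> a b; rewrite p1.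
- by move=> a b; rewrite p2.
Qed.

Let md1 i (t : R) : `|md i t| <= 1.
Proof.
have c n (x : R) : `|cs n x| <= 1 by rewrite ler_norml cos_geN1 cos_le1.
have c' n (x : R) : `|sn n x| <= 1 by rewrite ler_norml sin_geN1 sin_le1.
by case: i => [|[|i]] /=.
Qed.

Let md'1 i (t : R) : `|md' i t| <= 1.
Proof.
have c n (x : R) : `|cs n x| <= 1 by rewrite ler_norml cos_geN1 cos_le1.
have c' n (x : R) : `|sn n x| <= 1 by rewrite ler_norml sin_geN1 sin_le1.
by case: i => [|[|i]] /=; rewrite ?normr0 ?normrN.
Qed.

Let lam (i : nat) : R := if i is 0%N then 0 else 1.

Let C1per_md' i : C1per (md' i) (fun t : R => - lam i * md i t).
Proof.
case: i => [|[|i]] /=.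
- by apply: (C1per_ext (C1per_cst (0 : R))) => // t; rewrite oppr0 mul0r.
- apply: (C1per_ext (C1perZ (- 1) (C1per_sn R 1))) => t; first by rewrite mulN1r.
  by rewrite mul1r.
- apply: (C1per_ext (C1per_cs R 1)) => // t; by rewrite mul1r mulN1r.
Qed.

(** The modes are eigenfunctions of the flat Laplacian. *)
Let flat_mode i j :
  iint (fun a b => s1 a b * (md' i a * md j b) + s2 a b * (md i a * md' j b)) =
  (lam i + lam j) * mode_coef s i j.
Proof.
have [c1 c1' d1 p1] := C1per_md R i; have [c2 c2' d2 p2] := C1per_md R j.
have [k1 k1' e1 q1] := C1per_md' i; have [k2 k2' e2 q2] := C1per_md' j.
have H1 : C1T (fun a b => md' i a * md j b) (fun a b => - lam i * (md i a * md j b))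
              (fun a b => md' i a * md' j b).
  split.
  - exact: (cont2M (cont2_fst k1) (cont2_snd c2)).
  - exact: (cZ (cont2M (cont2_fst c1) (cont2_snd c2))).
  - exact: (cont2M (cont2_fst k1) (cont2_snd c2')).
  - move=> a b; apply: (der_eq (derM (e1 a) (der_cst (md j b) a))) => //.
    by rewrite mulr0 addr0 mulrA.
  - move=> a b; apply: (der_eq (derM (der_cst (md' i a) b) (d2 b))) => //.
    by rewrite mul0r add0r.
  - by move=> a b; rewrite q1.
  - by move=> a b; rewrite p2.
have H2 : C1T (fun a b => md i a * md' j b) (fun a b => md' i a * md' j b)
              (fun a b => - lam j * (md i a * md j b)).
  split.
  - exact: (cont2M (cont2_fst c1) (cont2_snd k2)).
  - exact: (cont2M (cont2_fst c1') (cont2_snd k2)).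
  - exact: (cZ (cont2M (cont2_fst c1) (cont2_snd c2))).
  - move=> a b; apply: (der_eq (derM (d1 a) (der_cst (md' j b) a))) => //.
    by rewrite mulr0 addr0.
  - move=> a b; apply: (der_eq (derM (der_cst (md i a) b) (e2 b))) => //.
    by rewrite mul0r add0r mulrCA.
  - by move=> a b; rewrite p1.
  - by move=> a b; rewrite q2.
have cm : cont2 (fun a b : R => md i a * md j b) := cont2M (cont2_fst c1) (cont2_snd c2).
have cm1 := C1T_cont H1; have cm2 := C1T_cont H2.
have z1 := iint_d1 (C1TM Hs H1); have z2 := iint_d2 (C1TM Hs H2).
rewrite iintD in z1; [|exact: cont2M|by apply: cont2M => //; exact: cZ].
rewrite iintD in z2; [|exact: cont2M|by apply: cont2M => //; exact: cZ].
rewrite iintD; try exact: cont2M.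
have m l : iint (fun a b => s a b * (- l * (md i a * md j b))) = - l * mode_coef s i j.
  rewrite /mode_coef -iintZ; first by apply: iint_ext => a b; ring.
  by apply: (cont2_ext (cont2M cs0 cm)) => a b; rewrite mulrA.
move: z1 z2; rewrite !m.
move: (iint _) (iint _) (mode_coef _ _ _) => x y z; rewrite mulrDl; lra.
Qed.

(** Outside the kernel the eigenvalue [lam i + lam j] is 0 or 1, at distance at
    least 1 from [2], so the equation tested against the mode bounds its
    coefficient by the deviation from the flat equation. *)
Let mode_small i j : (i < 3)%N -> (j < 3)%N -> `|mode_coef s i j| <= 6 * d * J.
Proof.
move=> i3 j3; have hJ : iint (fun a b => `|s a b|) <= J.
  apply: iint_le => //; first exact: cont2_abs.
  by move=> a b; rewrite /h -addrA lerDl addr_ge0.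
have [/andP[i0 j0]|ij] := boolP ((0 < i)%N && (0 < j)%N).
  have h1 : (0 < i < 3)%N by rewrite i0.
  have h2 : (0 < j < 3)%N by rewrite j0.
  have k0 : 0 <= iint (fun a b => `|s a b|).
    by apply: (iint_ge0 (cont2_abs cs0)) => a b; exact: normr_ge0.
  have d46 : 4 * d <= 6 * d by apply: ler_wpM2r; [exact: d0|rewrite ler_nat].
  have d4 : 0 <= 4 * d by apply: mulr_ge0; [|exact: d0].
  exact: (le_trans (kernel_small h1 h2) (ler_pM d4 k0 d46 hJ)).
have l2 : 1 <= 2 - (lam i + lam j).
  by move: ij; rewrite /lam; case: i i3 => [|i] _; case: j j3 => [|j] _ //= _; lra.
have [cm cm1 cm2 _ _ _ _] := C1T_mode i j.
have W := weak (C1T_mode i j).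
pose e a b : R := md i a * md j b; pose e1 a b : R := md' i a * md j b.
pose e2 a b : R := md i a * md' j b.
have b0 a b : `|e a b| <= 1 by rewrite normrM -[1]mulr1; apply: ler_pM.
have b1 a b : `|e1 a b| <= 1 by rewrite normrM -[1]mulr1; apply: ler_pM.
have b2 a b : `|e2 a b| <= 1 by rewrite normrM -[1]mulr1; apply: ler_pM.
pose err a b := ((al a b - 1) * s1 a b - be a b * s2 a b) * e1 a b
  + ((ga a b - 1) * s2 a b - be a b * s1 a b) * e2 a b
  - (4 * (D a b - 1 / 2) * s a b - 2 * K a b) * e a b.
have cerr : cont2 err.
  have c1 := @cont2_cst R 1; have c12 := @cont2_cst R (1 / 2).
  apply: cB; first apply: cont2D.
  - exact: (cont2M (cB (cont2M (cB cal c1) cs1) (cont2M cbe cs2)) cm1).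
  - exact: (cont2M (cB (cont2M (cB cga c1) cs2) (cont2M cbe cs1)) cm2).
  - exact: (cont2M (cB (cont2M (@cZ 4 _ (cB cD c12)) cs0) (@cZ 2 _ cK)) cm).
have E : iint err = (2 - (lam i + lam j)) * mode_coef s i j.
  have cA := cont2M (cB (cont2M (@cZ 4 _ cD) cs0) (@cZ 2 _ cK)) cm.
  have cW := cont2D (cont2M (cB (cont2M cal cs1) (cont2M cbe cs2)) cm1)
                    (cont2M (cB (cont2M cga cs2) (cont2M cbe cs1)) cm2).
  have cS : cont2 (fun a b => s a b * md i a * md j b).
    by apply: (cont2_ext (cont2M cs0 cm)) => a b; rewrite mulrA.
  have cF : cont2 (fun a b => s1 a b * e1 a b + s2 a b * e2 a b).
    exact: (cont2D (cont2M cs1 cm1) (cont2M cs2 cm2)).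
  have -> : iint err = iint (fun a b => ((al a b * s1 a b - be a b * s2 a b) * e1 a b
                 + (ga a b * s2 a b - be a b * s1 a b) * e2 a b
      - (4 * D a b * s a b - 2 * K a b) * e a b) -
      ((s1 a b * e1 a b + s2 a b * e2 a b) - 2 * (s a b * md i a * md j b))).
    apply: iint_ext => a b; rewrite /err.
    rewrite -[s a b * md i a * md j b]mulrA -/(e a b).
    move: (al a b) (be a b) (ga a b) (s a b) (s1 a b) (s2 a b) (e a b) (e1 a b) (e2 a b)
      (D a b) (K a b) => *; by field.
  rewrite (iintB (cB cW cA) (cB cF (@cZ 2 _ cS))) (iintB cW cA) (iintB cF (@cZ 2 _ cS)).
  rewrite (iintZ 2 cS) flat_mode -/(mode_coef s i j) W.
  move: (iint _) (mode_coef _ _ _) (lam i + lam j) => x y z; ring.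
have B : `|iint err| <= 6 * d * J.
  rewrite -(iintZ _ ch); apply: (iint_abs cerr (@cZ _ _ ch)) => a b.
  have P := @pointwise_error R d _ _ _ _ (s a b) _ _ _ _ _ _ d0 (al1 a b) (be0 a b) (ga1 a b)
    (D1 a b) (s1d a b) (s2d a b) (Kq a b) (b0 a b) (b1 a b) (b2 a b).
  by rewrite /err /h.
have l3 := le_trans l2 (ler_norm (2 - (lam i + lam j))).
rewrite E normrM in B.
exact: (le_trans (ler_peMl (normr_ge0 (mode_coef s i j)) l3) B).
Qed.

Let modes_small : \sum_(j < 3) \sum_(i < 3) mode_coef s i j ^+ 2 <= 1 / 100 * (N0 + N1).
Proof.
have B (i j : 'I_3) : mode_coef s i j ^+ 2 <= (6 * d * J) ^+ 2.
  have M := mode_small (ltn_ord i) (ltn_ord j).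
  rewrite -[mode_coef s i j ^+ 2]real_normK ?num_real //.
  move: (6 * d * J) `|_| (normr_ge0 (mode_coef s i j)) M => x y y0 yx.
  by rewrite lerXn2r ?nnegrE // (le_trans y0).
have L : \sum_(j < 3) \sum_(i < 3) mode_coef s i j ^+ 2 <= 9 * (6 * d * J) ^+ 2.
  rewrite -nine_times; apply: ler_sum => j _; apply: ler_sum => i _; exact: B.
apply: (le_trans L); exact: (low_mode_arith d0 dsmall (sqr_ge0 J) mean_square).
Qed.

(** The equation tested against [s] itself. *)
Let energy : (1 - 6 * d) * N1 <= (2 + 4 * d) * N0.
Proof.
have cN1 : cont2 (fun a b => s1 a b ^+ 2 + s2 a b ^+ 2) by apply: cont2D; exact: cX.
have cN0 : cont2 (fun a b => s a b ^+ 2) by exact: cX.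
have W := weak Hs.
have L : (1 - 2 * d) * N1 <= iint (fun a b =>
    (al a b * s1 a b - be a b * s2 a b) * s1 a b + (ga a b * s2 a b - be a b * s1 a b) * s2 a b).
  rewrite N1E -(iintZ _ cN1); apply: (iint_le (@cZ _ _ cN1)).
    exact: (cont2D (cont2M (cB (cont2M cal cs1) (cont2M cbe cs2)) cs1)
                   (cont2M (cB (cont2M cga cs2) (cont2M cbe cs1)) cs2)).
  by move=> a b; exact: pointwise_energy (al1 a b) (be0 a b) (ga1 a b).
rewrite W in L.
have U : iint (fun a b => (4 * D a b * s a b - 2 * K a b) * s a b) <=
    (2 + 4 * d) * N0 + 4 * d * N1.
  rewrite N1E -(iintZ _ cN1) -(iintZ _ cN0) -(iintD (@cZ _ _ cN0) (@cZ _ _ cN1)).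
  apply: (iint_le _ (cont2D (@cZ _ _ cN0) (@cZ _ _ cN1))).
    exact: (cont2M (cB (cont2M (@cZ 4 _ cD) cs0) (@cZ 2 _ cK)) cs0).
  by move=> a b; exact: pointwise_forcing (D1 a b) (sd a b) (Kq a b).
have LU := le_trans L U; rewrite -subr_ge0; rewrite -subr_ge0 in LU.
by move: LU; congr (_ <= _); ring.
Qed.

(** The deviation of the equation from [Laplacian s + 2 s = 0] on the flat torus
    is small against [s] and its gradient, and the nine low modes of [s] are
    small too: those outside the kernel by the equation tested against them,
    those in the kernel by hypothesis.  The gap between [2] and the next
    eigenvalue leaves no room. *)
Theorem nearly_flat_rigidity a b : s a b = 0.
Proof.
have G := torus_gap Hs; rewrite -/N0 -/N1 in G.
have M := modes_small; have E := energy.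
have N00 : N0 = 0.
  apply/eqP; rewrite eq_le N0p andbT.
  exact: (gap_contradiction d0 dsmall N0p N1p E G M).
apply/eqP; rewrite -sqrf_eq0; apply/eqP.
apply: (iint_eq0 (F := fun a b => s a b ^+ 2)) => //.
- exact: cX.
- by move=> *; exact: sqr_ge0.
- by move=> x y; rewrite (C1T_per1 Hs).
- by move=> x y; rewrite (C1T_per2 Hs).
Qed.

End Rigidity.
(** * Linear algebra of frames in four-space *)

Section Frames.
Variable R : realType.
Implicit Types (u v w x y z N W : 'rV[R]_4).

Lemma dotC n (u v : 'rV[R]_n) : dot u v = dot v u.
Proof. by apply: eq_bigr => i _; rewrite mulrC. Qed.

Lemma dotDl n (u v w : 'rV[R]_n) : dot (u + v) w = dot u w + dot v w.
Proof. by rewrite /dot -big_split; apply: eq_bigr => i _; rewrite mxE mulrDl. Qed.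

Lemma dotZl n c (u w : 'rV[R]_n) : dot (c *: u) w = c * dot u w.
Proof. by rewrite /dot mulr_sumr; apply: eq_bigr => i _; rewrite mxE mulrA. Qed.

Lemma dotDr n (u v w : 'rV[R]_n) : dot w (u + v) = dot w u + dot w v.
Proof. by rewrite dotC dotDl !(dotC w). Qed.

Lemma dotZr n c (u w : 'rV[R]_n) : dot w (c *: u) = c * dot w u.
Proof. by rewrite dotC dotZl (dotC w). Qed.

Lemma dotNl n (u w : 'rV[R]_n) : dot (- u) w = - dot u w.
Proof. by rewrite -scaleN1r dotZl mulN1r. Qed.

Lemma dotBl n (u v w : 'rV[R]_n) : dot (u - v) w = dot u w - dot v w.
Proof. by rewrite dotDl dotNl. Qed.

Lemma dot_ge0 n (u : 'rV[R]_n) : 0 <= dot u u.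
Proof. by apply: sumr_ge0 => i _; rewrite -expr2 sqr_ge0. Qed.

Lemma dot_eq0 n (u : 'rV[R]_n) : dot u u = 0 -> u = 0.
Proof.
move=> h; apply/rowP => i; rewrite mxE; apply/eqP; rewrite -sqrf_eq0 expr2.
have /eqP := h; rewrite psumr_eq0; last by move=> j _; rewrite -expr2 sqr_ge0.
by move=> /allP /(_ i); rewrite mem_index_enum => /(_ isT).
Qed.

Section Frame.
Variables (x N v1 v2 : 'rV[R]_4).
Hypotheses (x0 : dot x x != 0) (N0 : dot N N != 0) (xN : dot x N = 0).
Hypotheses (xv1 : dot x v1 = 0) (xv2 : dot x v2 = 0) (Nv1 : dot N v1 = 0) (Nv2 : dot N v2 = 0).
Hypothesis gram : dot v1 v1 * dot v2 v2 - dot v1 v2 ^+ 2 != 0.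

Lemma gram_solve c d (A B C : R) : A * B - C ^+ 2 != 0 ->
  c * A + d * C = 0 -> c * C + d * B = 0 -> c = 0 /\ d = 0.
Proof.
move=> h e1 e2; split; apply: (mulIf h); rewrite mul0r.
  have -> : c * (A * B - C ^+ 2) = B * (c * A + d * C) - C * (c * C + d * B) by ring.
  by rewrite e1 e2 !mulr0 subr0.
have -> : d * (A * B - C ^+ 2) = A * (c * C + d * B) - C * (c * A + d * C) by ring.
by rewrite e1 e2 !mulr0 subr0.
Qed.

Let M : 'M[R]_4 := \matrix_(i < 4) nth 0 [:: x; N; v1; v2] i.

Let comb (c : 'rV[R]_4) : c *m M =
  c 0 (inord 0) *: x + c 0 (inord 1) *: N + c 0 (inord 2) *: v1 + c 0 (inord 3) *: v2.
Proof.
rewrite mulmx_sum_row !big_ord_recr big_ord0 /= add0r !rowK /=.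
by congr (c 0 _ *: _ + c 0 _ *: _ + c 0 _ *: _ + c 0 _ *: _); apply: val_inj; rewrite /= inordK.
Qed.

Let M_unit : M \in unitmx.
Proof.
rewrite -row_free_unit -kermx_eq0; apply/eqP/row_matrixP => i; rewrite row0.
set c := row i (kermx M); have : c *m M = 0 by apply/sub_kermxP; exact: row_sub.
rewrite comb; set c0 := c 0 _; set c1 := c 0 _; set c2 := c 0 _; set c3 := c 0 _ => h.
have H w : c0 * dot x w + c1 * dot N w + c2 * dot v1 w + c3 * dot v2 w = 0.
  by rewrite -!dotZl -!dotDl h -(scale0r 0) dotZl mul0r.
have e0 : c0 = 0.
  have := H x; rewrite (dotC N) (dotC v1) (dotC v2) xN xv1 xv2 !mulr0 !addr0.
  by move/eqP; rewrite mulf_eq0 (negPf x0) orbF => /eqP.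
have e1 : c1 = 0.
  have := H N; rewrite xN (dotC v1) (dotC v2) Nv1 Nv2 !mulr0 !addr0 add0r.
  by move/eqP; rewrite mulf_eq0 (negPf N0) orbF => /eqP.
have [e2 e3] : c2 = 0 /\ c3 = 0.
  apply: (gram_solve gram).
    by have := H v1; rewrite xv1 Nv1 !mulr0 !add0r (dotC v2 v1).
  by have := H v2; rewrite xv2 Nv2 !mulr0 !add0r.
apply/rowP => j; rewrite [RHS]mxE.
case: j => [[|[|[|[|j]]]] jl] //.
- by rewrite -[RHS]e0 /c0; congr (c 0 _); apply: val_inj; rewrite /= inordK.
- by rewrite -[RHS]e1 /c1; congr (c 0 _); apply: val_inj; rewrite /= inordK.
- by rewrite -[RHS]e2 /c2; congr (c 0 _); apply: val_inj; rewrite /= inordK.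
- by rewrite -[RHS]e3 /c3; congr (c 0 _); apply: val_inj; rewrite /= inordK.
Qed.

Lemma frame_span w : exists c0 c1 c2 c3, w = c0 *: x + c1 *: N + c2 *: v1 + c3 *: v2.
Proof.
by rewrite -[w](mulmxKV M_unit) comb; do 4!eexists.
Qed.

Lemma frame_orth0 w : dot x w = 0 -> dot N w = 0 -> dot v1 w = 0 -> dot v2 w = 0 -> w = 0.
Proof.
move=> h0 h1 h2 h3; have [c0 [c1 [c2 [c3 e]]]] := frame_span w.
by apply: dot_eq0; rewrite {1}e !dotDl !dotZl h0 h1 h2 h3 !mulr0 !addr0.
Qed.

Lemma frame_tangent w : dot x w = 0 -> dot N w = 0 -> exists c d, w = c *: v1 + d *: v2.
Proof.
move=> h0 h1; have [c0 [c1 [c2 [c3 e]]]] := frame_span w.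
have e0 : c0 = 0.
  move: h0; rewrite e !dotDr !dotZr xN xv1 xv2 !mulr0 !addr0.
  by move/eqP; rewrite mulf_eq0 (negPf x0) orbF => /eqP.
have e1 : c1 = 0.
  move: h1; rewrite e !dotDr !dotZr (dotC N x) xN Nv1 Nv2 !mulr0 !addr0 add0r.
  by move/eqP; rewrite mulf_eq0 (negPf N0) orbF => /eqP.
by exists c2, c3; rewrite e e0 e1 !scale0r !add0r.
Qed.

End Frame.
End Frames.
(** * Estimates near the Clifford torus *)

Section Estimates.
Variable R : rcfType.
Implicit Types (e x y : R).

Lemma product_close e x y x' y' : `|x - x'| <= e -> `|y - y'| <= e ->
  `|x'| <= 1 -> `|y| <= 1 -> `|x * y - x' * y'| <= 2 * e.
Proof.
move=> hx hy x1 y1; have -> : x * y - x' * y' = (x - x') * y + x' * (y - y') by ring.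
apply: (le_trans (ler_normD _ _)); rewrite !normrM mulr_natl mulr2n.
apply: lerD.
  by rewrite -[e]mulr1; apply: ler_pM.
by rewrite -[e]mul1r; apply: ler_pM.
Qed.

Lemma sum_close e (w u v u' v' : 'I_4 -> R) :
  (forall k, `|w k| <= 1) -> (forall k, `|u k - u' k| <= e) -> (forall k, `|v k - v' k| <= e) ->
  (forall k, `|u' k| <= 1) -> (forall k, `|v k| <= 1) ->
  `|\sum_(k < 4) w k * u k * v k - \sum_(k < 4) w k * u' k * v' k| <= 8 * e.
Proof.
move=> hw hu hv u1 v1; rewrite -sumrB; apply: (le_trans (ler_norm_sum _ _ _)).
apply: (@le_trans _ _ (\sum_(k < 4) (2 * e))); last first.
  by rewrite sumr_const card_ord le_eqVlt; apply/orP; left; apply/eqP; ring.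
apply: ler_sum => k _; rewrite -!mulrA -mulrBr normrM -[leRHS]mul1r.
by apply: ler_pM => //; exact: product_close.
Qed.

Lemma metric_close e (E F G : R) : 0 <= e -> 60 * e <= 1 / 2000 ->
  `|E - 1 / 2| <= 8 * e -> `|F| <= 8 * e -> `|G - 1 / 2| <= 8 * e ->
  let D := Num.sqrt (E * G - F ^+ 2) in
  [/\ 0 < E * G - F ^+ 2, 2 / 5 <= D, `|D - 1 / 2| <= 60 * e,
      `|G / D - 1| <= 60 * e & `|F / D| <= 60 * e /\ `|E / D - 1| <= 60 * e].
Proof.
move=> e0 es hE hF hG D.
have q x y : `|x| <= 8 * e -> `|y| <= 8 * e -> `|x * y| <= e / 10.
  move=> hx hy; rewrite normrM; apply: (@le_trans _ _ (8 * e * (8 * e))).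
    by apply: ler_pM.
  have : e * e <= 1 / 2000 * e by apply: ler_wpM2r => //; lra.
  have -> : 8 * e * (8 * e) = 64 * (e * e) by ring.
  by move: (e * e) => z; lra.
have h1 := q _ _ hE hG; have h2 := q _ _ hF hF.
have hD : `|E * G - F ^+ 2 - 1 / 4| <= 9 * e.
  have -> : E * G - F ^+ 2 - 1 / 4 =
    (E - 1 / 2) * (G - 1 / 2) - F * F + ((E - 1 / 2) / 2 + (G - 1 / 2) / 2) by field.
  move: hE hG h1 h2; rewrite !ler_norml; move: ((E - 1 / 2) * _) (F * F) => z w.
  by move=> /andP[? ?] /andP[? ?] /andP[? ?] /andP[? ?]; apply/andP; split; lra.
have pos : 0 < E * G - F ^+ 2.
  move: hD; rewrite ler_norml => /andP[+ _]; clear D; move: (_ - F ^+ 2) => z h; lra.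
have D0 : 0 <= D := sqrtr_ge0 _.
have DD : D ^+ 2 = E * G - F ^+ 2 by rewrite sqr_sqrtr // ltW.
have hd : `|D - 1 / 2| <= 18 * e.
  have p : 0 < D + 1 / 2 by lra.
  rewrite -(ler_pM2r p) -{1}[D + 1 / 2]gtr0_norm // -normrM.
  have -> : (D - 1 / 2) * (D + 1 / 2) = D ^+ 2 - 1 / 4 by field.
  rewrite DD; apply: (le_trans hD).
  have -> : 9 * e = 18 * e * (1 / 2) by field.
  by apply: ler_wpM2l; lra.
have D25 : 2 / 5 <= D by move: hd; rewrite ler_norml => /andP[? _]; lra.
have Dp : 0 < D by lra.
have D12 : 48 / 100 <= D by move: hd; rewrite ler_norml => /andP[? _]; lra.
have quo x : `|x| <= 26 * e -> `|x / D| <= 60 * e.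
  move=> hx; rewrite normrM normfV (ger0_norm D0) ler_pdivrMr //; apply: (le_trans hx).
  have : 60 * e * (48 / 100) <= 60 * e * D by apply: ler_wpM2l => //; lra.
  by move: (60 * e * D) => z; lra.
have nz : D != 0 by rewrite gt_eqF.
have hGD : `|G - D| <= 26 * e.
  by move: hd hG; rewrite !ler_norml => /andP[? ?] /andP[? ?]; apply/andP; split; lra.
have hED : `|E - D| <= 26 * e.
  by move: hd hE; rewrite !ler_norml => /andP[? ?] /andP[? ?]; apply/andP; split; lra.
have uG : G / D - 1 = (G - D) / D by field.
have uE : E / D - 1 = (E - D) / D by field.
split=> //; first by apply: (le_trans hd); lra.
  by rewrite uG; exact: quo.
split; last by rewrite uE; exact: quo.
by apply: quo; apply: (le_trans hF); lra.
Qed.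

(** Multiplied by the squared length [U] of [(y0, y1)], the area [X] spanned by
    the two vectors becomes a combination of their inner products with
    [(y0, y1)]. *)
Lemma factor_area (y0 y1 p0 p1 q0 q1 m n : R) :
  y0 * p0 + y1 * p1 = m / 4 -> y0 * q0 + y1 * q1 = n / 4 ->
  2 / 5 <= y0 ^+ 2 + y1 ^+ 2 -> p0 ^+ 2 + p1 ^+ 2 + (q0 ^+ 2 + q1 ^+ 2) <= 11 / 10 ->
  (p0 * q1 - p1 * q0) ^+ 2 <= 1 / 5 * (m ^+ 2 + n ^+ 2).
Proof.
move=> hm hn hU hE.
set U := y0 ^+ 2 + y1 ^+ 2 in hU *; set X := p0 * q1 - p1 * q0.
set A := y0 * p1 - y1 * p0; set B := y0 * q1 - y1 * q0.
have UX : U * X = m / 4 * B - n / 4 * A by rewrite -hm -hn /U /X /A /B; ring.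
have UX2 : (U * X) ^+ 2 <= 1 / 16 * ((m ^+ 2 + n ^+ 2) * (A ^+ 2 + B ^+ 2)).
  rewrite UX -subr_ge0.
  have -> : 1 / 16 * ((m ^+ 2 + n ^+ 2) * (A ^+ 2 + B ^+ 2)) - (m / 4 * B - n / 4 * A) ^+ 2
    = ((m * A + n * B) / 4) ^+ 2 by field.
  exact: sqr_ge0.
have AB : A ^+ 2 + B ^+ 2 <= U * (11 / 10).
  apply: (@le_trans _ _ (U * (p0 ^+ 2 + p1 ^+ 2 + (q0 ^+ 2 + q1 ^+ 2)))).
    rewrite -subr_ge0.
    have -> : U * (p0 ^+ 2 + p1 ^+ 2 + (q0 ^+ 2 + q1 ^+ 2)) - (A ^+ 2 + B ^+ 2) =
      (y0 * p0 + y1 * p1) ^+ 2 + (y0 * q0 + y1 * q1) ^+ 2 by rewrite /U /A /B; ring.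
    by rewrite addr_ge0 ?sqr_ge0.
  by apply: ler_wpM2l => //; lra.
have S0 : 0 <= m ^+ 2 + n ^+ 2 by rewrite addr_ge0 ?sqr_ge0.
move: (m ^+ 2 + n ^+ 2) S0 UX2 => S S0 UX2.
have U0 : 0 < U by lra.
have h : U * (U * X ^+ 2) <= U * (11 / 160 * S).
  have -> : U * (U * X ^+ 2) = (U * X) ^+ 2 by ring.
  apply: (le_trans UX2); have : S * (A ^+ 2 + B ^+ 2) <= S * (U * (11 / 10)) by exact: ler_wpM2l.
  have -> : U * (11 / 160 * S) = 1 / 16 * (S * (U * (11 / 10))) by field.
  by move: (S * _) (S * _) => z w; lra.
rewrite ler_pM2l // in h.
have : 2 / 5 * X ^+ 2 <= U * X ^+ 2 by apply: ler_wpM2r => //; exact: sqr_ge0.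
move: (U * X ^+ 2) h => z h h'; lra.
Qed.

(** The numerator is twice the difference of the squared areas of the projections
    of the parallelogram spanned by [p] and [q] to the two plane factors. *)
Lemma trace_small_coords (y0 y1 y2 y3 p0 p1 p2 p3 q0 q1 q2 q3 s1 s2 D E F G : R) :
  E = p0 * p0 + p1 * p1 + p2 * p2 + p3 * p3 ->
  F = p0 * q0 + p1 * q1 + p2 * q2 + p3 * q3 ->
  G = q0 * q0 + q1 * q1 + q2 * q2 + q3 * q3 ->
  y0 * p0 + y1 * p1 + y2 * p2 + y3 * p3 = 0 ->
  y0 * q0 + y1 * q1 + y2 * q2 + y3 * q3 = 0 ->
  s1 = 2 * (y0 * p0 + y1 * p1 - y2 * p2 - y3 * p3) ->
  s2 = 2 * (y0 * q0 + y1 * q1 - y2 * q2 - y3 * q3) ->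
  2 / 5 <= y0 ^+ 2 + y1 ^+ 2 -> 2 / 5 <= y2 ^+ 2 + y3 ^+ 2 ->
  E + G <= 11 / 10 -> 2 / 5 <= D ->
  `|(G * (p0 * p0 + p1 * p1 - p2 * p2 - p3 * p3)
     - 2 * F * (p0 * q0 + p1 * q1 - p2 * q2 - p3 * q3)
     + E * (q0 * q0 + q1 * q1 - q2 * q2 - q3 * q3)) / D|
   <= 2 * (s1 ^+ 2 + s2 ^+ 2).
Proof.
move=> eE eF eG hp hq h1 h2 hU hV hE hD.
have m1 : y0 * p0 + y1 * p1 = s1 / 4 by lra.
have n1 : y0 * q0 + y1 * q1 = s2 / 4 by lra.
have m2 : y2 * p2 + y3 * p3 = (- s1) / 4 by lra.
have n2 : y2 * q2 + y3 * q3 = (- s2) / 4 by lra.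
have X := @factor_area y0 y1 p0 p1 q0 q1 s1 s2 m1 n1 hU.
have Y := @factor_area y2 y3 p2 p3 q2 q3 (- s1) (- s2) m2 n2 hV.
rewrite !sqrrN in Y.
have {}X : (p0 * q1 - p1 * q0) ^+ 2 <= 1 / 5 * (s1 ^+ 2 + s2 ^+ 2).
  apply: X; have := sqr_ge0 p2; have := sqr_ge0 p3; have := sqr_ge0 q2; have := sqr_ge0 q3.
  by move: hE; rewrite eE eG; lra.
have {}Y : (p2 * q3 - p3 * q2) ^+ 2 <= 1 / 5 * (s1 ^+ 2 + s2 ^+ 2).
  apply: Y; have := sqr_ge0 p0; have := sqr_ge0 p1; have := sqr_ge0 q0; have := sqr_ge0 q1.
  by move: hE; rewrite eE eG; lra.
rewrite (_ : _ + _ + _ = 2 * ((p0 * q1 - p1 * q0) ^+ 2 - (p2 * q3 - p3 * q2) ^+ 2)); last first.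
  by rewrite eE eG eF; ring.
have D0 : 0 < D by lra.
rewrite normrM normfV [`|D|]gtr0_norm // ler_pdivrMr // normrM [`|2|]ger0_norm //.
move: (sqr_ge0 (p0 * q1 - p1 * q0)) (sqr_ge0 (p2 * q3 - p3 * q2)) X Y.
move: ((p0 * q1 - p1 * q0) ^+ 2) ((p2 * q3 - p3 * q2) ^+ 2) => A B A0 B0.
have S0 : 0 <= s1 ^+ 2 + s2 ^+ 2 by rewrite addr_ge0 ?sqr_ge0.
move: (s1 ^+ 2 + s2 ^+ 2) S0 => S S0 hA hB.
clear -S0 hA hB A0 B0 hD; have hAB : `|A - B| <= 1 / 5 * S by rewrite ler_norml; apply/andP; split; lra.
have : 2 * S * (2 / 5) <= 2 * S * D by apply: ler_wpM2l => //; lra.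
move: (2 * S * D) => z hz; lra.
Qed.

End Estimates.
(** * Minimal tori close to the Clifford torus *)

Section LaplacePosition.
Variable R : realType.
Variables (y p q pp pq qq N : 'rV[R]_4) (E F G D D1 D2 al al1 be be1 be2 ga ga2 : R).

(** The coordinates of a minimal immersion into the sphere satisfy
    [Laplacian y = - 2 y].  Here the Laplacian is written out in divergence
    form, [al = G / D], [be = F / D], [ga = E / D] with [D] the area density,
    and a subscript 1 or 2 stands for a partial derivative; the numerical
    hypotheses are the first derivatives of the relations between these
    functions. *)
Lemma laplace_position :
  E = dot p p -> F = dot p q -> G = dot q q ->
  D != 0 -> D ^+ 2 = E * G - F ^+ 2 -> al * D = G -> be * D = F -> ga * D = E ->
  dot y y = 1 -> dot y p = 0 -> dot y q = 0 ->
  dot y pp = - E -> dot y pq = - F -> dot y qq = - G ->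
  D * D1 = G * dot p pp + E * dot q pq - F * (dot pp q + dot p pq) ->
  D * D2 = G * dot p pq + E * dot q qq - F * (dot pq q + dot p qq) ->
  al1 * E + al * (2 * dot p pp) - be1 * F - be * (dot pp q + dot p pq) = D1 ->
  ga2 * F + ga * (dot pq q + dot p qq) - be2 * E - be * (2 * dot p pq) = 0 ->
  al1 * F + al * (dot pp q + dot p pq) - be1 * G - be * (2 * dot q pq) = 0 ->
  ga2 * G + ga * (2 * dot q qq) - be2 * F - be * (dot pq q + dot p qq) = D2 ->
  dot N N != 0 -> dot N y = 0 -> dot N p = 0 -> dot N q = 0 ->
  G * dot N pp - 2 * F * dot N pq + E * dot N qq = 0 ->
  (al1 - be2) *: p + (ga2 - be1) *: q + al *: pp - (2 * be) *: pq + ga *: qq = - (2 * D) *: y.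
Proof.
move=> hE hF hG D0 DD hal hbe hga yy yp yq ypp ypq yqq hD1 hD2 c1 c2 c3 c4 N0 Ny Np Nq min.
set W := LHS; apply/eqP; rewrite -subr_eq0 scaleNr opprK; apply/eqP.
have e v : dot v (W + (2 * D) *: y) = (al1 - be2) * dot v p + (ga2 - be1) * dot v q
   + al * dot v pp - 2 * be * dot v pq + ga * dot v qq + 2 * D * dot v y.
  by rewrite /W !dotDr !dotZr -scaleNr dotZr mulNr.
apply: (@frame_orth0 R y N p q) => //.
- by rewrite yy oner_neq0.
- by rewrite dotC.
- by rewrite -hE -hG -hF -DD expf_neq0.
- apply: (mulfI D0); rewrite e yy yp yq ypp ypq yqq.
  have -> : D * ((al1 - be2) * 0 + (ga2 - be1) * 0 + al * - E - 2 * be * - F + ga * - G + 2 * D * 1)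
     = - (al * D) * E + 2 * (be * D) * F - (ga * D) * G + 2 * D ^+ 2 by ring.
  by rewrite hal hbe hga DD; ring.
- apply: (mulfI D0); rewrite e Ny Np Nq.
  have -> : D * ((al1 - be2) * 0 + (ga2 - be1) * 0 + al * dot N pp - 2 * be * dot N pq
     + ga * dot N qq + 2 * D * 0)
     = (al * D) * dot N pp - 2 * (be * D) * dot N pq + (ga * D) * dot N qq by ring.
  by rewrite hal hbe hga mulr0 min.
- apply: (mulfI D0); rewrite e (dotC p y) yp -hE -hF mulr0 addr0 mulr0.
  have -> : D * ((al1 - be2) * E + (ga2 - be1) * F + al * dot p pp - 2 * be * dot p pq + ga * dot p qq)
    = D * (al1 * E + al * (2 * dot p pp) - be1 * F - be * (dot pp q + dot p pq))
    + D * (ga2 * F + ga * (dot pq q + dot p qq) - be2 * E - be * (2 * dot p pq))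
    - ((al * D) * dot p pp + (ga * D) * dot pq q - (be * D) * (dot pp q + dot p pq)) by ring.
  by rewrite c1 c2 hal hbe hga hD1 (dotC pq q); ring.
- apply: (mulfI D0); rewrite e (dotC q y) yq -hG (dotC q p) -hF mulr0 addr0 mulr0.
  have -> : D * ((al1 - be2) * F + (ga2 - be1) * G + al * dot q pp - 2 * be * dot q pq + ga * dot q qq)
    = D * (al1 * F + al * (dot pp q + dot p pq) - be1 * G - be * (2 * dot q pq))
    + D * (ga2 * G + ga * (2 * dot q qq) - be2 * F - be * (dot pq q + dot p qq))
    + ((al * D) * (dot q pp - dot pp q - dot p pq) - (ga * D) * dot q qq
       + (be * D) * (dot pq q + dot p qq)) by ring.
  by rewrite c3 c4 hal hbe hga hD2 (dotC pp q); ring.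
Qed.

End LaplacePosition.

Section TorusSurfaces.
Variable R : realType.
Implicit Types (u v : R -> R -> 'rV[R]_4).

Definition wdot (w : 'I_4 -> R) (x z : 'rV[R]_4) : R := \sum_(k < 4) w k * x 0 k * z 0 k.

Definition sgn4 (k : 'I_4) : R := if (k < 2)%N then 1 else - 1.

(** The quadratic form that cuts the Clifford torus out of the sphere. *)
Definition qf : 'rV[R]_4 -> 'rV[R]_4 -> R := wdot sgn4.

Lemma wdotC w x z : wdot w x z = wdot w z x.
Proof. by apply: eq_bigr => k _; ring. Qed.

Lemma wdotDr w x z z' : wdot w x (z + z') = wdot w x z + wdot w x z'.
Proof. by rewrite /wdot -big_split; apply: eq_bigr => k _; rewrite mxE mulrDr. Qed.

Lemma wdotZr w x c z : wdot w x (c *: z) = c * wdot w x z.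
Proof. by rewrite /wdot mulr_sumr; apply: eq_bigr => k _; rewrite mxE; ring. Qed.

Lemma dotE (x z : 'rV[R]_4) : dot x z = wdot (fun=> 1) x z.
Proof. by apply: eq_bigr => k _; rewrite mul1r. Qed.

Lemma sum4 (f : 'I_4 -> R) :
  \sum_(k < 4) f k = f (inord 0) + f (inord 1) + f (inord 2) + f (inord 3).
Proof.
rewrite !big_ord_recr big_ord0 /= add0r.
by congr (f _ + f _ + f _ + f _); apply: val_inj; rewrite /= inordK.
Qed.

Lemma qfE (x z : 'rV[R]_4) : qf x z = x 0 (inord 0) * z 0 (inord 0) + x 0 (inord 1) * z 0 (inord 1)
  - x 0 (inord 2) * z 0 (inord 2) - x 0 (inord 3) * z 0 (inord 3).
Proof. by rewrite /qf /wdot sum4 /sgn4 !inordK //=; ring. Qed.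

Lemma dot4E (x z : 'rV[R]_4) : dot x z = x 0 (inord 0) * z 0 (inord 0) + x 0 (inord 1) * z 0 (inord 1)
  + x 0 (inord 2) * z 0 (inord 2) + x 0 (inord 3) * z 0 (inord 3).
Proof. by rewrite /dot sum4. Qed.

Definition C1V u u1 u2 : Prop :=
  forall k, C1T (fun a b => u a b 0 k) (fun a b => u1 a b 0 k) (fun a b => u2 a b 0 k).

Lemma C1V_wdot w u u1 u2 v v1 v2 : C1V u u1 u2 -> C1V v v1 v2 ->
  C1T (fun a b => wdot w (u a b) (v a b))
      (fun a b => wdot w (u1 a b) (v a b) + wdot w (u a b) (v1 a b))
      (fun a b => wdot w (u2 a b) (v a b) + wdot w (u a b) (v2 a b)).
Proof.
move=> Hu Hv.
have H k := C1TM (C1TM (@C1T_cst R (w k)) (Hu k)) (Hv k).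
apply: (C1T_ext (C1T_sum (index_enum 'I_4) H)) => // a b;
  by rewrite /wdot -big_split; apply: eq_bigr => k _ /=; ring.
Qed.

Lemma C1V_dot u u1 u2 v v1 v2 : C1V u u1 u2 -> C1V v v1 v2 ->
  C1T (fun a b => dot (u a b) (v a b))
      (fun a b => dot (u1 a b) (v a b) + dot (u a b) (v1 a b))
      (fun a b => dot (u2 a b) (v a b) + dot (u a b) (v2 a b)).
Proof.
by move=> Hu Hv; apply: (C1T_ext (C1V_wdot (fun=> 1) Hu Hv)) => a b; rewrite !dotE.
Qed.

Lemma C1T_unique1 (A A1 A2 B B1 B2 : R -> R -> R) : C1T A A1 A2 -> C1T B B1 B2 ->
  (forall a b, A a b = B a b) -> forall a b, A1 a b = B1 a b.
Proof.
move=> HA HB e a b; apply: (der_unique (C1T_der1 HA a b)).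
by apply: (der_eq (C1T_der1 HB a b)).
Qed.

Lemma C1T_unique2 (A A1 A2 B B1 B2 : R -> R -> R) : C1T A A1 A2 -> C1T B B1 B2 ->
  (forall a b, A a b = B a b) -> forall a b, A2 a b = B2 a b.
Proof.
move=> HA HB e a b; apply: (der_unique (C1T_der2 HA a b)).
by apply: (der_eq (C1T_der2 HB a b)).
Qed.

Lemma sphere_tangent (u u1 u2 : R -> R -> 'rV[R]_4) : C1V u u1 u2 ->
  (forall a b, dot (u a b) (u a b) = 1) ->
  forall a b, dot (u a b) (u1 a b) = 0 /\ dot (u a b) (u2 a b) = 0.
Proof.
move=> Hu e a b; have C := C1V_dot Hu Hu.
have half (x : R) : x + x = 0 -> x = 0 by move/eqP; rewrite -mulr2n mulrn_eq0 /= => /eqP.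
split; apply: half.
  by rewrite {1}dotC; exact: (C1T_unique1 C (@C1T_cst R 1) e).
by rewrite {1}dotC; exact: (C1T_unique2 C (@C1T_cst R 1) e).
Qed.

End TorusSurfaces.
Lemma divergence_parts (R : realType) (w1 w11 w12 w2 w21 w22 e e1 e2 f : R -> R -> R) :
  C1T w1 w11 w12 -> C1T w2 w21 w22 -> C1T e e1 e2 ->
  (forall a b, w11 a b + w22 a b = - f a b) ->
  iint (fun a b => w1 a b * e1 a b + w2 a b * e2 a b) = iint (fun a b => f a b * e a b).
Proof.
move=> H1 H2 He hf.
have cf : cont2 f.
  apply: (cont2_ext (cont2N (cont2D (C1T_cont1 H1) (C1T_cont2 H2)))) => a b.
  by rewrite hf opprK.
have Z1 := C1TM H1 He; have Z2 := C1TM H2 He.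
have cw := cont2D (cont2M (C1T_cont H1) (C1T_cont1 He)) (cont2M (C1T_cont H2) (C1T_cont2 He)).
apply/eqP; rewrite -subr_eq0 -(iintB cw (cont2M cf (C1T_cont He))); apply/eqP.
rewrite -[RHS](addr0 0) -[X in X + _](iint_d1 Z1) -[X in _ + X](iint_d2 Z2).
rewrite -(iintD (C1T_cont1 Z1) (C1T_cont2 Z2)); apply: iint_ext => a b /=.
by rewrite -[f a b]opprK -hf; ring.
Qed.

(** On the Clifford torus the quadratic form has trace zero on the tangent plane.
    Near it the trace is quadratic in the tangential part of the form. *)
Lemma trace_small (R : realType) (y p q : 'rV[R]_4) (D : R) :
  dot y y = 1 -> `|qf y y| <= 1 / 10 -> dot y p = 0 -> dot y q = 0 ->
  dot p p + dot q q <= 11 / 10 -> 2 / 5 <= D ->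
  `|(dot q q * qf p p - 2 * dot p q * qf p q + dot p p * qf q q) / D|
  <= 2 * ((2 * qf y p) ^+ 2 + (2 * qf y q) ^+ 2).
Proof.
move=> yy ys yp yq hE hD; rewrite !(qfE p) !(qfE q).
have [U V] : 2 / 5 <= y 0 (inord 0) ^+ 2 + y 0 (inord 1) ^+ 2 /\
             2 / 5 <= y 0 (inord 2) ^+ 2 + y 0 (inord 3) ^+ 2.
  move: yy ys; rewrite dot4E qfE -!expr2 ler_norml => yy /andP[s1 s2].
  clear -yy s1 s2; move: (_ ^+ 2) (_ ^+ 2) (_ ^+ 2) (_ ^+ 2) yy s1 s2 => A B C E yy s1 s2.
  by split; lra.
by apply: trace_small_coords (dot4E _ _) (dot4E _ _) (dot4E _ _) _ _ _ _ U V hE hD;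
  rewrite -?dot4E -?qfE.
Qed.

Lemma trace_hypotheses (R : realType) (e s E G : R) : 0 <= e -> 60 * e <= 1 / 2000 ->
  `|s| <= 60 * e -> `|E - 1 / 2| <= 8 * e -> `|G - 1 / 2| <= 8 * e ->
  `|s| <= 1 / 10 /\ E + G <= 11 / 10.
Proof.
move=> e0 es hs; rewrite !ler_norml => /andP[_ hE] /andP[_ hG]; split; last by lra.
by move: hs; rewrite ler_norml => /andP[? ?]; apply/andP; split; lra.
Qed.

Section NearClifford.
Variable R : realType.

Definition clif (a b : R) : 'rV[R]_4 :=
  \row_(k < 4) (Num.sqrt 2 / 2 * nth 0 [:: cos a; sin a; cos b; sin b] k).
Definition clif1 (a b : R) : 'rV[R]_4 :=
  \row_(k < 4) (Num.sqrt 2 / 2 * nth 0 [:: - sin a; cos a; 0; 0] k).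
Definition clif2 (a b : R) : 'rV[R]_4 :=
  \row_(k < 4) (Num.sqrt 2 / 2 * nth 0 [:: 0; 0; - sin b; cos b] k).

Lemma half_sqrt2_sqr : (Num.sqrt 2 / 2) ^+ 2 = 1 / 2 :> R.
Proof. by rewrite expr_div_n sqr_sqrtr //; field. Qed.

Let r := Num.sqrt 2 / 2 : R.

Lemma half_sqrt2_bound : 0 <= r /\ r <= 3 / 4.
Proof.
have r0 : 0 <= r by rewrite divr_ge0 ?sqrtr_ge0.
split=> //; have := half_sqrt2_sqr; rewrite -/r; move: (r) r0 => x x0 h.
by rewrite leNgt; apply/negP => h1; nra.
Qed.

Let sin1 (t : R) : `|sin t| <= 1. Proof. by rewrite ler_norml sin_geN1 sin_le1. Qed.
Let cos1 (t : R) : `|cos t| <= 1. Proof. by rewrite ler_norml cos_geN1 cos_le1. Qed.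

Let coord_bound (l : seq R) (k : 'I_4) : (forall x, x \in l -> `|x| <= 1) ->
  `|r * nth 0 l k| <= 3 / 4.
Proof.
have [r0 r34] := half_sqrt2_bound => H; rewrite normrM (ger0_norm r0) -[leRHS]mulr1.
apply: ler_pM => //; have [kl|kl] := ltnP k (size l); first exact: (H _ (mem_nth 0 kl)).
by rewrite nth_default // normr0.
Qed.

Lemma clif_bound a b k : `|clif a b 0 k| <= 3 / 4.
Proof. by rewrite mxE; apply: coord_bound => x; rewrite !inE => /or4P[] /eqP->. Qed.

Lemma clif1_bound a b k : `|clif1 a b 0 k| <= 3 / 4.
Proof.
rewrite mxE; apply: coord_bound => x; rewrite !inE => /or4P[] /eqP->;
  by rewrite ?normrN ?normr0 ?ler01.
Qed.

Lemma clif2_bound a b k : `|clif2 a b 0 k| <= 3 / 4.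
Proof.
rewrite mxE; apply: coord_bound => x; rewrite !inE => /or4P[] /eqP->;
  by rewrite ?normrN ?normr0 ?ler01.
Qed.

Let rr : r * r = 1 / 2. Proof. by rewrite -expr2 half_sqrt2_sqr. Qed.

Let cs2 (t : R) : cos t * cos t + sin t * sin t = 1.
Proof. by rewrite -!expr2 cos2Dsin2. Qed.

Let half4 x0 x1 x2 x3 z0 z1 z2 z3 : r * x0 * (r * z0) + r * x1 * (r * z1)
   + r * x2 * (r * z2) + r * x3 * (r * z3) = (x0 * z0 + x1 * z1 + x2 * z2 + x3 * z3) / 2.
Proof.
have -> : r * x0 * (r * z0) + r * x1 * (r * z1) + r * x2 * (r * z2) + r * x3 * (r * z3)
  = r * r * (x0 * z0 + x1 * z1 + x2 * z2 + x3 * z3) by ring.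
by rewrite rr; field.
Qed.

Let half4q x0 x1 x2 x3 z0 z1 z2 z3 : r * x0 * (r * z0) + r * x1 * (r * z1)
   - r * x2 * (r * z2) - r * x3 * (r * z3) = (x0 * z0 + x1 * z1 - x2 * z2 - x3 * z3) / 2.
Proof.
have -> : r * x0 * (r * z0) + r * x1 * (r * z1) - r * x2 * (r * z2) - r * x3 * (r * z3)
  = r * r * (x0 * z0 + x1 * z1 - x2 * z2 - x3 * z3) by ring.
by rewrite rr; field.
Qed.

Lemma clif_dot a b : dot (clif1 a b) (clif1 a b) = 1 / 2 /\
  dot (clif1 a b) (clif2 a b) = 0 /\ dot (clif2 a b) (clif2 a b) = 1 / 2.
Proof.
rewrite !dot4E !mxE !inordK //= !half4.
have := cs2 a; have := cs2 b; rewrite !mulrNN !mul0r !mulr0.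
by move=> h1 h2; split; [|split]; lra.
Qed.

Lemma clif_qf a b : qf (clif a b) (clif a b) = 0 /\
  qf (clif a b) (clif1 a b) = 0 /\ qf (clif a b) (clif2 a b) = 0.
Proof.
rewrite !qfE !mxE !inordK //= !half4q.
have := cs2 a; have := cs2 b.
by move=> h1 h2; split; [|split]; lra.
Qed.

Lemma le34 (x : R) : `|x| <= 3 / 4 -> `|x| <= 1.
Proof. move=> h; lra. Qed.

Lemma near_bounded (e x z : R) : 0 <= e -> 60 * e <= 1 / 2000 ->
  `|x - z| <= e -> `|z| <= 3 / 4 -> `|x| <= 1.
Proof.
move=> e0 es h1 h2; have -> : x = (x - z) + z by ring.
apply: (le_trans (ler_normD _ _)); lra.
Qed.

Lemma kernel_constant (e x : R) : 0 <= e -> x <= 2 * e -> 2 * x <= 4 * (60 * e).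
Proof. by move=> *; lra. Qed.

Lemma eight_le_sixty (e x : R) : 0 <= e -> x <= 8 * e -> x <= 60 * e /\ 2 * x <= 60 * e.
Proof. by move=> *; split; lra. Qed.

Variables (e : R) (y p q pp pq qq : R -> R -> 'rV[R]_4).
Hypotheses (e0 : 0 <= e) (es : 60 * e <= 1 / 2000).
Hypotheses (Hy : C1V y p q) (Hp : C1V p pp pq) (Hq : C1V q pq qq).
Hypothesis sphere : forall a b, dot (y a b) (y a b) = 1.
Hypotheses (ny : forall a b k, `|y a b 0 k - clif a b 0 k| <= e)
  (np : forall a b k, `|p a b 0 k - clif1 a b 0 k| <= e)
  (nq : forall a b k, `|q a b 0 k - clif2 a b 0 k| <= e).

Let E (a b : R) : R := dot (p a b) (p a b).
Let F (a b : R) : R := dot (p a b) (q a b).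
Let G (a b : R) : R := dot (q a b) (q a b).

Hypothesis minimal_at : forall a b, exists N : 'rV[R]_4,
  [/\ dot N N != 0, dot N (y a b) = 0, dot N (p a b) = 0, dot N (q a b) = 0 &
      G a b * dot N (pp a b) - 2 * F a b * dot N (pq a b) + E a b * dot N (qq a b) = 0].

Let s (a b : R) : R := qf (y a b) (y a b).

Hypothesis balanced : forall i j, (i < 2)%N -> (j < 2)%N ->
  iint (fun a b => s a b * y a b 0 (inord i) * y a b 0 (inord (2 + j))) = 0.

Let s1 (a b : R) : R := 2 * qf (y a b) (p a b).
Let s2 (a b : R) : R := 2 * qf (y a b) (q a b).

Let close w (u u' v v' : 'rV[R]_4) : (forall k, `|w k| <= 1) ->
  (forall k, `|u 0 k - u' 0 k| <= e) -> (forall k, `|v 0 k - v' 0 k| <= e) ->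
  (forall k, `|u' 0 k| <= 3 / 4) -> (forall k, `|v' 0 k| <= 3 / 4) ->
  `|wdot w u v - wdot w u' v'| <= 8 * e.
Proof.
move=> hw hu hv u1 v1; apply: sum_close => // k; first exact: le34.
exact: near_bounded e0 es (hv k) (v1 k).
Qed.

Let one1 (k : 'I_4) : `|(1 : R)| <= 1. Proof. by rewrite normr1. Qed.
Let sgn1 (k : 'I_4) : `|sgn4 R k| <= 1.
Proof. by rewrite /sgn4; case: ifP; rewrite ?normrN normr1. Qed.

Let EFG_close a b :
  [/\ `|E a b - 1 / 2| <= 8 * e, `|F a b| <= 8 * e & `|G a b - 1 / 2| <= 8 * e].
Proof.
have [h1 [h2 h3]] := clif_dot a b; rewrite -[F a b]subr0 -{1}h1 -{}h2 -{}h3 /E /F /G !dotE.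
split; apply: close => //; by move=> k; first [exact: clif1_bound|exact: clif2_bound].
Qed.

Let s_close a b : [/\ `|s a b| <= 60 * e, `|s1 a b| <= 60 * e & `|s2 a b| <= 60 * e].
Proof.
have [h1 [h2 h3]] := clif_qf a b.
have c1 : `|s a b| <= 8 * e.
  rewrite -[s a b]subr0 -h1; apply: close => //; by move=> k; exact: clif_bound.
have c2 : `|qf (y a b) (p a b)| <= 8 * e.
  rewrite -[qf _ _]subr0 -h2; apply: close => //; by move=> k; first [exact: clif_bound|exact: clif1_bound].
have c3 : `|qf (y a b) (q a b)| <= 8 * e.
  rewrite -[qf _ _]subr0 -h3; apply: close => //; by move=> k; first [exact: clif_bound|exact: clif2_bound].
rewrite /s1 /s2 !normrM [`|2|]ger0_norm //.
have [? _] := eight_le_sixty e0 c1; have [_ ?] := eight_le_sixty e0 c2.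
by have [_ ?] := eight_le_sixty e0 c3.
Qed.

Let D (a b : R) : R := Num.sqrt (E a b * G a b - F a b ^+ 2).
Let al (a b : R) : R := G a b / D a b.
Let be (a b : R) : R := F a b / D a b.
Let ga (a b : R) : R := E a b / D a b.

Let metric a b := let: And3 h1 h2 h3 := EFG_close a b in metric_close e0 es h1 h2 h3.

Let D2pos a b : 0 < E a b * G a b - F a b ^+ 2. Proof. by have [] := metric a b. Qed.
Let Dpos a b : 0 < D a b. Proof. by rewrite sqrtr_gt0. Qed.
Let Dn0 a b : D a b != 0. Proof. by rewrite gt_eqF. Qed.
Let DD a b : D a b ^+ 2 = E a b * G a b - F a b ^+ 2.
Proof. by rewrite sqr_sqrtr // ltW. Qed.
Let alD a b : al a b * D a b = G a b. Proof. by rewrite divfK. Qed.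
Let beD a b : be a b * D a b = F a b. Proof. by rewrite divfK. Qed.
Let gaD a b : ga a b * D a b = E a b. Proof. by rewrite divfK. Qed.

Let E1 (a b : R) : R := 2 * dot (p a b) (pp a b).
Let E2 (a b : R) : R := 2 * dot (p a b) (pq a b).
Let F1 (a b : R) : R := dot (pp a b) (q a b) + dot (p a b) (pq a b).
Let F2 (a b : R) : R := dot (pq a b) (q a b) + dot (p a b) (qq a b).
Let G1 (a b : R) : R := 2 * dot (q a b) (pq a b).
Let G2 (a b : R) : R := 2 * dot (q a b) (qq a b).

Let HE : C1T E E1 E2.
Proof.
apply: (C1T_ext (C1V_dot Hp Hp)) => // a b; rewrite ?/E1 ?/E2 mulr_natl mulr2n;
  by rewrite [X in X + _]dotC.
Qed.
Let HF : C1T F F1 F2. Proof. exact: (C1V_dot Hp Hq). Qed.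
Let HG : C1T G G1 G2.
Proof.
apply: (C1T_ext (C1V_dot Hq Hq)) => // a b; rewrite ?/G1 ?/G2 mulr_natl mulr2n;
  by rewrite [X in X + _]dotC.
Qed.

Let HD2 : C1T (fun a b => E a b * G a b - F a b ^+ 2)
  (fun a b => E1 a b * G a b + E a b * G1 a b - 2 * F a b * F1 a b)
  (fun a b => E2 a b * G a b + E a b * G2 a b - 2 * F a b * F2 a b).
Proof.
apply: (C1T_ext (C1TD (C1TM HE HG) (C1TN (C1TM HF HF)))) => a b; first by rewrite expr2.
  by ring.
by ring.
Qed.

Let D1 (a b : R) : R := (E1 a b * G a b + E a b * G1 a b - 2 * F a b * F1 a b) / (2 * D a b).
Let D2 (a b : R) : R := (E2 a b * G a b + E a b * G2 a b - 2 * F a b * F2 a b) / (2 * D a b).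
Let HD : C1T D D1 D2. Proof. exact: (C1T_sqrt D2pos HD2). Qed.
Let HDi := C1TV Dn0 HD.

Let quotient_C1 X X1 X2 : C1T X X1 X2 ->
  exists Y1 Y2, C1T (fun a b => X a b / D a b) Y1 Y2.
Proof. by move=> HX; do 2!eexists; exact: (C1TM HX HDi). Qed.

Let s_C1 : C1T s s1 s2.
Proof.
apply: (C1T_ext (C1V_wdot (sgn4 R) Hy Hy)) => // a b; rewrite /s1 /s2 mulr_natl mulr2n /qf;
  by rewrite [X in X + _]wdotC.
Qed.

Let K (a b : R) : R := (G a b * qf (p a b) (p a b) - 2 * F a b * qf (p a b) (q a b)
  + E a b * qf (q a b) (q a b)) / D a b.

Let ydot (v v1 v2 : R -> R -> 'rV[R]_4) : C1V v v1 v2 -> (forall a b, dot (y a b) (v a b) = 0) ->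
  forall a b, dot (y a b) (v1 a b) = - dot (p a b) (v a b) /\
              dot (y a b) (v2 a b) = - dot (q a b) (v a b).
Proof.
move=> Hv e1 a b; have H := C1V_dot Hy Hv; have Z := @C1T_cst R 0.
split; apply/eqP; rewrite -addr_eq0 addrC; apply/eqP.
  exact: (C1T_unique1 H Z e1).
exact: (C1T_unique2 H Z e1).
Qed.

Let yp a b : dot (y a b) (p a b) = 0. Proof. exact: (sphere_tangent Hy sphere a b).1. Qed.
Let yq a b : dot (y a b) (q a b) = 0. Proof. exact: (sphere_tangent Hy sphere a b).2. Qed.

(** Differentiating the four algebraic relations between the coefficients and the
    metric supplies the numerical hypotheses of [laplace_position]. *)
Let conservation : exists al1 al2 be1 be2 ga1 ga2 : R -> R -> R,
  [/\ C1T al al1 al2, C1T be be1 be2, C1T ga ga1 ga2 &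
  forall a b, (al1 a b - be2 a b) *: p a b + (ga2 a b - be1 a b) *: q a b + al a b *: pp a b
     - (2 * be a b) *: pq a b + ga a b *: qq a b = - (2 * D a b) *: y a b].
Proof.
have [al1 [al2 Hal]] := quotient_C1 HG; have [be1 [be2 Hbe]] := quotient_C1 HF.
have [ga1 [ga2 Hga]] := quotient_C1 HE.
exists al1, al2, be1, be2, ga1, ga2; split=> // a b.
have dD1 : D a b * D1 a b = G a b * dot (p a b) (pp a b) + E a b * dot (q a b) (pq a b)
    - F a b * F1 a b.
  rewrite /D1; move: (Dn0 a b) (F1 a b); rewrite /E1 /G1; move: (D a b) (E a b) (F a b) (G a b).
  by move: (dot _ _) (dot _ _) => x1 x2 d x3 x4 x5 d0 x6; field.
have dD2 : D a b * D2 a b = G a b * dot (p a b) (pq a b) + E a b * dot (q a b) (qq a b)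
    - F a b * F2 a b.
  rewrite /D2; move: (Dn0 a b) (F2 a b); rewrite /E2 /G2; move: (D a b) (E a b) (F a b) (G a b).
  by move: (dot _ _) (dot _ _) => x1 x2 d x3 x4 x5 d0 x6; field.
have r1 := C1TD (C1TM Hal HE) (C1TN (C1TM Hbe HF)).
have r2 := C1TD (C1TM Hga HF) (C1TN (C1TM Hbe HE)).
have r3 := C1TD (C1TM Hal HF) (C1TN (C1TM Hbe HG)).
have r4 := C1TD (C1TM Hga HG) (C1TN (C1TM Hbe HF)).
have u1 a' b' : al a' b' * E a' b' - be a' b' * F a' b' = D a' b'.
  apply: (mulfI (Dn0 a' b')); rewrite -expr2 DD.
  have -> : D a' b' * (al a' b' * E a' b' - be a' b' * F a' b') =
    (al a' b' * D a' b') * E a' b' - (be a' b' * D a' b') * F a' b' by ring.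
  by rewrite alD beD; ring.
have u2 a' b' : ga a' b' * F a' b' - be a' b' * E a' b' = 0.
  by rewrite /ga /be; ring.
have u3 a' b' : al a' b' * F a' b' - be a' b' * G a' b' = 0.
  by rewrite /al /be; ring.
have u4 a' b' : ga a' b' * G a' b' - be a' b' * F a' b' = D a' b'.
  apply: (mulfI (Dn0 a' b')); rewrite -expr2 DD.
  have -> : D a' b' * (ga a' b' * G a' b' - be a' b' * F a' b') =
    (ga a' b' * D a' b') * G a' b' - (be a' b' * D a' b') * F a' b' by ring.
  by rewrite gaD beD; ring.
have c1 := C1T_unique1 r1 HD u1 a b.
have c2 := C1T_unique2 r2 (@C1T_cst R 0) u2 a b.
have c3 := C1T_unique1 r3 (@C1T_cst R 0) u3 a b.
have c4 := C1T_unique2 r4 HD u4 a b.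
have [N [N0 Ny Np Nq min]] := minimal_at a b.
have [ypp ypq] := ydot Hp yp a b; have [_ yqq] := ydot Hq yq a b.
apply: (laplace_position (E := E a b) (F := F a b) (G := G a b) (D1 := D1 a b) (D2 := D2 a b)
   (al1 := al1 a b) (be1 := be1 a b) (N := N)) => //.
- by rewrite ypq dotC.
- by rewrite -c1 /E1 /F1 -/(al a b) -/(be a b); ring.
- by rewrite -c2 /E2 /F2 -/(ga a b) -/(be a b); ring.
- by rewrite -c3 /F1 /G1 -/(al a b) -/(be a b); ring.
- by rewrite -c4 /G2 /F2 -/(ga a b) -/(be a b); ring.
Qed.

Opaque iint.

Let KE a b : al a b * qf (p a b) (p a b) - 2 * be a b * qf (p a b) (q a b)
   + ga a b * qf (q a b) (q a b) = K a b.
Proof. by rewrite /K /al /be /ga; ring. Qed.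

(** Since [Laplacian y = - 2 y] holds in each coordinate, [D] times
    [Laplacian s + 4 s] is [2 K], with [K] equal to [D] times the metric trace of the
    quadratic form. *)
Let weak e' e1 e2 : C1T e' e1 e2 ->
  iint (fun a b => (al a b * s1 a b - be a b * s2 a b) * e1 a b
                 + (ga a b * s2 a b - be a b * s1 a b) * e2 a b) =
  iint (fun a b => (4 * D a b * s a b - 2 * K a b) * e' a b).
Proof.
move=> He; have [al1 [al2 [be1 [be2 [ga1 [ga2 [Hal Hbe Hga C]]]]]]] := conservation.
have Hs1 := C1TM (@C1T_cst R 2) (C1V_wdot (sgn4 R) Hy Hp).
have Hs2 := C1TM (@C1T_cst R 2) (C1V_wdot (sgn4 R) Hy Hq).
have W1 := C1TD (C1TM Hal Hs1) (C1TN (C1TM Hbe Hs2)).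
have W2 := C1TD (C1TM Hga Hs2) (C1TN (C1TM Hbe Hs1)).
apply: (divergence_parts (f := fun a b => 4 * D a b * s a b - 2 * K a b) W1 W2 He) => a b /=; rewrite -/(qf _ _).
have := congr1 (qf (y a b)) (C a b).
rewrite -(scaleNr (2 * be a b)) /qf !wdotDr !wdotZr -/(s a b) => Ca.
transitivity (2 * (- (2 * D a b) * s a b) + 2 * K a b); last first.
  by ring.
rewrite -Ca -KE /qf (wdotC _ (q a b) (p a b)); ring.
Qed.

Let mode_clif i j a b : (i < 2)%N -> (j < 2)%N ->
  md i.+1 a * md j.+1 b = 2 * (clif a b 0 (inord i) * clif a b 0 (inord (2 + j))).
Proof.
move=> hi hj.
have e1 (x z : R) : 2 * (r * x * (r * z)) = x * z.
  have -> : 2 * (r * x * (r * z)) = 2 * (r * r) * (x * z) by ring.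
  by rewrite rr; field.
rewrite !mxE !inordK ?e1; [|by case: j hj => [|[]]|by case: i hi => [|[]]].
by case: i hi => [|[|i]] // _; case: j hj => [|[|j]] // _; rewrite /= /cs /sn !mul1r.
Qed.

(** The kernel modes are products of coordinates of the Clifford torus, and [s] is
    orthogonal to the same products of coordinates of the nearby surface. *)
Let kernel_small i j : (0 < i < 3)%N -> (0 < j < 3)%N ->
  `|mode_coef s i j| <= 4 * (60 * e) * iint (fun a b => `|s a b|).
Proof.
case: i => // i /andP[_ hi]; case: j => // j /andP[_ hj].
have [cs_ _ _ _ _ _ _] := s_C1.
have cy k : cont2 (fun a b => y a b 0 k) := C1T_cont (Hy k).
have cyy := cont2M (cont2M cs_ (cy (inord i))) (cy (inord (2 + j))).
have cm := cont2M (cont2M cs_ (cont2_fst (@cts_md R i.+1))) (cont2_snd (@cts_md R j.+1)).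
have c2y := cont2M (@cont2_cst R 2) cyy.
have -> : mode_coef s i.+1 j.+1 = iint (fun a b => s a b * md i.+1 a * md j.+1 b
    - 2 * (s a b * y a b 0 (inord i) * y a b 0 (inord (2 + j)))).
  by rewrite (iintB cm c2y) (iintZ 2 cyy) balanced // mulr0 subr0.
have ca := cont2_abs cs_; rewrite -(iintZ _ ca).
apply: (iint_abs (cont2D cm (cont2N c2y)) (cont2M (@cont2_cst R _) ca)) => a b.
have -> : s a b * md i.+1 a * md j.+1 b - 2 * (s a b * y a b 0 (inord i) * y a b 0 (inord (2 + j)))
  = s a b * (md i.+1 a * md j.+1 b - 2 * (y a b 0 (inord i) * y a b 0 (inord (2 + j)))) by ring.
rewrite mode_clif // -mulrBr normrM mulrC; apply: ler_wpM2r; first exact: normr_ge0.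
have h := product_close (ny a b (inord i)) (ny a b (inord (2 + j)))
  (le34 (clif_bound _ _ _)) (near_bounded e0 es (ny a b _) (clif_bound _ _ _)).
rewrite distrC in h; rewrite normrM [`|2|]ger0_norm //.
exact: kernel_constant e0 h.
Qed.

(** On the Clifford torus [D = 1 / 2] and the coefficients [al], [be], [ga] are
    1, 0, 1, so that [s] satisfies a nearly flat equation with small coefficients
    along the kernel. *)
Theorem nearby_minimal_torus a b : qf (y a b) (y a b) = 0.
Proof.
have d0 : 0 <= 60 * e by apply: mulr_ge0.
have [cs_ _ _ _ _ _ _] := s_C1.
have cD := C1T_cont HD; have cDi := cont2V Dn0 cD.
have cqf u u1 u2 v v1 v2 (Hu : C1V u u1 u2) (Hv : C1V v v1 v2) :=
  C1T_cont (C1V_wdot (sgn4 R) Hu Hv).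
have cK : cont2 K.
  apply: (cont2M _ cDi); apply: (cont2D (cont2D (cont2M (C1T_cont HG) (cqf _ _ _ _ _ _ Hp Hp))
    (cont2N (cont2M (cont2M (@cont2_cst R 2) (C1T_cont HF)) (cqf _ _ _ _ _ _ Hp Hq))))
    (cont2M (C1T_cont HE) (cqf _ _ _ _ _ _ Hq Hq))).
apply: (@nearly_flat_rigidity R (60 * e) s s1 s2 al be ga D K d0 es s_C1
  (cont2M (C1T_cont HG) cDi) (cont2M (C1T_cont HF) cDi) (cont2M (C1T_cont HE) cDi) cD cK
  _ _ _ _ _ _ _ _ weak kernel_small) => {}a {}b.
- by have [] := metric a b.
- by have [_ _ _ _ []] := metric a b.
- by have [_ _ _ _ []] := metric a b.
- by have [] := metric a b.
- by have [] := s_close a b.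
- by have [] := s_close a b.
- by have [] := s_close a b.
have h1 := yp a b; have h2 := yq a b; have h3 := sphere a b.
have [_ hD _ _ _] := metric a b; have [hE _ hG] := EFG_close a b.
have [hs _ _] := s_close a b.
have [n1 n2] := trace_hypotheses e0 es hs hE hG.
exact: (trace_small h3 n1 h1 h2 n2 hD).
Qed.

End NearClifford.
(** * Differentiation along curves *)

Section Curves.
Variable R : realType.

Lemma cvg_row (T : Type) (F : set_system T) (FF : Filter F) n (f : T -> 'rV[R]_n) (l : 'rV[R]_n) :
  (forall j, (fun t => f t 0 j) @ F --> l 0 j) -> f @ F --> l.
Proof.
move=> H A /nbhs_ballP[e /= e0 eA].
have S : F (fun t => forall j : 'I_n, ball (l 0 j) e (f t 0 j)).
  by apply: filter_forall => j; exact: (H j _ (nbhsx_ballx _ _ e0)).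
apply: (@filterS _ F FF _ _ _ S) => t ht.
by apply: eA; split=> // i j; rewrite ord1.
Qed.

Lemma nbhs_coords n (x : 'rV[R]_n) (A : set 'rV[R]_n) : nbhs x A ->
  exists2 r : R, 0 < r & forall z : 'rV[R]_n, (forall j, `|z 0 j - x 0 j| < r) -> A z.
Proof.
move=> /nbhs_ballP[e /= e0 eA]; exists e => // z hz; apply: eA; split=> // i j.
by rewrite ord1 /ball /= distrC.
Qed.

Lemma derP (f : R -> R) t d : der f t d <->
  forall e, 0 < e -> exists2 r : R, 0 < r &
    forall h, `|h| < r -> `|f (t + h) - f t - d * h| <= e * `|h|.
Proof.
split.
  move=> [df dE] e e0.
  have L : (fun h => h^-1 *: (f (h *: 1 + t) - f t)) @ (0 : R)^' --> d by rewrite -dE; exact: df.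
  have [r /= r0 hr] := (cvgrPdist_le _ _).1 L e e0.
  exists r => // h hh; have [->|h0] := eqVneq h 0.
    by rewrite addr0 subrr mulr0 subr0 normr0 mulr0.
  have := hr h; rewrite /ball /= sub0r normrN => /(_ hh h0).
  rewrite /GRing.scale /= mulr1 [h + t]addrC => H.
  have -> : f (t + h) - f t - d * h = - (d - h^-1 * (f (t + h) - f t)) * h by field.
  by rewrite normrM normrN ler_wpM2r.
move=> H; have L : (fun h => h^-1 *: (f (h *: 1 + t) - f t)) @ (0 : R)^' --> d.
  apply/cvgrPdist_le => e e0; have [r r0 hr] := H e e0.
  near=> h.
  have h0 : h != 0 by near: h; exact: nbhs_dnbhs_neq.
  have hd : `|h| < r by near: h; apply: dnbhs0_lt.
  have {hr}hh := hr h hd; rewrite /GRing.scale /= mulr1 [h + t]addrC.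
  have -> : d - h^-1 * (f (t + h) - f t) = - (f (t + h) - f t - d * h) / h by field.
  by rewrite normrM normrN normfV ler_pdivrMr // normr_gt0.
by apply: DeriveDef; [apply/cvg_ex; exists d|exact: (cvg_lim _ L)].
Unshelve. all: by end_near. Qed.

Lemma der_line n (h : 'rV[R]_n -> R) z v t d : is_derive (z + t *: v) v h d ->
  der (fun t => h (z + t *: v)) t d.
Proof.
move=> [dh dE].
have e : (fun s => s^-1 *: (h (z + (s *: 1 + t) *: v) - h (z + t *: v))) =
         (fun s => s^-1 *: (h (s *: v + (z + t *: v)) - h (z + t *: v))).
  apply/funext => s; congr (_ *: (h _ - _)).
  have -> : s *: (1 : R) = s by exact: mulr1.
  by rewrite scalerDl addrCA.
apply: DeriveDef; first by rewrite /derivable e.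
by rewrite /derive e.
Qed.

Definition C1on n (U : set 'rV[R]_n) (h : 'rV[R]_n -> R) (hj : 'I_n -> 'rV[R]_n -> R) : Prop :=
  forall x, U x -> {for x, continuous h} /\
                   (forall j, is_derive x (delta_mx 0 j) h (hj j x)) /\
                   (forall j, {for x, continuous (hj j)}).

Section Expansion.
Variables (n : nat) (U : set 'rV[R]_n) (h : 'rV[R]_n -> R) (hj : 'I_n -> 'rV[R]_n -> R).
Hypotheses (oU : open U) (H : C1on U h hj).

(** Move from [x] to [x + w] along the coordinate axes, one at a time. *)
Lemma C1on_expansion x (e : R) : U x -> 0 < e -> exists2 r : R, 0 < r &
  forall w : 'rV[R]_n, (forall j, `|w 0 j| < r) ->
    `|h (x + w) - h x - \sum_j hj j x * w 0 j| <= e * \sum_j `|w 0 j|.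
Proof.
move=> Ux e0.
have [r1 r10 hU] := nbhs_coords (open_nbhs_nbhs (conj oU Ux)).
have N : nbhs x (fun z => forall j : 'I_n, `|hj j z - hj j x| < e).
  apply: (@filter_forall _ _ (fun (j : 'I_n) z => `|hj j z - hj j x| < e) (nbhs x)) => j.
  have [_ [_ /(_ j)]] := H Ux.
  by move=> /cvgrPdist_lt /(_ e e0); apply: filterS => z; rewrite distrC.
have [r2 r20 hc] := nbhs_coords N.
exists (Num.min r1 r2); first by rewrite lt_min r10.
move=> w hw; pose W (k : nat) : 'rV[R]_n := \row_j (if (j < k)%N then w 0 j else 0).
have W0 : W 0%N = 0 by apply/rowP => j; rewrite !mxE.
have Wn : W n = w by apply/rowP => j; rewrite !mxE ltn_ord.
suff S k : (k <= n)%N ->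
    `|h (x + W k) - h x - \sum_(j < n | (j < k)%N) hj j x * w 0 j|
    <= e * \sum_(j < n | (j < k)%N) `|w 0 j|.
  have := S n (leqnn n); rewrite Wn.
  have e1 (f : 'I_n -> R) : \sum_(j < n | (j < n)%N) f j = \sum_j f j.
    by apply: eq_bigl => j; rewrite ltn_ord.
  by rewrite !e1.
elim: k => [_|k IH kn].
  rewrite W0 addr0 subrr sub0r normrN !big_pred0 //.
  by rewrite normr0 mulr0.
pose i := Ordinal kn.
have split_sum (f : 'I_n -> R) : \sum_(j < n | (j < k.+1)%N) f j =
    f i + \sum_(j < n | (j < k)%N) f j.
  rewrite (bigD1 i) //=; congr (_ + _); apply: eq_bigl => j.
  by rewrite ltnS -(inj_eq val_inj) /= andbC -ltn_neqAle.
have WS : W k.+1 = W k + w 0 i *: delta_mx 0 i.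
  apply/rowP => j; rewrite !mxE eqxx /= ltnS leq_eqVlt -(inj_eq val_inj) /=.
  have [jk|jk] := eqVneq (j : nat) k.
    by rewrite jk ltnn add0r mulr1; congr (w 0 _); apply: val_inj.
  by rewrite mulr0 addr0.
have small t j : `|t| <= `|w 0 i| -> `|(x + W k + t *: delta_mx 0 i) 0 j - x 0 j| < Num.min r1 r2.
  move=> ht; rewrite !mxE eqxx /=.
  rewrite [X in `|X|](_ : _ = (if (j < k)%N then w 0 j else 0) + t * (j == i)%:R); last by ring.
  have [ji|ji] := eqVneq j i.
    by rewrite ji /= ltnn add0r mulr1; exact: (le_lt_trans ht).
  rewrite mulr0 addr0; case: ifP => // _.
  by rewrite normr0 lt_min r10.
have dline t : `|t| <= `|w 0 i| ->
    der (fun t => h (x + W k + t *: delta_mx 0 i)) t (hj i (x + W k + t *: delta_mx 0 i)).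
  move=> ht; apply: der_line; have := small t ^~ ht => sm.
  have [|_ [D _]] := @H (x + W k + t *: delta_mx 0 i); last exact: D.
  by apply: hU => j; have := sm j; rewrite lt_min => /andP[].
have [c cw E] : exists2 c, `|c| <= `|w 0 i| &
    h (x + W k.+1) - h (x + W k) = hj i (x + W k + c *: delta_mx 0 i) * w 0 i.
  pose f t := h (x + W k + t *: delta_mx 0 i).
  pose f' t := hj i (x + W k + t *: delta_mx 0 i).
  have f0 : f 0 = h (x + W k) by rewrite /f scale0r addr0.
  have f1 : f (w 0 i) = h (x + W k.+1) by rewrite /f WS addrA.
  rewrite -f0 -f1; have [p|p] := leP 0 (w 0 i).
    have [|c /andP[c0 c1] ec] := @mean_value R f f' 0 (w 0 i) p.
      by move=> t /andP[t0 t1]; apply: dline; rewrite !ger0_norm.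
    by exists c; rewrite ?ger0_norm // ec subr0.
  have [|c /andP[c0 c1] ec] := @mean_value R f f' (w 0 i) 0 (ltW p).
    by move=> t /andP[t0 t1]; apply: dline; rewrite !ler0_norm // ?lerN2 // ltW.
  exists c; first by rewrite !ler0_norm // ?lerN2 // ltW.
  by rewrite -opprB ec sub0r mulrN opprK.
rewrite !split_sum.
have -> : h (x + W k.+1) - h x - (hj i x * w 0 i + \sum_(j < n | (j < k)%N) hj j x * w 0 j) =
  (hj i (x + W k + c *: delta_mx 0 i) - hj i x) * w 0 i
  + (h (x + W k) - h x - \sum_(j < n | (j < k)%N) hj j x * w 0 j).
  by rewrite mulrBl -E; ring.
apply: (le_trans (ler_normD _ _)); rewrite mulrDr; apply: lerD; last exact: IH (ltnW kn).
rewrite normrM; apply: ler_wpM2r => //; apply: ltW; apply: (hc _ _ i) => j.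
by have := small c j cw; rewrite lt_min => /andP[].
Qed.

Lemma der_chain (z : R -> 'rV[R]_n) (v : 'rV[R]_n) t : U (z t) ->
  (forall j, der (fun t => z t 0 j) t (v 0 j)) ->
  der (fun t => h (z t)) t (\sum_j hj j (z t) * v 0 j).
Proof.
move=> Uz dz; apply/derP => e e0.
pose V : R := \sum_j (`|v 0 j| + 1).
have V0 : 0 <= V by apply: sumr_ge0 => j _; rewrite addr_ge0.
pose A : R := \sum_j `|hj j (z t)|.
have A0 : 0 <= A by apply: sumr_ge0.
have e1 : 0 < e / 2 / (V + 1) by rewrite !divr_gt0 // ltr_wpDl.
have [r1 r10 h1] := C1on_expansion Uz e1.
pose d := Num.min 1 (e / 2 / (A + 1)).
have d0 : 0 < d by rewrite lt_min ltr01 !divr_gt0 // ltr_wpDl.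
have N : \forall k \near (0 : R), forall j : 'I_n,
    `|z (t + k) 0 j - z t 0 j - v 0 j * k| <= d * `|k|.
  apply: (@filter_forall _ _ (fun (j : 'I_n) k => `|z (t + k) 0 j - z t 0 j - v 0 j * k| <= d * `|k|)
    (nbhs (0 : R))) => j.
  have [r r0 hr] := (derP _ _ _).1 (dz j) d d0.
  by apply/nbhs_ballP; exists r => // k /=; rewrite /ball /= sub0r normrN; exact: hr.
have N2 : \forall k \near (0 : R), forall j : 'I_n, `|z (t + k) 0 j - z t 0 j| < r1.
  apply: (@filter_forall _ _ (fun (j : 'I_n) k => `|z (t + k) 0 j - z t 0 j| < r1)
    (nbhs (0 : R))) => j.
  have [r /= r0 hr] := (cvgrPdist_lt _ _).1 (der_cts (dz j)) _ r10.
  apply/nbhs_ballP; exists r => // k /=; rewrite /ball /= sub0r normrN => kr.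
  by rewrite distrC; apply: hr; rewrite /ball /= opprD addrA subrr add0r normrN.
have [r /= r0 hr] := filterI N N2.
exists r => // k kr; have [|a1 a2] := hr k; first by rewrite /ball /= sub0r normrN.
pose w := z (t + k) - z t.
have wE j : w 0 j = z (t + k) 0 j - z t 0 j by rewrite !mxE.
have hw : z (t + k) = z t + w by rewrite /w [RHS]addrC subrK.
rewrite hw; have B : `|h (z t + w) - h (z t) - \sum_j hj j (z t) * w 0 j|
     <= e / 2 / (V + 1) * \sum_j `|w 0 j| by apply: h1 => j; rewrite wE; exact: a2.
have wv : \sum_j `|w 0 j| <= V * `|k|.
  rewrite mulr_suml; apply: ler_sum => j _; rewrite mulrDl mul1r.
  have -> : w 0 j = v 0 j * k + (w 0 j - v 0 j * k) by ring.
  apply: (le_trans (ler_normD _ _)); rewrite normrM; apply: lerD => //.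
  rewrite wE; apply: (le_trans (a1 j)); rewrite ler_piMl //.
  by rewrite /d ge_min lexx.
have S : `|\sum_j hj j (z t) * w 0 j - (\sum_j hj j (z t) * v 0 j) * k| <= A * d * `|k|.
  rewrite mulr_suml -sumrB /A -mulrA mulr_suml; apply: (le_trans (ler_norm_sum _ _ _)).
  apply: ler_sum => j _; rewrite -mulrA -mulrBr normrM; apply: ler_wpM2l => //.
  by rewrite wE; exact: a1.
have -> : h (z t + w) - h (z t) - (\sum_j hj j (z t) * v 0 j) * k =
  (h (z t + w) - h (z t) - \sum_j hj j (z t) * w 0 j) +
  (\sum_j hj j (z t) * w 0 j - (\sum_j hj j (z t) * v 0 j) * k) by ring.
apply: (le_trans (ler_normD _ _)); apply: (le_trans (lerD B S)).
have b1 : e / 2 / (V + 1) * \sum_j `|w 0 j| <= e / 2 * `|k|.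
  apply: (@le_trans _ _ (e / 2 / (V + 1) * (V * `|k|))).
    by apply: ler_wpM2l => //; exact: ltW.
  rewrite mulrA; apply: ler_wpM2r => //; rewrite mulrAC ler_pdivrMr ?ltr_wpDl //.
  by apply: ler_wpM2l; [rewrite divr_ge0 // ltW|rewrite lerDl].
have b2 : A * d * `|k| <= e / 2 * `|k|.
  apply: ler_wpM2r => //; apply: (@le_trans _ _ (A * (e / 2 / (A + 1)))).
    by apply: ler_wpM2l => //; rewrite /d ge_min lexx orbT.
  rewrite mulrA ler_pdivrMr ?ltr_wpDl // mulrC.
  by apply: ler_wpM2l; [rewrite divr_ge0 // ltW|rewrite lerDl].
by apply: (le_trans (lerD b1 b2)); rewrite -mulrDl -splitr.
Qed.

End Expansion.
End Curves.
Section SmoothFunctions.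
Variable R : realType.
Implicit Types (F : R -> R -> R).

Lemma cont2_comp_row n (h : 'rV[R]_n -> R) (z : R -> R -> 'rV[R]_n) :
  (forall a b, {for z a b, continuous h}) -> (forall j, cont2 (fun a b => z a b 0 j)) ->
  cont2 (fun a b => h (z a b)).
Proof.
move=> ch cz w; apply: (@cvg_comp _ _ _ (fun w : R * R => z w.1 w.2) h); last exact: ch.
by apply: cvg_row => j; exact: cz.
Qed.

Section C1onAlgebra.
Variables (n : nat) (U : set 'rV[R]_n).
Implicit Types (h k : 'rV[R]_n -> R) (hj kj : 'I_n -> 'rV[R]_n -> R).

Lemma C1on_cst (c : R) : C1on U (fun=> c) (fun _ _ => 0).
Proof.
by move=> x _; split; [exact: cst_continuous|split=> j; [exact: is_derive_cst|exact: cst_continuous]].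
Qed.

Lemma C1onD h hj k kj : C1on U h hj -> C1on U k kj ->
  C1on U (fun x => h x + k x) (fun j x => hj j x + kj j x).
Proof.
move=> Hh Hk x Ux; have [c1 [d1 e1]] := Hh x Ux; have [c2 [d2 e2]] := Hk x Ux.
split; [|split=> j].
- exact: (continuousD c1 c2).
- by have i1 := d1 j; have i2 := d2 j; exact: is_deriveD.
- exact: (continuousD (e1 j) (e2 j)).
Qed.

Lemma C1onM h hj k kj : C1on U h hj -> C1on U k kj ->
  C1on U (fun x => h x * k x) (fun j x => hj j x * k x + h x * kj j x).
Proof.
move=> Hh Hk x Ux; have [c1 [d1 e1]] := Hh x Ux; have [c2 [d2 e2]] := Hk x Ux.
split; [|split=> j].
- exact: (continuousM c1 c2).
- have := @is_deriveM _ _ h k x _ _ _ (d1 j) (d2 j).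
  by rewrite /GRing.scale /= addrC [k x * _]mulrC.
- exact: (continuousD (continuousM (e1 j) c2) (continuousM c1 (e2 j))).
Qed.

Lemma C1on_ext h hj k kj : C1on U h hj -> (forall x, h x = k x) ->
  (forall j x, hj j x = kj j x) -> C1on U k kj.
Proof.
move=> H e e'; have -> : k = h by apply/funext.
by have -> : kj = hj by apply/funext => j; apply/funext.
Qed.

Lemma C1on_sum (I : Type) (r : seq I) (h : I -> 'rV[R]_n -> R) (hj : I -> 'I_n -> 'rV[R]_n -> R) :
  (forall i, C1on U (h i) (hj i)) ->
  C1on U (fun x => \sum_(i <- r) h i x) (fun j x => \sum_(i <- r) hj i j x).
Proof.
move=> H; elim: r => [|i r IH].
  by apply: (C1on_ext (C1on_cst 0)) => *; rewrite big_nil.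
by apply: (C1on_ext (C1onD (H i) IH)) => *; rewrite big_cons.
Qed.

End C1onAlgebra.

Lemma C1_coord n m (U : set 'rV[R]_n) (F : 'rV[R]_n -> 'rV[R]_m) i : C1 U F ->
  C1on U (fun x => F x 0 i) (fun j x => partial j F x 0 i).
Proof.
have cc (G : 'rV[R]_n -> 'rV[R]_m) x : {for x, continuous G} -> {for x, continuous (fun x => G x 0 i)}.
  move=> cG; apply: (@cvg_comp _ _ _ G (fun M : 'rV[R]_m => M 0 i)); first exact: cG.
  exact: coord_continuous.
move=> HF x Ux; have [c H] := HF x Ux; split; first exact: cc.
split=> j; have [d e] := H j; last exact: cc.
apply: DeriveDef; first exact: ((derivable_mxP F x _).1 d 0 i).
by rewrite /partial (derive_mx d) mxE.
Qed.

Lemma C1T_comp n (U : set 'rV[R]_n) h hj (z z1 z2 : R -> R -> 'rV[R]_n) :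
  open U -> C1on U h hj -> (forall a b, U (z a b)) ->
  (forall j, C1T (fun a b => z a b 0 j) (fun a b => z1 a b 0 j) (fun a b => z2 a b 0 j)) ->
  C1T (fun a b => h (z a b)) (fun a b => \sum_j hj j (z a b) * z1 a b 0 j)
      (fun a b => \sum_j hj j (z a b) * z2 a b 0 j).
Proof.
move=> oU H Uz Hz; have cz j := C1T_cont (Hz j).
have per1 a b : z (a + 2 * pi) b = z a b by apply/rowP => j; exact: (C1T_per1 (Hz j)).
have per2 a b : z a (b + 2 * pi) = z a b by apply/rowP => j; exact: (C1T_per2 (Hz j)).
have chj j : cont2 (fun a b => hj j (z a b)).
  by apply: cont2_comp_row => // a b; have [_ [_ e]] := H _ (Uz a b); exact: e.
split.
- by apply: cont2_comp_row => // a b; have [] := H _ (Uz a b).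
- by apply: cont2_sum => j; exact: (cont2M (chj j) (C1T_cont1 (Hz j))).
- by apply: cont2_sum => j; exact: (cont2M (chj j) (C1T_cont2 (Hz j))).
- by move=> a b; apply: (der_chain oU H (z := fun t => z t b)) => // j; exact: (C1T_der1 (Hz j)).
- by move=> a b; apply: (der_chain oU H (z := z a)) => // j; exact: (C1T_der2 (Hz j)).
- by move=> a b; rewrite per1.
- by move=> a b; rewrite per2.
Qed.

(** Both mixed derivatives are limits of the same second difference quotient. *)
Lemma mixed_partials F F1 F2 F11 F12 F21 F22 :
  C1T F F1 F2 -> C1T F1 F11 F12 -> C1T F2 F21 F22 -> forall a b, F12 a b = F21 a b.
Proof.
move=> H H1 H2 a b.
apply/eqP; rewrite -subr_eq0 -normr_le0; apply/ler_addgt0Pr => e e0; rewrite add0r.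
have e2 : 0 < e / 2 by rewrite divr_gt0.
have [r1 r10 h1] := continuous2P a b (C1T_cont2 H1) e2.
have [r2 r20 h2] := continuous2P a b (C1T_cont1 H2) e2.
pose h := Num.min r1 r2 / 2.
have m0 : 0 < Num.min r1 r2 by rewrite lt_min r10.
have h0 : 0 < h by rewrite divr_gt0.
have hm : h < Num.min r1 r2 by rewrite ltr_pdivrMr // ltr_pMr // ltr1n.
have [hr1 hr2] : h < r1 /\ h < r2 by move: hm; rewrite lt_min => /andP.
pose W := F (a + h) (b + h) - F (a + h) b - (F a (b + h) - F a b).
have [x xh ex] : exists2 x, `|x - a| <= `|h| & W = (F1 x (b + h) - F1 x b) * h.
  have [|x xh ex] := @mean_value_near R (fun t => F t (b + h) - F t b)
    (fun t => F1 t (b + h) - F1 t b) a h.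
    by move=> t; exact: (derD (C1T_der1 H t _) (derN (C1T_der1 H t _))).
  by exists x.
have [y yh ey] := mean_value_near b h (C1T_der2 H1 x).
have [y' yh' ey'] : exists2 y, `|y - b| <= `|h| & W = (F2 (a + h) y - F2 a y) * h.
  have [|y' yh' ey'] := @mean_value_near R (fun t => F (a + h) t - F a t)
    (fun t => F2 (a + h) t - F2 a t) b h.
    by move=> t; exact: (derD (C1T_der2 H _ t) (derN (C1T_der2 H _ t))).
  by exists y' => //; rewrite -ey' /W; ring.
have [x' xh' ex'] := mean_value_near a h (fun t => C1T_der1 H2 t y').
have E : F12 x y = F21 x' y'.
  have hn : h != 0 by rewrite gt_eqF.
  by apply: (mulIf hn); apply: (mulIf hn); rewrite -ey -ex' -ex -ey'.
rewrite (gtr0_norm h0) in xh yh xh' yh'.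
have A := h1 x y (le_lt_trans xh hr1) (le_lt_trans yh hr1).
have B := h2 x' y' (le_lt_trans xh' hr2) (le_lt_trans yh' hr2).
rewrite E in A; rewrite (splitr e).
have -> : F12 a b - F21 a b = (F21 x' y' - F21 a b) - (F21 x' y' - F12 a b) by ring.
by apply: (le_trans (ler_normB _ _)); apply: lerD; exact: ltW.
Qed.

Lemma periodic_derivatives F F1 F2 :
  (forall a b, der (fun x => F x b) a (F1 a b)) -> (forall a b, der (F a) b (F2 a b)) ->
  (forall a b, F (a + 2 * pi) b = F a b) -> (forall a b, F a (b + 2 * pi) = F a b) ->
  [/\ forall a b, F1 (a + 2 * pi) b = F1 a b, forall a b, F1 a (b + 2 * pi) = F1 a b,
      forall a b, F2 (a + 2 * pi) b = F2 a b & forall a b, F2 a (b + 2 * pi) = F2 a b].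
Proof.
move=> d1 d2 p1 p2.
have sh (f : R -> R) t d : der f (t + 2 * pi) d -> der (fun s => f (s + 2 * pi)) t d.
  move=> df; apply: (der_eq (der_comp (g := fun s => s + 2 * pi) df (derD (der_id t) (der_cst (2 * pi) t)))) => //.
  by rewrite addr0 mulr1.
split=> a b.
- apply: (der_unique (sh _ _ _ (d1 _ b))).
  by apply: (der_eq (d1 a b)) => // s; rewrite p1.
- apply: (der_unique (d1 a (b + 2 * pi))).
  by apply: (der_eq (d1 a b)) => // s; rewrite p2.
- apply: (der_unique (d2 (a + 2 * pi) b)).
  by apply: (der_eq (d2 a b)) => // s; rewrite p1.
- apply: (der_unique (sh _ _ _ (d2 a _))).
  by apply: (der_eq (d2 a b)) => // s; rewrite p2.
Qed.

Definition row2 (a b : R) : 'rV[R]_2 := \row_(j < 2) (if j == 0 then a else b).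

Lemma row2E (p : 'rV[R]_2) : p = row2 (p 0 0) (p 0 1).
Proof. by apply/rowP => -[[|[|j]] jl] //; rewrite mxE; congr (p 0 _); apply: val_inj. Qed.

Lemma C1T_plane (h : 'rV[R]_2 -> R) hj : C1on setT h hj ->
  (forall a b, h (row2 (a + 2 * pi) b) = h (row2 a b)) ->
  (forall a b, h (row2 a (b + 2 * pi)) = h (row2 a b)) ->
  C1T (fun a b => h (row2 a b)) (fun a b => hj 0 (row2 a b)) (fun a b => hj 1 (row2 a b)).
Proof.
move=> H p1 p2.
have cr j : cont2 (fun a b => row2 a b 0 j).
  case: (eqVneq j 0) => [->|j0].
    apply: (cont2_ext (cont2_fst (@cts_id R))) => a b; by rewrite mxE.
  apply: (cont2_ext (cont2_snd (@cts_id R))) => a b; by rewrite mxE (negPf j0).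
split=> //.
- by apply: cont2_comp_row => // a b; have [] := H (row2 a b) I.
- by apply: cont2_comp_row => // a b; have [_ [_ e]] := H (row2 a b) I; exact: e.
- by apply: cont2_comp_row => // a b; have [_ [_ e]] := H (row2 a b) I; exact: e.
- move=> a b; have e t : row2 t b = row2 0 b + t *: delta_mx 0 0.
    apply/rowP => j; rewrite !mxE /=; case: (j == 0); by rewrite ?mulr1 ?mulr0 ?add0r ?addr0.
  have [_ [d _]] := H (row2 a b) I; have := d 0; rewrite e => D.
  by apply: (der_eq (der_line D)) => [t|]; rewrite -e.
- move=> a b; have e t : row2 a t = row2 a 0 + t *: delta_mx 0 1.
    by apply/rowP => -[[|[|j]] jl] //; rewrite !mxE /= ?mulr0 ?mulr1 ?addr0 ?add0r.
  have [_ [d _]] := H (row2 a b) I; have := d 1; rewrite e => D.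
  by apply: (der_eq (der_line D)) => [t|]; rewrite -e.
Qed.

End SmoothFunctions.
(** * Minimality read off a defining function *)

Section LevelSets.
Variable R : realType.

Section LevelSurface.
Variables (U : set 'rV[R]_4) (H : 'rV[R]_4 -> R) (Hj : 'I_4 -> 'rV[R]_4 -> R)
  (Hjk : 'I_4 -> 'I_4 -> 'rV[R]_4 -> R).
Hypotheses (oU : open U) (H1 : C1on U H Hj) (H2 : forall j, C1on U (Hj j) (Hjk j)).

Definition grad (x : 'rV[R]_4) : 'rV[R]_4 := \row_j Hj j x.

Definition hess (x v w : 'rV[R]_4) : R := \sum_j (\sum_k Hjk j k x * w 0 k) * v 0 j.

Variables (z z1 z2 z11 z12 z21 z22 : R -> R -> 'rV[R]_4).
Hypotheses (Hz : C1V z z1 z2) (Hz1 : C1V z1 z11 z12) (Hz2 : C1V z2 z21 z22).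
Hypotheses (Uz : forall a b, U (z a b)) (z0 : forall a b, H (z a b) = 0).

Let gradE x v : dot (grad x) v = \sum_j Hj j x * v 0 j.
Proof. by apply: eq_bigr => j _; rewrite mxE. Qed.

Lemma level_first a b : dot (grad (z a b)) (z1 a b) = 0 /\ dot (grad (z a b)) (z2 a b) = 0.
Proof.
have C := C1T_comp oU H1 Uz Hz; rewrite !gradE; split.
  exact: (C1T_unique1 C (@C1T_cst R 0) z0).
exact: (C1T_unique2 C (@C1T_cst R 0) z0).
Qed.

Let second u u1 u2 : C1V u u1 u2 -> (forall a b, dot (grad (z a b)) (u a b) = 0) ->
  forall a b, hess (z a b) (u a b) (z1 a b) + dot (grad (z a b)) (u1 a b) = 0 /\
              hess (z a b) (u a b) (z2 a b) + dot (grad (z a b)) (u2 a b) = 0.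
Proof.
move=> Hu u0 a b.
have C := C1T_sum (index_enum 'I_4) (fun j => C1TM (C1T_comp oU (H2 j) Uz Hz) (Hu j)).
have e a' b' : \sum_(i <- index_enum 'I_4) Hj i (z a' b') * u a' b' 0 i = 0.
  by rewrite -gradE.
rewrite !gradE /hess -!big_split; split.
  exact: (C1T_unique1 C (@C1T_cst R 0) e).
exact: (C1T_unique2 C (@C1T_cst R 0) e).
Qed.

(** The relations of [level_first] differentiated once more. *)
Lemma level_second a b (N := grad (z a b)) (B := hess (z a b)) :
  [/\ B (z1 a b) (z1 a b) = - dot N (z11 a b), B (z1 a b) (z2 a b) = - dot N (z12 a b),
      B (z2 a b) (z1 a b) = - dot N (z21 a b) & B (z2 a b) (z2 a b) = - dot N (z22 a b)].
Proof.
have [e1 e2] := second Hz1 (fun a b => (level_first a b).1) a b.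
have [e3 e4] := second Hz2 (fun a b => (level_first a b).2) a b.
by split; apply/eqP; rewrite -addr_eq0; apply/eqP.
Qed.

Lemma hessDl x c v d w u : hess x (c *: v + d *: w) u = c * hess x v u + d * hess x w u.
Proof.
rewrite /hess !mulr_sumr -big_split; apply: eq_bigr => j _ /=; rewrite !mxE; ring.
Qed.

Lemma hessDr x c v d w u : hess x u (c *: v + d *: w) = c * hess x u v + d * hess x u w.
Proof.
rewrite /hess !mulr_sumr -big_split; apply: eq_bigr => j _ /=.
rewrite !mulrA -mulrDl !mulr_sumr -big_split /=; congr (_ * _); apply: eq_bigr => k _.
by rewrite !mxE; ring.
Qed.

End LevelSurface.

(** Up to the factor [E G - F ^ 2], the trace of a bilinear form over the plane
    spanned by two vectors, so its vanishing depends on the plane only. *)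
Definition trace_form (B : 'rV[R]_4 -> 'rV[R]_4 -> R) (v w : 'rV[R]_4) : R :=
  dot w w * B v v - dot v w * (B v w + B w v) + dot v v * B w w.

Lemma trace_form_change (B : 'rV[R]_4 -> 'rV[R]_4 -> R) v w c1 d1 c2 d2 :
  (forall c v d w u, B (c *: v + d *: w) u = c * B v u + d * B w u) ->
  (forall c v d w u, B u (c *: v + d *: w) = c * B u v + d * B u w) ->
  trace_form B (c1 *: v + d1 *: w) (c2 *: v + d2 *: w)
  = (c1 * d2 - d1 * c2) ^+ 2 * trace_form B v w.
Proof.
move=> Bl Br; rewrite /trace_form !Bl !Br !dotDl !dotDr !dotZl !dotZr (dotC w v); ring.
Qed.

Lemma trace_inv2 (A B : 'M[R]_2) : A \in unitmx -> \tr (invmx A *m B) = 0 ->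
  A 1 1 * B 0 0 - A 0 1 * B 1 0 - A 1 0 * B 0 1 + A 0 0 * B 1 1 = 0.
Proof.
move=> uA; have : A *m (invmx A *m B) = B by rewrite mulKVmx.
move: (invmx A *m B) => T <-.
have i1 : lift 0 0 = 1 :> 'I_2 by apply: val_inj.
rewrite /mxtrace !mxE !big_ord_recl !big_ord0 !addr0 i1 => e.
have -> : T 1 1 = - T 0 0 by apply/eqP; rewrite -addr_eq0 addrC e.
ring.
Qed.

Lemma det2 (A : 'M[R]_2) : \det A = A 0 0 * A 1 1 - A 0 1 * A 1 0.
Proof.
have i1 : lift 0 0 = 1 :> 'I_2 by apply: val_inj.
have i2 : lift 1 0 = 0 :> 'I_2 by apply: val_inj.
rewrite (expand_det_row _ 0) !big_ord_recl big_ord0 /cofactor !det_mx11 !mxE i1 i2 /=.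
rewrite addr0 expr0 expr1; ring.
Qed.

Lemma unit_gram2 (A : 'M[R]_2) (E F G : R) : A \in unitmx ->
  A 0 0 = E -> A 0 1 = F -> A 1 0 = F -> A 1 1 = G -> E * G - F ^+ 2 != 0.
Proof.
by move=> uA e1 e2 e3 e4; move: uA; rewrite unitmxE unitfE det2 e1 e2 e3 e4 -expr2.
Qed.

Lemma traceless2 (A B : 'M[R]_2) (E F G n : R) (D : 'I_2 -> 'I_2 -> R) : A \in unitmx ->
  n != 0 -> \tr (invmx A *m B) / 2 = 0 -> (forall i j, B i j = n * D i j) ->
  A 0 0 = E -> A 0 1 = F -> A 1 0 = F -> A 1 1 = G ->
  G * D 0 0 - F * (D 0 1 + D 1 0) + E * D 1 1 = 0.
Proof.
move=> uA n0 /eqP; rewrite mulf_eq0 invr_eq0 pnatr_eq0 orbF => /eqP /(trace_inv2 uA) h e.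
move=> e1 e2 e3 e4; move: h; rewrite !e e1 e2 e3 e4 => h.
by apply: (mulfI n0); rewrite mulr0 -[RHS]h; ring.
Qed.

Section MinimalTorus.
Variables (f : 'rV[R]_2 -> 'rV[R]_4) (p : 'rV[R]_2).
Hypotheses (imm : immersion f) (min : minimal f).

Let A := first_form f p.

Let AE i j : A i j = dot (partial i f p) (partial j f p).
Proof. by rewrite /A mxE. Qed.

Let A_unit : A \in unitmx.
Proof.
pose M := \matrix_(i < 2) partial i f p.
have AM : A = M *m M^T.
  apply/matrixP => i j; rewrite !mxE; apply: eq_bigr => k _; by rewrite !mxE.
rewrite -row_free_unit -kermx_eq0; apply/eqP/row_matrixP => i; rewrite row0.
set c := row i _; have c0 : c *m A = 0 by apply/sub_kermxP; exact: row_sub.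
have : c *m M = 0.
  apply: dot_eq0; have : (c *m A *m c^T) 0 0 = 0 by rewrite c0 mul0mx mxE.
  rewrite AM mulmxA -mulmxA -trmx_mul mxE => e.
  by rewrite -[RHS]e; apply: eq_bigr => k _; rewrite [X in _ = _ * X]mxE.
move/eqP; rewrite mulmx_free_eq0; first by move/eqP.
exact: imm.
Qed.

Lemma immersion_gram : dot (partial 0 f p) (partial 0 f p) * dot (partial 1 f p) (partial 1 f p)
  - dot (partial 0 f p) (partial 1 f p) ^+ 2 != 0.
Proof.
exact: (unit_gram2 A_unit (AE 0 0) (AE 0 1) (etrans (AE 1 0) (dotC _ _)) (AE 1 1)).
Qed.

Lemma minimal_trace N : dot N N != 0 -> dot N (f p) = 0 -> (forall i, dot N (partial i f p) = 0) ->
  forall D : 'I_2 -> 'I_2 -> R, (forall i j, D i j = dot N (partial i (partial j f) p)) ->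
  dot (partial 1 f p) (partial 1 f p) * D 0 0
  - dot (partial 0 f p) (partial 1 f p) * (D 0 1 + D 1 0)
  + dot (partial 0 f p) (partial 0 f p) * D 1 1 = 0.
Proof.
move=> N0 Nf Ni D DE; pose n := enorm N; pose nu := n^-1 *: N.
have np : 0 < n by rewrite sqrtr_gt0 lt_neqAle eq_sym N0 dot_ge0.
have un : unit_normal f p nu.
  split; rewrite ?dotZl ?Nf ?mulr0 //.
    rewrite /enorm dotZl dotZr mulrA -expr2 sqrtrM ?sqr_ge0 // sqrtr_sqr.
    by rewrite ger0_norm ?invr_ge0 ?ltW // mulVf // gt_eqF.
  by move=> i; rewrite dotZl Ni mulr0.
have e i j : second_form f p nu i j = n^-1 * D i j by rewrite mxE dotZr dotC DE.
have ni : n^-1 != 0 by rewrite invr_eq0 gt_eqF.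
exact: (traceless2 A_unit ni (min un) e (AE 0 0) (AE 0 1) (etrans (AE 1 0) (dotC _ _)) (AE 1 1)).
Qed.

End MinimalTorus.
End LevelSets.
Section TorusAsSurface.
Variables (R : realType) (alpha : R) (f : 'rV[R]_2 -> 'rV[R]_4).
Hypothesis Hf : torus alpha f.

Lemma C2_coords n m (U : set 'rV[R]_n) (F : 'rV[R]_n -> 'rV[R]_m) : C2alpha alpha U F ->
  (forall k, C1on U (fun x => F x 0 k) (fun j x => partial j F x 0 k)) /\
  (forall j k, C1on U (fun x => partial j F x 0 k) (fun i x => partial i (partial j F) x 0 k)).
Proof.
by move=> [c1 c2 _]; split=> [k|j k]; [exact: (C1_coord k c1)|exact: (C1_coord k (c2 j))].
Qed.

Let per1 a b : f (row2 (a + 2 * pi) b) = f (row2 a b).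
Proof.
have [_ per _] := Hf; rewrite -(per (row2 a b) 0); congr (f _).
by apply/rowP => j; rewrite !mxE /=; case: (j == 0); rewrite ?mulr1 ?mulr0 ?addr0.
Qed.

Let per2 a b : f (row2 a (b + 2 * pi)) = f (row2 a b).
Proof.
have [_ per _] := Hf; rewrite -(per (row2 a b) 1); congr (f _).
by apply/rowP => -[[|[|j]] jl] //; rewrite !mxE /= ?mulr1 ?mulr0 ?addr0.
Qed.

Lemma torus_C1V : C1V (fun a b => f (row2 a b)) (fun a b => partial 0 f (row2 a b))
                      (fun a b => partial 1 f (row2 a b)).
Proof.
have [_ _ C2] := Hf; have [c1 _] := C2_coords C2 => k.
by apply: (C1T_plane (c1 k)) => a b; rewrite ?per1 ?per2.
Qed.

Lemma torus_C1V' i : C1V (fun a b => partial i f (row2 a b))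
  (fun a b => partial 0 (partial i f) (row2 a b)) (fun a b => partial 1 (partial i f) (row2 a b)).
Proof.
have [_ _ C2] := Hf; have [_ c2] := C2_coords C2 => k.
have [_ _ _ d1 d2 p1 p2] := torus_C1V k.
have [q1 q2 q3 q4] := periodic_derivatives d1 d2 p1 p2.
apply: (C1T_plane (c2 i k)) => a b.
  have [->|->] : i = 0 \/ i = 1 by case: i => -[|[|i]] il //; [left|right]; exact: val_inj.
    exact: q1.
  exact: q3.
have [->|->] : i = 0 \/ i = 1 by case: i => -[|[|i]] il //; [left|right]; exact: val_inj.
  exact: q2.
exact: q4.
Qed.

End TorusAsSurface.

Section TraceForm.
Variables (R : realType) (B : 'rV[R]_4 -> 'rV[R]_4 -> R) (v w : 'rV[R]_4) (x1 x2 x3 x4 : R).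
Hypotheses (B1 : B v v = - x1) (B2 : B w v = - x2) (B3 : B v w = - x3) (B4 : B w w = - x4).

Lemma trace_form_opp :
  dot w w * x1 - dot v w * (x2 + x3) + dot v v * x4 = 0 -> trace_form B v w = 0.
Proof. by move=> e; rewrite /trace_form B1 B2 B3 B4 -[RHS]oppr0 -e; ring. Qed.

Lemma trace_form_opp_inv : x2 = x3 -> trace_form B v w = 0 ->
  dot w w * x1 - 2 * dot v w * x2 + dot v v * x4 = 0.
Proof. by move=> e2; rewrite /trace_form B1 B2 B3 B4 -e2 => e; rewrite -[RHS]oppr0 -e; ring. Qed.

End TraceForm.

Section MinimalityTransfer.
Variables (R : realType) (alpha : R) (f : 'rV[R]_2 -> 'rV[R]_4).
Hypotheses (Hf : torus alpha f) (imm : immersion f) (min : minimal f).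
Variables (U : set 'rV[R]_4) (H : 'rV[R]_4 -> R) (Hj : 'I_4 -> 'rV[R]_4 -> R)
  (Hjk : 'I_4 -> 'I_4 -> 'rV[R]_4 -> R).
Hypotheses (oU : open U) (H1 : C1on U H Hj) (H2 : forall j, C1on U (Hj j) (Hjk j)).
Hypotheses (Uf : forall t, U (f t)) (Hf0 : forall t, H (f t) = 0).
Variables (y p q pp pq qq : R -> R -> 'rV[R]_4).
Hypotheses (Hy : C1V y p q) (Hp : C1V p pp pq) (Hq : C1V q pq qq).
Hypotheses (Uy : forall a b, U (y a b)) (Hy0 : forall a b, H (y a b) = 0).
Hypotheses (sphere : forall a b, dot (y a b) (y a b) = 1).
Hypotheses (onf : forall a b, exists t, f t = y a b).
Hypotheses (N0 : forall a b, dot (grad Hj (y a b)) (grad Hj (y a b)) != 0)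
  (Ny : forall a b, dot (grad Hj (y a b)) (y a b) = 0).

(** Two parametrizations of the same surface have the same tangent planes,
    hence the same trace of the Hessian of the defining function over them;
    for a surface inside the level set that trace is the mean curvature up to
    a factor. *)
Theorem minimal_parametrization a b : exists N : 'rV[R]_4,
  [/\ dot N N != 0, dot N (y a b) = 0, dot N (p a b) = 0, dot N (q a b) = 0 &
   dot (q a b) (q a b) * dot N (pp a b) - 2 * dot (p a b) (q a b) * dot N (pq a b)
   + dot (p a b) (p a b) * dot N (qq a b) = 0].
Proof.
have [t ft] := onf a b.
pose N := grad Hj (y a b); exists N.
have [n1 n2] := level_first oU H1 Hy Uy Hy0 a b.
split; [exact: N0|exact: Ny|exact: n1|exact: n2|].
pose z a b := f (row2 a b); have Hz := torus_C1V Hf.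
have tE : z (t 0 0) (t 0 1) = y a b by rewrite /z -row2E.
have Uz a' b' : U (z a' b') by exact: Uf.
have z0 a' b' : H (z a' b') = 0 by exact: Hf0.
have [m1 m2] := level_first oU H1 Hz Uz z0 (t 0 0) (t 0 1).
have fs a' b' : dot (z a' b') (z a' b') = 1.
  have [S _ _] := Hf; have := S (row2 a' b'); rewrite /S3 /= /enorm => e.
  by rewrite -(sqr_sqrtr (dot_ge0 (z a' b'))) /z e expr1n.
have [t1 t2] := sphere_tangent Hz fs (t 0 0) (t 0 1).
have [k1 k2] := sphere_tangent Hy sphere a b.
have [B1 B2 B3 B4] := level_second oU H1 H2 Hz (torus_C1V' Hf 0) (torus_C1V' Hf 1) Uz z0 (t 0 0) (t 0 1).
have [A1 A2 A3 A4] := level_second oU H1 H2 Hy Hp Hq Uy Hy0 a b.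
rewrite /z /= -!row2E ft in t1 t2.
rewrite /= -!row2E ft -/N in m1 m2 B1 B2 B3 B4; rewrite -/N in A1 A2 A3 A4.
set f1 := partial 0 f t in m1 m2 t1 t2 B1 B2 B3 B4.
set f2 := partial 1 f t in m1 m2 t1 t2 B1 B2 B3 B4.
have yy : dot (y a b) (y a b) != 0 by rewrite sphere oner_neq0.
have yN : dot (y a b) N = 0 by rewrite dotC; exact: Ny.
have span := frame_tangent yy (N0 a b) yN t1 t2 m1 m2 (immersion_gram t imm).
have [c1 [d1 pE]] := span _ k1 n1; have [c2 [d2 qE]] := span _ k2 n2.
have T : trace_form (hess Hjk (y a b)) f1 f2 = 0.
  have Nf : dot N (f t) = 0 by rewrite ft; exact: Ny.
  have Ni i : dot N (partial i f t) = 0.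
    have [->|->] : i = 0 \/ i = 1 by case: i => -[|[|i]] il //; [left|right]; exact: val_inj.
      exact: m1.
    exact: m2.
  have e := @minimal_trace R f t imm min N (N0 a b) Nf Ni
    (fun i j => dot N (partial i (partial j f) t)) (fun i j => erefl).
  exact: (trace_form_opp B1 B3 B2 B4 e).
have TC := trace_form_change f1 f2 c1 d1 c2 d2 (@hessDl R Hjk (y a b)) (@hessDr R Hjk (y a b)).
rewrite T mulr0 -pE -qE in TC.
exact: (trace_form_opp_inv A1 A3 A2 A4 erefl TC).
Qed.

End MinimalityTransfer.
(** * Diffeomorphic images of the Clifford torus *)

Section CliffordCalculus.
Variable R : realType.

Lemma C1T_first (f f' : R -> R) : C1per f f' ->
  C1T (fun a _ => f a) (fun a _ => f' a) (fun _ _ => 0).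
Proof.
move=> [c c' d p]; split=> //; try exact: cont2_fst; first exact: cont2_cst.
by move=> a b; exact: der_cst.
Qed.

Lemma C1T_second (f f' : R -> R) : C1per f f' ->
  C1T (fun _ b => f b) (fun _ _ => 0) (fun _ b => f' b).
Proof.
move=> [c c' d p]; split=> //; try exact: cont2_snd; first exact: cont2_cst.
by move=> a b; exact: der_cst.
Qed.

Lemma C1per_cos : C1per (@cos R) (fun t => - sin t).
Proof. by apply: (C1per_ext (C1per_cs R 1)) => t; rewrite /cs /sn !mul1r. Qed.

Lemma C1per_sin : C1per (@sin R) (@cos R).
Proof. by apply: (C1per_ext (C1per_sn R 1)) => t; rewrite /cs /sn !mul1r. Qed.

Lemma C1perN (f f' : R -> R) : C1per f f' -> C1per (fun t => - f t) (fun t => - f' t).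
Proof. by move=> H; apply: (C1per_ext (C1perZ (- 1) H)) => t; rewrite mulN1r. Qed.

Definition clif11 (a b : R) : 'rV[R]_4 :=
  \row_(k < 4) (Num.sqrt 2 / 2 * nth 0 [:: - cos a; - sin a; 0; 0] k).
Definition clif22 (a b : R) : 'rV[R]_4 :=
  \row_(k < 4) (Num.sqrt 2 / 2 * nth 0 [:: 0; 0; - cos b; - sin b] k).

Let C1T_entry (k : 'I_4) (s s1 s2 : R -> R -> seq R) :
  C1T (fun a b => nth 0 (s a b) k) (fun a b => nth 0 (s1 a b) k) (fun a b => nth 0 (s2 a b) k) ->
  C1T (fun a b => (\row_(k < 4) (Num.sqrt 2 / 2 * nth 0 (s a b) k)) 0 k : R)
      (fun a b => (\row_(k < 4) (Num.sqrt 2 / 2 * nth 0 (s1 a b) k)) 0 k)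
      (fun a b => (\row_(k < 4) (Num.sqrt 2 / 2 * nth 0 (s2 a b) k)) 0 k).
Proof.
move=> H; apply: (C1T_ext (C1TM (@C1T_cst R (Num.sqrt 2 / 2)) H)) => a b; rewrite mxE //;
  by rewrite mul0r add0r.
Qed.

Lemma C1V_clif : C1V (@clif R) (@clif1 R) (@clif2 R).
Proof.
move=> k; apply: C1T_entry; case: k => -[|[|[|[|k]]]] kl //=.
- exact: C1T_first C1per_cos.
- exact: C1T_first C1per_sin.
- exact: C1T_second C1per_cos.
- exact: C1T_second C1per_sin.
Qed.

Lemma C1V_clif1 : C1V (@clif1 R) clif11 (fun _ _ => 0).
Proof.
move=> k; have E a b : (0 : 'rV[R]_4) 0 k = (\row_(k < 4) (Num.sqrt 2 / 2 * nth 0 ((fun _ _ : R => [::]) a b) k)) 0 k.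
  by rewrite !mxE nth_nil mulr0.
apply: (C1T_ext (@C1T_entry k (fun a _ => [:: - sin a; cos a; 0; 0]) (fun a _ => [:: - cos a; - sin a; 0; 0]) (fun _ _ => [::]) _)).
- case: k {E} => -[|[|[|[|k]]]] kl //=.
  + exact: C1T_first (C1perN C1per_sin).
  + exact: C1T_first C1per_cos.
  + exact: C1T_cst.
  + exact: C1T_cst.
- by [].
- by [].
- by move=> a b; rewrite [RHS](E a b).
Qed.

Lemma C1V_clif2 : C1V (@clif2 R) (fun _ _ => 0) clif22.
Proof.
move=> k; have E a b : (0 : 'rV[R]_4) 0 k = (\row_(k < 4) (Num.sqrt 2 / 2 * nth 0 ((fun _ _ : R => [::]) a b) k)) 0 k.
  by rewrite !mxE nth_nil mulr0.
apply: (C1T_ext (@C1T_entry k (fun _ b => [:: 0; 0; - sin b; cos b]) (fun _ _ => [::]) (fun _ b => [:: 0; 0; - cos b; - sin b]) _)).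
- case: k {E} => -[|[|[|[|k]]]] kl //=.
  + exact: C1T_cst.
  + exact: C1T_cst.
  + exact: C1T_second (C1perN C1per_sin).
  + exact: C1T_second C1per_cos.
- by [].
- by move=> a b; rewrite [RHS](E a b).
- by [].
Qed.

Lemma clifford_torusE (x : 'rV[R]_4) : clifford_torus x <->
  x 0 (inord 0) ^+ 2 + x 0 (inord 1) ^+ 2 = 1 / 2 /\
  x 0 (inord 2) ^+ 2 + x 0 (inord 3) ^+ 2 = 1 / 2.
Proof.
have half (u v : R) : Num.sqrt (u ^+ 2 + v ^+ 2) = Num.sqrt 2 / 2 <-> u ^+ 2 + v ^+ 2 = 1 / 2.
  have p : 0 <= u ^+ 2 + v ^+ 2 by rewrite addr_ge0 ?sqr_ge0.
  split=> [e|->]; first by rewrite -(sqr_sqrtr p) e half_sqrt2_sqr.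
  have r0 := (half_sqrt2_bound R).1.
  by rewrite -half_sqrt2_sqr sqrtr_sqr ger0_norm.
by rewrite /clifford_torus /=; split=> -[/half h1 /half h2].
Qed.

Lemma clifford_qf (x : 'rV[R]_4) : clifford_torus x -> qf x x = 0.
Proof. by move=> /clifford_torusE[h1 h2]; rewrite qfE -!expr2; lra. Qed.

Lemma S3E (x : 'rV[R]_4) : S3 x <-> dot x x = 1.
Proof.
rewrite /S3 /= /enorm; split=> [e|->]; last by rewrite sqrtr1.
by rewrite -(sqr_sqrtr (dot_ge0 x)) e expr1n.
Qed.

Lemma clifford_S3 (x : 'rV[R]_4) : clifford_torus x -> S3 x.
Proof. by move=> /clifford_torusE[h1 h2]; apply/S3E; rewrite dot4E -!expr2; lra. Qed.

Lemma enormZ (r : R) (x : 'rV[R]_4) : 0 <= r -> S3 x -> enorm (r *: x) = r.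
Proof.
move=> r0 /S3E x1; rewrite /enorm dotZl dotZr x1 mulr1 -expr2 sqrtr_sqr.
by rewrite ger0_norm.
Qed.

Lemma A2_ray (r : R) (x : 'rV[R]_4) : 2^-1 < r < 2 -> S3 x -> A2 (r *: x).
Proof.
move=> /[dup] rr /andP[r1 r2] Sx; have r0 : 0 <= r by rewrite (le_trans _ (ltW r1)) // invr_ge0.
by rewrite /A2 /= enormZ.
Qed.

Lemma S3_A2 (x : 'rV[R]_4) : S3 x -> A2 x.
Proof. by move=> Sx; rewrite -[x]scale1r; apply: A2_ray => //; apply/andP; split; lra. Qed.

Lemma A2_open : open (A2 : set 'rV[R]_4).
Proof.
have cc (k : 'I_4) x : {for x, continuous (fun x : 'rV[R]_4 => x 0 k)} by exact: coord_continuous.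
have sq k x := continuousM (cc k x) (cc k x).
have cd : continuous (fun x : 'rV[R]_4 => dot x x).
  have -> : (fun x : 'rV[R]_4 => dot x x) = (fun x => x 0 (inord 0) * x 0 (inord 0)
     + x 0 (inord 1) * x 0 (inord 1) + x 0 (inord 2) * x 0 (inord 2) + x 0 (inord 3) * x 0 (inord 3)).
    by apply/funext => w; rewrite dot4E.
  move=> x; exact: (continuousD (continuousD (continuousD (sq _ x) (sq _ x)) (sq _ x)) (sq _ x)).
have c : continuous (@enorm R 4).
  move=> x; apply: (@cvg_comp _ _ _ (fun x : 'rV[R]_4 => dot x x) Num.sqrt); first exact: cd.
  exact: sqrt_continuous.
have -> : A2 = @enorm R 4 @^-1` `]2^-1, 2[%classic.
  by apply/seteqP; split=> x; rewrite /A2 /= in_itv.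
by move/continuousP : c; apply; exact: interval_open.
Qed.

Lemma clif_torus a b : clifford_torus (@clif R a b).
Proof.
have e (x : R) : (Num.sqrt 2 / 2 * x) ^+ 2 = 1 / 2 * x ^+ 2 by rewrite exprMn half_sqrt2_sqr.
apply/clifford_torusE; rewrite !mxE !inordK //= !e.
have := cos2Dsin2 a; have := cos2Dsin2 b; by split; lra.
Qed.

End CliffordCalculus.

Section ImageSurface.
Variables (R : realType) (alpha : R) (X : 'rV[R]_4 -> 'rV[R]_4).
Hypothesis HX : canonically_extended_diffeo alpha X.

Definition image_y a b : 'rV[R]_4 := X (clif a b).
(** The differential of [X] along the torus, applied to the vector field [u]. *)
Definition push (u : R -> R -> 'rV[R]_4) a b : 'rV[R]_4 :=
  \row_k \sum_j partial j X (clif a b) 0 k * u a b 0 j.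

Let C2X : C2alpha alpha A2 X. Proof. have [[g [_ _ _ _ [C _]]] _] := HX; exact: C. Qed.

Let clifA2 a b : A2 (@clif R a b). Proof. exact: S3_A2 (clifford_S3 (@clif_torus R _ _)). Qed.

Lemma C1V_image : C1V image_y (push (@clif1 R)) (push (@clif2 R)).
Proof.
have [c1 _] := C2_coords C2X => k.
by apply: (C1T_ext (C1T_comp (@A2_open R) (c1 k) clifA2 (@C1V_clif R))) => a b; rewrite ?mxE.
Qed.

Let C1V_push u u1 u2 : C1V u u1 u2 -> exists v1 v2, C1V (push u) v1 v2.
Proof.
move=> Hu; have [_ c2] := C2_coords C2X.
pose v (z1 u1 : R -> R -> 'rV[R]_4) a b : 'rV[R]_4 := \row_k \sum_j
  ((\sum_i partial i (partial j X) (clif a b) 0 k * z1 a b 0 i) * u a b 0 j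
   + partial j X (clif a b) 0 k * u1 a b 0 j).
exists (v (@clif1 R) u1), (v (@clif2 R) u2) => k.
have C := C1T_sum (index_enum 'I_4) (fun j =>
  C1TM (C1T_comp (@A2_open R) (c2 j k) clifA2 (@C1V_clif R)) (Hu j)).
by apply: (C1T_ext C) => a b; rewrite ?mxE.
Qed.

Lemma image_second : exists pp pq qq,
  C1V (push (@clif1 R)) pp pq /\ C1V (push (@clif2 R)) pq qq.
Proof.
have [pp [pq Hp]] := C1V_push (@C1V_clif1 R); have [qp [qq Hq]] := C1V_push (@C1V_clif2 R).
exists pp, pq, qq; split; first exact: Hp.
move=> k; apply: (C1T_ext (Hq k)) => // a b.
by rewrite (mixed_partials (C1V_image k) (Hp k) (Hq k)).
Qed.

Lemma image_ray a b r : 2^-1 < r < 2 -> X (r *: clif a b) = r *: image_y a b.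
Proof.
move=> rr; have [_ [xi [_ e]]] := HX; have S := clifford_S3 (@clif_torus R a b).
have e1 : X (clif a b) = xi (clif a b).
  by have := e 1 _ _ S; rewrite !scale1r; apply; apply/andP; split; lra.
by rewrite e // /image_y e1.
Qed.

Lemma image_S3 x : S3 x -> S3 (X x).
Proof.
move=> S; have [_ [xi [[_ [fS _ _ _ _]] e]]] := HX.
have -> : X x = xi x.
  by have := e 1 _ _ S; rewrite !scale1r; apply; apply/andP; split; lra.
exact: fS.
Qed.

Lemma image_sphere a b : dot (image_y a b) (image_y a b) = 1.
Proof. by apply/S3E; apply: image_S3; exact: clifford_S3 (@clif_torus R _ _). Qed.

(** The function is the quadratic form composed with the inverse of [X].  As [X]
    commutes with dilations, the function vanishes along the rays through the
    image of the torus, so its gradient has no radial part there.  Along the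
    image of a curve [zeta] of the sphere that crosses the torus it is
    [- 2 sin s cos s], so its gradient does not vanish. *)
Lemma image_defining : exists (H : 'rV[R]_4 -> R) Hj Hjk,
  [/\ C1on A2 H Hj, forall j, C1on A2 (Hj j) (Hjk j),
      forall x, clifford_torus x -> H (X x) = 0,
      forall a b, dot (grad Hj (image_y a b)) (image_y a b) = 0 &
      forall a b, dot (grad Hj (image_y a b)) (grad Hj (image_y a b)) != 0].
Proof.
have [[g [XA gA gX Xg [_ C2g]]] _] := HX.
have [c1 c2] := C2_coords C2g; have [d1 _] := C2_coords C2X.
pose H x := qf (g x) (g x).
pose Hj j x := \sum_k sgn4 R k * (2 * (g x 0 k * partial j g x 0 k)).
have HC : C1on A2 H Hj.
  apply: (C1on_ext (C1on_sum (index_enum 'I_4)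
    (fun k => C1onM (C1onM (@C1on_cst R 4 A2 (sgn4 R k)) (c1 k)) (c1 k)))) => [x|j x] //.
  by apply: eq_bigr => k _; ring.
have HjC j := C1on_sum (index_enum 'I_4) (fun k => C1onM (@C1on_cst R 4 A2 (sgn4 R k))
   (C1onM (@C1on_cst R 4 A2 2) (C1onM (c1 k) (c2 j k)))).
have HXx x : A2 x -> H (X x) = qf x x by move=> Ax; rewrite /H gX.
have gradE x v : dot (grad Hj x) v = \sum_j Hj j x * v 0 j.
  by apply: eq_bigr => j _; rewrite mxE.
exists H, Hj; eexists; split.
- exact: HC.
- by move=> j; exact: (HjC j).
- by move=> x Tx; rewrite HXx ?clifford_qf //; exact: S3_A2 (clifford_S3 Tx).
- move=> a b; rewrite gradE.
  have S := clifford_S3 (@clif_torus R a b).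
  pose z t : 'rV[R]_4 := t *: image_y a b.
  have z1 : z 1 = image_y a b by rewrite /z scale1r.
  have D : der (fun t => H (z t)) 1 (\sum_j Hj j (z 1) * image_y a b 0 j).
    apply: (der_chain (@A2_open R) HC).
      by rewrite z1; exact: S3_A2 (image_S3 S).
    move=> j; apply: (der_eq (derM (der_id 1) (der_cst (image_y a b 0 j) 1))) => [t|].
      by rewrite mxE.
    by rewrite mul1r mulr0 addr0.
  rewrite z1 in D; apply: (der_unique (der_near D _) (der_cst 0 1)).
  have : \forall t \near (1 : R), t \in `]2^-1, 2[.
    by apply: near_in_itvoo; rewrite in_itv /=; apply/andP; split; lra.
  apply: filterS => t; rewrite in_itv /= => tt.
  rewrite /z -image_ray // HXx; last exact: A2_ray.
  by rewrite /qf wdotZr wdotC wdotZr -/(qf _ _) clifford_qf ?mulr0 //; exact: (@clif_torus R).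
- move=> a b; apply/eqP => /dot_eq0 g0.
  have [c cE] : exists c, c = @clif R a b by exists (clif a b).
  pose zeta (s : R) : 'rV[R]_4 := \row_k (c 0 k * (cos s - sgn4 R k * sin s)).
  have z0 : zeta 0 = c by apply/rowP => k; rewrite mxE sin0 cos0 mulr0 subr0 mulr1.
  have [T1 T2] := (clifford_torusE _).1 (@clif_torus R a b).
  rewrite -cE in T1 T2; have zS s : S3 (zeta s).
    apply/S3E; rewrite dot4E !mxE /sgn4 !inordK //=.
    transitivity ((c 0 (inord 0) ^+ 2 + c 0 (inord 1) ^+ 2) * (cos s - sin s) ^+ 2
      + (c 0 (inord 2) ^+ 2 + c 0 (inord 3) ^+ 2) * (cos s + sin s) ^+ 2); first by ring.
    by rewrite T1 T2 -[RHS](cos2Dsin2 s); field.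
  have zq s : qf (zeta s) (zeta s) = - 2 * (sin s * cos s).
    rewrite qfE !mxE /sgn4 !inordK //=.
    transitivity ((c 0 (inord 0) ^+ 2 + c 0 (inord 1) ^+ 2) * (cos s - sin s) ^+ 2
      - (c 0 (inord 2) ^+ 2 + c 0 (inord 3) ^+ 2) * (cos s + sin s) ^+ 2); first by ring.
    by rewrite T1 T2; field.
  pose zv : 'rV[R]_4 := \row_k (c 0 k * - sgn4 R k).
  have dz j : der (fun s => zeta s 0 j) 0 (zv 0 j).
    apply: (der_eq (derM (der_cst (c 0 j) 0) (derD (is_derive_cos 0)
      (derN (derM (der_cst (sgn4 R j) 0) (is_derive_sin 0)))))) => [s|]; first by rewrite mxE.
    by rewrite mxE cos0 sin0; ring.
  pose xv : 'rV[R]_4 := \row_k \sum_j partial j X (zeta 0) 0 k * zv 0 j.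
  have dx k : der (fun s => X (zeta s) 0 k) 0 (xv 0 k).
    rewrite mxE; apply: (der_chain (@A2_open R) (d1 k) (z := zeta)) => //.
    exact: S3_A2 (zS 0).
  have D := der_chain (@A2_open R) HC (z := fun s => X (zeta s)) (XA _ (S3_A2 (zS 0))) dx.
  have e0 : \sum_j Hj j (X (zeta 0)) * xv 0 j = 0.
    by rewrite -gradE z0 cE -/(image_y a b) g0; apply: big1 => k _; rewrite mxE mul0r.
  rewrite e0 in D.
  have D2 : der (fun s => - 2 * (sin s * cos s) : R) 0 (- 2).
    apply: (der_eq (derM (der_cst (- 2) 0) (derM (is_derive_sin 0) (is_derive_cos 0)))) => //.
    by rewrite cos0 sin0; ring.
  have := der_unique D (der_eq D2 _ erefl).
  suff h : forall s, - 2 * (sin s * cos s) = H (X (zeta s)).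
    by move=> /(_ h) /eqP; rewrite eq_sym oppr_eq0 pnatr_eq0.
  by move=> s; rewrite HXx ?zq //; exact: S3_A2.
Qed.

Variable f : 'rV[R]_2 -> 'rV[R]_4.
Hypotheses (Hf : torus alpha f) (imm : immersion f) (min : minimal f)
  (rng : range f = X @` clifford_torus).

Theorem image_minimal : exists pp pq qq,
  [/\ C1V (push (@clif1 R)) pp pq, C1V (push (@clif2 R)) pq qq &
  forall a b (y := image_y a b) (p := push (@clif1 R) a b) (q := push (@clif2 R) a b),
    exists N : 'rV[R]_4,
    [/\ dot N N != 0, dot N y = 0, dot N p = 0, dot N q = 0 &
     dot q q * dot N (pp a b) - 2 * dot p q * dot N (pq a b) + dot p p * dot N (qq a b) = 0]].
Proof.
have [pp [pq [qq [Hp Hq]]]] := image_second.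
exists pp, pq, qq; split=> // a b.
have [H [Hj [Hjk [H1 H2 H0 Ny N0]]]] := image_defining.
have [Sf _ _] := Hf.
apply: (@minimal_parametrization R alpha f Hf imm min A2 H Hj Hjk (@A2_open R) H1 H2 _ _
  image_y _ _ pp pq qq C1V_image Hp Hq _ _ image_sphere _ N0 Ny).
- by move=> t; exact: S3_A2.
- move=> t; have : range f (f t) by exists t.
  by rewrite rng => -[x Tx <-]; exact: H0.
- by move=> a' b'; apply: S3_A2; apply: image_S3; exact: clifford_S3 (@clif_torus R _ _).
- by move=> a' b'; apply: H0; exact: (@clif_torus R).
- move=> a' b'; have : (X @` clifford_torus) (image_y a' b').
    by exists (clif a' b') => //; exact: (@clif_torus R).
  by rewrite -rng => -[t _ <-]; exists t.
Qed.

End ImageSurface.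
(** * Closeness to the identity *)

Section NormCloseness.
Variable R : realType.

Lemma coord_enorm (x : 'rV[R]_4) i : `|x 0 i| <= enorm x.
Proof.
rewrite -sqrtr_sqr /enorm; apply: ler_wsqrtr.
rewrite /dot (bigD1 i) //= expr2 lerDl; apply: sumr_ge0 => j _.
by rewrite -expr2 sqr_ge0.
Qed.

Lemma enorm_ge0 (x : 'rV[R]_4) : 0 <= enorm x. Proof. exact: sqrtr_ge0. Qed.

Lemma sup_norm_le (U : set 'rV[R]_4) (F : 'rV[R]_4 -> 'rV[R]_4) x : U x ->
  ((enorm (F x))%:E <= sup_norm U F)%E.
Proof. by move=> Ux; apply: ereal_sup_ubound; exists x. Qed.

Lemma sup_norm_ge0 (U : set 'rV[R]_4) (F : 'rV[R]_4 -> 'rV[R]_4) x : U x ->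
  (0 <= sup_norm U F)%E.
Proof. by move=> Ux; apply: le_trans (sup_norm_le F Ux); rewrite lee_fin enorm_ge0. Qed.

Lemma holder_ge0 alpha (U : set 'rV[R]_4) (F : 'rV[R]_4 -> 'rV[R]_4) x z : U x -> U z -> x <> z ->
  (0 <= holder_seminorm alpha U F)%E.
Proof.
move=> Ux Uz xz; apply: (@le_trans _ _ ((enorm (F x - F z) / enorm (x - z) `^ alpha)%:E)).
  by rewrite lee_fin divr_ge0 ?enorm_ge0 // powR_ge0.
by apply: ereal_sup_ubound; exists (x, z).
Qed.

Lemma first_terms_lt (a b c d e : \bar R) : (0 <= b)%E -> (0 <= c)%E -> (0 <= d)%E -> (0 <= a)%E ->
  (a + b + c + d < e)%E -> (a < e)%E /\ (b < e)%E.
Proof.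
move=> b0 c0 d0 a0 h; have h1 : (a + b < e)%E.
  by apply: le_lt_trans h; rewrite -addeA leeDl // adde_ge0.
split; first by apply: le_lt_trans h1; rewrite leeDl.
by apply: le_lt_trans h1; rewrite leeDr.
Qed.

Lemma bigmax_ge0 (f : 'I_4 -> \bar R) : (forall j, (0 <= f j)%E) ->
  (0 <= \big[maxe/-oo]_(j < 4) f j)%E.
Proof. by move=> h; apply: (le_trans (h 0)); exact: le_bigmax. Qed.

(** The norm is a sum of four suprema, each nonnegative because the domain has two
    distinct points; the first two bound the values and first derivatives. *)
Lemma C2alpha_norm_close alpha (X : 'rV[R]_4 -> 'rV[R]_4) (e : R) :
  (forall x j, A2 x -> derivable X x (delta_mx 0 j)) ->
  (C2alpha_norm alpha A2 (fun x => (X x - x)%R) < e%:E)%E ->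
  forall x, A2 x -> forall k, `|X x 0 k - x 0 k| <= e /\
    forall j, `|partial j X x 0 k - (j == k)%:R| <= e.
Proof.
move=> dX h x Ax k.
have P1 := S3_A2 (clifford_S3 (@clif_torus R 0 0)).
have P2 := S3_A2 (clifford_S3 (@clif_torus R pi 0)).
have P12 : @clif R 0 0 <> clif pi 0.
  move=> /rowP /(_ (inord 0)); rewrite !mxE inordK //= cos0 cospi => /eqP.
  rewrite -subr_eq0 -mulrBr mulf_eq0 mulf_eq0 sqrtr_eq0 invr_eq0 opprK -(natrD _ 1 1) !pnatr_eq0 /=.
  by rewrite !orbF leNgt ltr0n.
have [||||h1 h2] := first_terms_lt _ _ _ _ h.
- by apply: bigmax_ge0 => j; exact: sup_norm_ge0 P1.
- by apply: bigmax_ge0 => j; apply: bigmax_ge0 => i; exact: sup_norm_ge0 P1.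
- by apply: bigmax_ge0 => j; apply: bigmax_ge0 => i; exact: holder_ge0 P1 P2 P12.
- exact: sup_norm_ge0 P1.
split.
  have := le_lt_trans (sup_norm_le _ Ax) h1; rewrite lte_fin => /ltW; apply: le_trans.
  by apply: le_trans (coord_enorm _ k); rewrite !mxE.
move=> j; have h3 : (sup_norm A2 (partial j (fun x => (X x - x)%R)) < e%:E)%E.
  by apply: le_lt_trans h2; exact: (le_bigmax _ (fun j => sup_norm A2 (partial j (fun x => (X x - x)%R)))).
have := le_lt_trans (sup_norm_le _ Ax) h3; rewrite lte_fin => /ltW; apply: le_trans.
apply: le_trans (coord_enorm _ k).
have -> : partial j (fun x => X x - x) x = partial j X x - delta_mx 0 j.
  rewrite /partial deriveB; [|exact: dX|exact: derivable_id].
  by rewrite derive_id.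
by rewrite !mxE eqxx /= eq_sym.
Qed.

End NormCloseness.

Section ImageCloseness.
Variables (R : realType) (alpha : R) (X : 'rV[R]_4 -> 'rV[R]_4) (e : R).
Hypotheses (HX : canonically_extended_diffeo alpha X)
  (hn : (C2alpha_norm alpha A2 (fun x => (X x - x)%R) < e%:E)%E).

Lemma image_close a b k : `|image_y X a b 0 k - clif a b 0 k| <= 4 * e /\
  `|push X (@clif1 R) a b 0 k - clif1 a b 0 k| <= 4 * e /\
  `|push X (@clif2 R) a b 0 k - clif2 a b 0 k| <= 4 * e.
Proof.
have [[g [_ _ _ _ [[C _ _] _]]] _] := HX.
have dX x j : A2 x -> derivable X x (delta_mx 0 j).
  by move=> Ax; have [_ H] := C x Ax; have [d _] := H j; exact: d.
have Ac := S3_A2 (clifford_S3 (@clif_torus R a b)).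
have [h1 h2] := C2alpha_norm_close dX hn Ac k.
have e0 : 0 <= e by apply: le_trans h1.
split; first by apply: (le_trans h1); rewrite ler_peMl // ler1n.
have P (u : R -> R -> 'rV[R]_4) : (forall j, `|u a b 0 j| <= 3 / 4) -> `|push X u a b 0 k - u a b 0 k| <= 4 * e.
  move=> ub; rewrite mxE.
  have -> : u a b 0 k = \sum_j (j == k)%:R * u a b 0 j.
    by rewrite (bigD1 k) //= eqxx mul1r big1 ?addr0 // => j /negPf ->; rewrite mul0r.
  rewrite -sumrB; apply: (le_trans (ler_norm_sum _ _ _)).
  have -> : 4 * e = \sum_(j < 4) e by rewrite sumr_const card_ord mulr_natl.
  apply: ler_sum => j _; rewrite -mulrBl normrM -[leRHS]mulr1.
  by apply: ler_pM => //; exact: le34 (ub j).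
by split; apply: P => j; [exact: clif1_bound|exact: clif2_bound].
Qed.

End ImageCloseness.
(** * Rotations and the balancing condition *)

Section Rotations.
Variable R : realType.
Implicit Types (x u v : 'rV[R]_4) (g h : 'M[R]_4) (i j k l : 'I_4).

Definition orth g : Prop := forall u v, dot (u *m g) (v *m g) = dot u v.

Lemma dotmx u v : dot u v = (u *m v^T) 0 0.
Proof. by rewrite mxE; apply: eq_bigr => k _; rewrite mxE. Qed.

Lemma dot_delta k l : dot (delta_mx 0 k : 'rV[R]_4) (delta_mx 0 l) = (k == l)%:R.
Proof.
rewrite /dot (bigD1 k) //= big1 => [|m /negPf mk].
  by rewrite !mxE !eqxx mul1r addr0.
by rewrite !mxE mk mul0r.
Qed.

Lemma orthP g : orth g <-> g *m g^T = 1%:M.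
Proof.
split=> [H|H u v]; last by rewrite !dotmx trmx_mul mulmxA -(mulmxA u) H mulmx1.
apply/matrixP => k l; have := H (delta_mx 0 k) (delta_mx 0 l).
rewrite dot_delta -!rowE => e; rewrite [RHS]mxE -e.
by rewrite mxE; apply: eq_bigr => m _; rewrite !mxE.
Qed.

Lemma orth1 : orth 1%:M. Proof. by move=> u v; rewrite !mulmx1. Qed.

Lemma orthM g h : orth g -> orth h -> orth (g *m h).
Proof. by move=> Hg Hh u v; rewrite !mulmxA Hh Hg. Qed.

Lemma orthT g : orth g -> orth g^T.
Proof. by move=> /orthP H; apply/orthP; rewrite trmxK; exact: mulmx1C. Qed.

Lemma mulmx_orthVK g x : orth g -> x *m g^T *m g = x.
Proof. by move=> /orthP H; rewrite -mulmxA (mulmx1C H) mulmx1. Qed.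

Lemma unit_coord x k : dot x x = 1 -> `|x 0 k| <= 1.
Proof. by move=> e; apply: (le_trans (coord_enorm x k)); rewrite /enorm e sqrtr1. Qed.

Lemma orth_entry g k l : orth g -> `|g k l| <= 1.
Proof.
move=> H; have := @unit_coord (delta_mx 0 k *m g) l; rewrite H dot_delta eqxx => /(_ erefl).
by rewrite -rowE mxE.
Qed.

Lemma C1V_mul (z z1 z2 : R -> R -> 'rV[R]_4) g : C1V z z1 z2 ->
  C1V (fun a b => z a b *m g) (fun a b => z1 a b *m g) (fun a b => z2 a b *m g).
Proof.
move=> H k; apply: (C1T_ext (C1T_sum (index_enum 'I_4)
  (fun j => C1TM (H j) (@C1T_cst R (g j k))))) => a b; rewrite mxE //;
  by apply: eq_bigr => j _; rewrite mulr0 addr0.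
Qed.

Let sum_delta x i : \sum_l x 0 l * (l == i)%:R = x 0 i.
Proof.
by rewrite (bigD1 i) //= eqxx mulr1 big1 ?addr0 // => l /negPf ->; rewrite mulr0.
Qed.

Definition rot i j (t : R) : 'M[R]_4 := \matrix_(l, k)
  (if k == i then cos t * (l == i)%:R - sin t * (l == j)%:R
   else if k == j then sin t * (l == i)%:R + cos t * (l == j)%:R else (l == k)%:R).

Lemma mul_rot x i j t k : (x *m rot i j t) 0 k =
  if k == i then cos t * x 0 i - sin t * x 0 j
  else if k == j then sin t * x 0 i + cos t * x 0 j else x 0 k.
Proof.
rewrite mxE; case: (eqVneq k i) => [->|ki].
  rewrite -(sum_delta x i) -(sum_delta x j) !mulr_sumr -sumrB.
  by apply: eq_bigr => l _; rewrite mxE eqxx; ring.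
case: (eqVneq k j) => [kj|kj].
  rewrite {k}kj in ki *; rewrite -(sum_delta x i) -(sum_delta x j) !mulr_sumr -big_split.
  apply: eq_bigr => l _ /=; rewrite mxE eqxx; case: eqP => [ji|_]; last by ring.
  by rewrite ji eqxx in ki.
rewrite -(sum_delta x k); apply: eq_bigr => l _.
by rewrite mxE (negPf ki) (negPf kj).
Qed.

Lemma wdot_split w x z i j : i != j ->
  wdot w x z = w i * x 0 i * z 0 i + w j * x 0 j * z 0 j
    + \sum_(k < 4 | (k != i) && (k != j)) w k * x 0 k * z 0 k.
Proof.
by move=> ij; rewrite /wdot (bigD1 i) //= (bigD1 j) /= 1?eq_sym // addrA.
Qed.

Lemma orth_rot i j t : i != j -> orth (rot i j t).
Proof.
move=> ij u v; rewrite !dotE !(wdot_split _ _ _ ij) !mul_rot !eqxx eq_sym (negPf ij).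
congr (_ + _); first by have := cos2Dsin2 t; rewrite !expr2 => e; rewrite -[RHS]mulr1 -e; ring.
by apply: eq_bigr => k /andP[/negPf ki /negPf kj]; rewrite !mul_rot ki kj.
Qed.

Lemma qf_rot x i j t : (i < 2)%N -> (2 <= j)%N ->
  qf (x *m rot i j t) (x *m rot i j t) =
  qf x x - 2 * sin t ^+ 2 * (x 0 i ^+ 2 - x 0 j ^+ 2) - 4 * (sin t * cos t) * (x 0 i * x 0 j).
Proof.
move=> i2 j2; have ij : i != j.
  by apply/negP => /eqP e; move: i2; rewrite e ltnNge j2.
rewrite /qf !(wdot_split _ _ _ ij) !mul_rot !eqxx eq_sym (negPf ij).
rewrite /sgn4 i2 ltnNge j2 /=.
set S := \sum_(_ < _ | _) _; set S' := \sum_(_ < _ | _) _.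
have -> : S = S'.
  by apply: eq_bigr => k /andP[/negPf ki /negPf kj]; rewrite !mul_rot ki kj.
have := cos2Dsin2 t => e; have c2 : cos t ^+ 2 = 1 - sin t ^+ 2 by rewrite -e addrK.
by ring: c2.
Qed.

End Rotations.

Section Balancing.
Variable R : realType.
Opaque iint.

Lemma der_min0 (f : R -> R) d : der f 0 d -> (forall t, f 0 <= f t) -> d = 0.
Proof.
move=> df m; apply/eqP; rewrite -normr_le0; apply/ler_addgt0Pr => e e0; rewrite add0r.
have [r r0 h] := (derP _ _ _).1 df e e0.
have p : 0 < r / 2 by rewrite divr_gt0.
have pr : r / 2 < r by rewrite ltr_pdivrMr // ltr_pMr // ltr1n.
have h1 := h (r / 2); have h2 := h (- (r / 2)).
rewrite (gtr0_norm p) add0r in h1; rewrite normrN (gtr0_norm p) sub0r in h2.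
have := h1 pr; have := h2 pr; rewrite !ler_norml => /andP[_ a] /andP[_ b].
have m1 := m (r / 2); have m2 := m (- (r / 2)).
have e1 : d * - (r / 2) = - (d * (r / 2)) by ring.
have e2 : - e * (r / 2) = - (e * (r / 2)) by ring.
rewrite e1 in a; clear -a b m1 m2 p e2.
apply/andP; split; rewrite -(ler_pM2r p) ?e2.
  by move: (d * (r / 2)) (e * (r / 2)) (f (r / 2)) (f (- (r / 2))) (f 0) a b m1 m2 => *; lra.
by move: (d * (r / 2)) (e * (r / 2)) (f (r / 2)) (f (- (r / 2))) (f 0) a b m1 m2 => *; lra.
Qed.

Variables (z z1 z2 : R -> R -> 'rV[R]_4).
Hypothesis Hz : C1V z z1 z2.
Hypothesis zmin : forall (i j : 'I_4) t, (i < 2)%N -> (2 <= j)%N ->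
  iint (fun a b => qf (z a b) (z a b) ^+ 2) <=
  iint (fun a b => qf (z a b *m rot i j t) (z a b *m rot i j t) ^+ 2).

(** The first variation of the mean square of the quadratic form under
    rotations mixing the two plane factors. *)
Lemma balanced_of_min (i j : 'I_4) : (i < 2)%N -> (2 <= j)%N ->
  iint (fun a b => qf (z a b) (z a b) * z a b 0 i * z a b 0 j) = 0.
Proof.
move=> i2 j2; pose s a b := qf (z a b) (z a b).
have cz k := C1T_cont (Hz k); have cs_ : cont2 s := C1T_cont (C1V_wdot (sgn4 R) Hz Hz).
pose A a b := z a b 0 i ^+ 2 - z a b 0 j ^+ 2; pose B a b := z a b 0 i * z a b 0 j.
have cA : cont2 A.
  exact: (cont2D (@cont2X R _ 2 (cz i)) (cont2N (@cont2X R _ 2 (cz j)))).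
have cB : cont2 B := cont2M (cz i) (cz j).
have cZ (c : R) F : cont2 F -> cont2 (fun a b => c * F a b) by exact: (cont2M (@cont2_cst R c)).
(* the mean square along the rotation, as a trigonometric polynomial in [t] *)
pose phi (t : R) := iint (fun a b => s a b ^+ 2) + (- 4 * sin t ^+ 2) * iint (fun a b => s a b * A a b)
  + (- 8 * (sin t * cos t)) * iint (fun a b => s a b * B a b)
  + (4 * sin t ^+ 4) * iint (fun a b => A a b ^+ 2)
  + (16 * sin t ^+ 3 * cos t) * iint (fun a b => A a b * B a b)
  + (16 * sin t ^+ 2 * cos t ^+ 2) * iint (fun a b => B a b ^+ 2).
have phiE t : phi t = iint (fun a b => qf (z a b *m rot i j t) (z a b *m rot i j t) ^+ 2).
  have c0 := @cont2X R _ 2 cs_; have c1 := cont2M cs_ cA; have c2 := cont2M cs_ cB.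
  have c3 := @cont2X R _ 2 cA; have c4 := cont2M cA cB; have c5 := @cont2X R _ 2 cB.
  rewrite /phi -(iintZ _ c1) -(iintZ _ c2) -(iintZ _ c3) -(iintZ _ c4) -(iintZ _ c5).
  have d1 := cZ (- 4 * sin t ^+ 2) _ c1; have d2 := cZ (- 8 * (sin t * cos t)) _ c2.
  have d3 := cZ (4 * sin t ^+ 4) _ c3; have d4 := cZ (16 * sin t ^+ 3 * cos t) _ c4.
  have d5 := cZ (16 * sin t ^+ 2 * cos t ^+ 2) _ c5.
  have e1 := cont2D c0 d1; have e2 := cont2D e1 d2.
  have e3 := cont2D e2 d3; have e4 := cont2D e3 d4.
  rewrite -(iintD c0 d1) -(iintD e1 d2) -(iintD e2 d3) -(iintD e3 d4) -(iintD e4 d5).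
  by apply: iint_ext => a b; rewrite qf_rot // /s /A /B; ring.
have dphi : der phi 0 (- 8 * iint (fun a b => s a b * B a b)).
  have ds := is_derive_sin (0 : R); have dc := is_derive_cos (0 : R).
  have c (x : R) := der_cst x 0.
  have s2 := derM ds ds; have s3 := derM s2 ds; have s4 := derM s3 ds.
  rewrite /phi; move: (iint (fun a b => s a b ^+ 2)) (iint (fun a b => s a b * A a b))
    (iint (fun a b => s a b * B a b)) (iint (fun a b => A a b ^+ 2))
    (iint (fun a b => A a b * B a b)) (iint (fun a b => B a b ^+ 2)) => I0 I1 I2 I3 I4 I5.
  apply: (der_eq (derD (derD (derD (derD (derD (c I0) (derM (derM (c (- 4)) s2) (c I1)))
     (derM (derM (c (- 8)) (derM ds dc)) (c I2))) (derM (derM (c 4) s4) (c I3)))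
     (derM (derM (derM (c 16) s3) dc) (c I4))) (derM (derM (derM (c 16) s2) (derM dc dc)) (c I5)))).
    by move=> t; ring.
  by rewrite sin0 cos0; ring.
have := der_min0 dphi _; have m t : phi 0 <= phi t.
  rewrite !phiE; apply: le_trans (zmin t i2 j2).
  by rewrite -phiE /phi sin0 !(expr0n, mulr0, mul0r, addr0) /=.
move=> /(_ m) /eqP; rewrite mulf_eq0 oppr_eq0 pnatr_eq0 /= => /eqP e.
by rewrite -[RHS]e; apply: iint_ext => a b; rewrite mulrA.
Qed.

End Balancing.
(** * Choice of the rotation *)

Section OrthogonalCompact.
Variable R : realType.

(** Matrices are flattened to row vectors, for which boxes are known to be
    compact. *)
Definition mx16 (v : 'rV[R]_(4 * 4)) : 'M[R]_4 := vec_mx v.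

Definition orth_set : set 'rV[R]_(4 * 4) := [set v | orth (mx16 v)].

Let mx16E v k l : mx16 v k l = v 0 (mxvec_index k l).
Proof. by rewrite /mx16 mxE. Qed.

Lemma mx16K (g : 'M[R]_4) : mx16 (mxvec g) = g.
Proof. exact: mxvecK. Qed.

Lemma orth_set_compact : compact orth_set.
Proof.
have box : compact [set v : 'rV[R]_(4 * 4) | forall i, v ord0 i \in `[-1, 1]].
  apply: (@rV_compact R _ (fun=> [set` `[(- 1 : R), 1]])) => _; exact: segment_compact.
apply: subclosed_compact box _; last first.
  move=> v Ov i; case/mxvec_indexP: i => k l.
  by rewrite in_itv /= -ler_norml -mx16E; exact: orth_entry.
pose f (kl : 'I_4 * 'I_4) (v : 'rV[R]_(4 * 4)) : R := (mx16 v *m (mx16 v)^T) kl.1 kl.2.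
have -> : orth_set = \bigcap_(kl in [set: 'I_4 * 'I_4]) (f kl @^-1` [set (1%:M : 'M[R]_4) kl.1 kl.2]).
  apply/seteqP; split=> [v /orthP Ov kl _|v H]; first by rewrite /= /f Ov.
  by apply/orthP; apply/matrixP => k l; exact: (H (k, l)).
apply: closed_bigI => -[k l] _.
have cf : continuous (f (k, l)).
  have cc k' l' x : {for x, continuous (fun v : 'rV[R]_(4 * 4) => v 0 (mxvec_index k' l'))}.
    exact: coord_continuous.
  have sq m x := continuousM (cc k m x) (cc l m x).
  have -> : f (k, l) = (fun v => v 0 (mxvec_index k (inord 0)) * v 0 (mxvec_index l (inord 0))
    + v 0 (mxvec_index k (inord 1)) * v 0 (mxvec_index l (inord 1))
    + v 0 (mxvec_index k (inord 2)) * v 0 (mxvec_index l (inord 2))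
    + v 0 (mxvec_index k (inord 3)) * v 0 (mxvec_index l (inord 3))).
    by apply/funext => v; rewrite /f mxE sum4 /= !mxE.
  move=> x; exact: (continuousD (continuousD (continuousD (sq _ x) (sq _ x)) (sq _ x)) (sq _ x)).
have /continuous_closedP H := cf; apply: H; exact: closed_eq.
Qed.

End OrthogonalCompact.

Section Slice.
Variable R : realType.
Opaque iint.
Implicit Types (x w : 'rV[R]_4) (g h : 'M[R]_4).

Definition mean_qf (y : R -> R -> 'rV[R]_4) g : R :=
  iint (fun a b => qf (y a b *m g) (y a b *m g) ^+ 2).

Lemma qf_bound x : dot x x = 1 -> `|qf x x| <= 1.
Proof.
move=> <-; rewrite /qf /dot; apply: (le_trans (ler_norm_sum _ _ _)).
apply: ler_sum => k _; rewrite -mulrA normrM -[leRHS]mul1r.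
apply: ler_pM => //; first by rewrite /sgn4; case: ifP; rewrite ?normrN normr1.
by rewrite ger0_norm // -expr2 sqr_ge0.
Qed.

Lemma mulmx_close x x' g g' (d : R) k : dot x x = 1 -> orth g' ->
  (forall j, `|x 0 j - x' 0 j| <= d) -> (forall j, `|g j k - g' j k| <= d) ->
  `|(x *m g) 0 k - (x' *m g') 0 k| <= 8 * d.
Proof.
move=> x1 og hx hg; rewrite !mxE -sumrB; apply: (le_trans (ler_norm_sum _ _ _)).
have -> : 8 * d = \sum_(j < 4) (2 * d) by rewrite sumr_const card_ord; ring.
apply: ler_sum => j _; rewrite mulrC [X in _ - X]mulrC.
apply: product_close => //; first exact: orth_entry.
exact: unit_coord.
Qed.

Lemma qf_orth_close x x' g g' (d : R) : dot x x = 1 -> dot x' x' = 1 -> orth g -> orth g' ->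
  (forall j, `|x 0 j - x' 0 j| <= d) -> (forall j k, `|g j k - g' j k| <= d) ->
  `|qf (x *m g) (x *m g) ^+ 2 - qf (x' *m g') (x' *m g') ^+ 2| <= 128 * d.
Proof.
move=> x1 x1' og og' hx hg.
have c k := @mulmx_close x x' g g' d k x1 og' hx (hg ^~ k).
have u1 : dot (x *m g) (x *m g) = 1 by rewrite og.
have u2 : dot (x' *m g') (x' *m g') = 1 by rewrite og'.
have h : `|qf (x *m g) (x *m g) - qf (x' *m g') (x' *m g')| <= 8 * (8 * d).
  apply: sum_close => // k; try exact: unit_coord.
  by rewrite /sgn4; case: ifP; rewrite ?normrN normr1.
have := qf_bound u1; have := qf_bound u2.
move: (qf (x *m g) _) (qf (x' *m g') _) h => A B h hB hA.
rewrite subr_sqr normrM.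
have -> : 128 * d = 8 * (8 * d) * (1 + 1) by ring.
by apply: ler_pM => //; apply: (le_trans (ler_normD _ _)); apply: lerD.
Qed.

Let cq (y y1 y2 : R -> R -> 'rV[R]_4) g : C1V y y1 y2 ->
  cont2 (fun a b => qf (y a b *m g) (y a b *m g) ^+ 2).
Proof.
move=> Hy; have Hz := C1V_mul g Hy.
exact: (@cont2X R _ 2 (C1T_cont (C1V_wdot (sgn4 R) Hz Hz))).
Qed.

Lemma mean_qf_close (y y1 y2 y' y1' y2' : R -> R -> 'rV[R]_4) g g' (d : R) :
  C1V y y1 y2 -> C1V y' y1' y2' ->
  (forall a b, dot (y a b) (y a b) = 1) -> (forall a b, dot (y' a b) (y' a b) = 1) ->
  orth g -> orth g' ->
  (forall a b j, `|y a b 0 j - y' a b 0 j| <= d) -> (forall j k, `|g j k - g' j k| <= d) ->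
  `|mean_qf y g - mean_qf y' g'| <= 128 * d * (2 * pi) ^+ 2.
Proof.
move=> Hy Hy' s s' og og' hy hg; rewrite -(iintB (@cq _ _ _ g Hy) (@cq _ _ _ g' Hy')) -iint_cst.
apply: iint_abs; first exact: (cont2D (@cq _ _ _ g Hy) (cont2N (@cq _ _ _ g' Hy'))).
  exact: cont2_cst.
by move=> a b; apply: qf_orth_close => // j; exact: hy.
Qed.

(** The orthogonal group is compact and the mean square depends continuously on
    the rotation. *)
Lemma mean_qf_min (y y1 y2 : R -> R -> 'rV[R]_4) : C1V y y1 y2 ->
  (forall a b, dot (y a b) (y a b) = 1) ->
  exists2 v, @orth_set R v & forall g, orth g -> mean_qf y (mx16 v) <= mean_qf y g.
Proof.
move=> Hy sy.
have ne : (@orth_set R) !=set0.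
  by exists (mxvec 1%:M); rewrite /orth_set /= mx16K; exact: orth1.
have c : {within @orth_set R, continuous (fun v => mean_qf y (mx16 v))}.
  apply/subspace_continuousP => v Ov; apply/cvgrPdist_le => e e0.
  have K0 : 0 < 128 * (2 * pi) ^+ 2 :> R by rewrite mulr_gt0 // exprn_gt0 // tau_gt0.
  pose d := e / (128 * (2 * pi) ^+ 2); have d0 : 0 < d by rewrite divr_gt0.
  suff H : nbhs v (fun w : 'rV[R]_(4 * 4) => orth_set w -> `|mean_qf y (mx16 v) - mean_qf y (mx16 w)| <= e) by exact: H.
  apply/nbhs_ballP; exists d => //= w bw Ow.
  have dE : 128 * d * (2 * pi) ^+ 2 = e by rewrite (mulrC 128) -mulrA /d divfK // gt_eqF.
  rewrite -dE.
  apply: (mean_qf_close Hy Hy) => // [a b j|j k]; first by rewrite subrr normr0 ltW.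
  rewrite /mx16 !mxE; apply: ltW; have [_ /(_ 0 (mxvec_index j k))] := bw.
  by rewrite /ball /=.
have [v Ov m] := compact_EVT_min ne (@orth_set_compact R) c.
exists v; first by rewrite inE in Ov.
move=> g og; rewrite -(mx16K g); apply: m; rewrite inE /orth_set /= mx16K; exact: og.
Qed.

End Slice.
Section CliffordStabilizer.
Variable R : realType.
Implicit Types (x w : 'rV[R]_4).

Lemma unit_circle_angle (u v : R) : u ^+ 2 + v ^+ 2 = 1 -> exists t, u = cos t /\ v = sin t.
Proof.
move=> e; have u1 : -1 <= u <= 1.
  have v0 := sqr_ge0 v; by apply/andP; split; nra.
have s : 1 - u ^+ 2 = v ^+ 2 by rewrite -e addrC addKr.
have [v0|v0] := leP 0 v.
  exists (acos u); rewrite acosK ?in_itv // sin_acos // s sqrtr_sqr ger0_norm //.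
exists (- acos u); rewrite cosN sinN acosK ?in_itv // sin_acos // s sqrtr_sqr ltr0_norm //.
by rewrite opprK.
Qed.

Lemma clif_surj x : clifford_torus x -> exists a b, x = clif a b.
Proof.
move=> /clifford_torusE[h1 h2].
have [r [rE r2]] : exists r : R, r = Num.sqrt 2 / 2 /\ r ^+ 2 = 1 / 2.
  by exists (Num.sqrt 2 / 2); split=> //; exact: half_sqrt2_sqr.
have r0 : r != 0 by rewrite -sqrf_eq0 r2 mulf_neq0 // ?invr_eq0 ?oner_neq0 // pnatr_eq0.
have un (u v : R) : u ^+ 2 + v ^+ 2 = 1 / 2 -> (u / r) ^+ 2 + (v / r) ^+ 2 = 1.
  by move=> e; rewrite !expr_div_n r2 -mulrDl e mulfV // mulf_neq0 // ?invr_eq0 ?oner_neq0 // pnatr_eq0.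
have [a [a1 a2]] := unit_circle_angle (un _ _ h1); have [b [b1 b2]] := unit_circle_angle (un _ _ h2).
exists a, b; apply/rowP => k; rewrite mxE -rE.
have ne (u c : R) : u / r = c -> u = r * c by move=> <-; rewrite mulrC divfK.
have E (n : nat) (kl : (n < 4)%N) : x 0 (Ordinal kl) = x 0 (inord n).
  by congr (x 0 _); apply: val_inj; rewrite /= inordK.
case: k => -[|[|[|[|k]]]] kl //=; rewrite E; exact: ne.
Qed.

Variable g : 'M[R]_4.
Hypothesis og : orth g.
Hypothesis g0 : forall a b, qf (clif a b *m g) (clif a b *m g) = 0.

Let B x w := qf (x *m g) (w *m g).

Let BDr x w w' : B x (w + w') = B x w + B x w'.
Proof. by rewrite /B mulmxDl /qf wdotDr. Qed.
Let BZr x c w : B x (c *: w) = c * B x w.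
Proof. by rewrite /B -scalemxAl /qf wdotZr. Qed.
Let BC x w : B x w = B w x. Proof. exact: wdotC. Qed.
Let BDl x x' w : B (x + x') w = B x w + B x' w. Proof. by rewrite BC BDr !(BC w). Qed.
Let BZl x c w : B (c *: x) w = c * B x w. Proof. by rewrite BC BZr (BC w). Qed.

Let cone x (n : R) : 0 < n -> x 0 (inord 0) ^+ 2 + x 0 (inord 1) ^+ 2 = n ->
  x 0 (inord 2) ^+ 2 + x 0 (inord 3) ^+ 2 = n -> B x x = 0.
Proof.
move=> n0 h1 h2; pose c := (Num.sqrt (2 * n))^-1.
have n2 : 0 < 2 * n by rewrite mulr_gt0.
have c2 : c ^+ 2 = (2 * n)^-1 by rewrite exprVn sqr_sqrtr // ltW.
have [|a [b e]] := @clif_surj (c *: x).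
  apply/clifford_torusE; rewrite !mxE !exprMn -!mulrDr h1 h2 c2.
  by split; field; rewrite gt_eqF.
have := g0 a b; rewrite -e -/(B _ _) BZl BZr mulrA -expr2 c2 => /eqP.
by rewrite mulf_eq0 invr_eq0 (gt_eqF n2) /= => /eqP.
Qed.

Let E i : 'rV[R]_4 := delta_mx 0 (inord i).
Let vec (x0 x1 x2 x3 : R) : 'rV[R]_4 := x0 *: E 0 + x1 *: E 1 + x2 *: E 2 + x3 *: E 3.

Let vecE (x0 x1 x2 x3 : R) : [/\ vec x0 x1 x2 x3 0 (inord 0) = x0, vec x0 x1 x2 x3 0 (inord 1) = x1,
  vec x0 x1 x2 x3 0 (inord 2) = x2 & vec x0 x1 x2 x3 0 (inord 3) = x3].
Proof.
by rewrite !mxE -!(inj_eq val_inj) /= !inordK //= !(mulr1, mulr0, addr0, add0r).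
Qed.

Let Bvec (x0 x1 x2 x3 : R) (q := fun i j => B (E i) (E j)) : B (vec x0 x1 x2 x3) (vec x0 x1 x2 x3) =
  x0 ^+ 2 * q 0%N 0%N + x1 ^+ 2 * q 1%N 1%N + x2 ^+ 2 * q 2%N 2%N + x3 ^+ 2 * q 3%N 3%N
  + 2 * (x0 * x1 * q 0%N 1%N + x0 * x2 * q 0%N 2%N + x0 * x3 * q 0%N 3%N
         + x1 * x2 * q 1%N 2%N + x1 * x3 * q 1%N 3%N + x2 * x3 * q 2%N 3%N).
Proof.
rewrite /vec !BDl !BDr !BZl !BZr /q.
rewrite (BC (E 1) (E 0)) (BC (E 2) (E 0)) (BC (E 3) (E 0)) (BC (E 2) (E 1)) (BC (E 3) (E 1)) (BC (E 3) (E 2)).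
ring.
Qed.

(** A quadratic form vanishing on the cone over the Clifford torus is a multiple
    of [qf]: its ten coefficients are determined by its zeros. *)
Let proportional x : B x x = B (E 0) (E 0) * qf x x.
Proof.
have K (x0 x1 x2 x3 n : R) : 0 < n -> x0 ^+ 2 + x1 ^+ 2 = n -> x2 ^+ 2 + x3 ^+ 2 = n ->
    B (vec x0 x1 x2 x3) (vec x0 x1 x2 x3) = 0.
  move=> n0 e1 e2; have [a0 a1 a2 a3] := vecE x0 x1 x2 x3.
  by apply: (cone n0); rewrite ?a0 ?a1 ?a2 ?a3.
have k1 := K 1 0 1 0 1 ltr01; have k2 := K 1 0 (- 1) 0 1 ltr01; have k3 := K 1 0 0 1 1 ltr01.
have k4 := K 1 0 0 (- 1) 1 ltr01; have k5 := K 0 1 1 0 1 ltr01; have k6 := K 0 1 (- 1) 0 1 ltr01.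
have k7 := K 0 1 0 1 1 ltr01; have k8 := K 0 1 0 (- 1) 1 ltr01.
(* the coefficients mixing the coordinates of one factor need a cone point with
   both of them nonzero, such as those from [3 ^ 2 + 4 ^ 2 = 5 ^ 2] *)
have p25 : 0 < 25 :> R by rewrite ltr0n.
have k9 := K 3 4 5 0 25 p25; have k10 := K 5 0 3 4 25 p25.
have xE : x = vec (x 0 (inord 0)) (x 0 (inord 1)) (x 0 (inord 2)) (x 0 (inord 3)).
  have [e0 e1 e2 e3] := vecE (x 0 (inord 0)) (x 0 (inord 1)) (x 0 (inord 2)) (x 0 (inord 3)).
  apply/rowP => k; have E' (n : nat) (kl : (n < 4)%N) : Ordinal kl = inord n.
    by apply: val_inj; rewrite /= inordK.
  case: k => -[|[|[|[|k]]]] kl //; rewrite !E'; by [rewrite e0|rewrite e1|rewrite e2|rewrite e3].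
rewrite {1 2}xE qfE; rewrite !Bvec in k1 k2 k3 k4 k5 k6 k7 k8 k9 k10 *.
move: (x 0 _) (x 0 _) (x 0 _) (x 0 _) => x0 x1 x2 x3.
clear xE; move: (B (E 0) (E 0)) (B (E 1) (E 1)) (B (E 2) (E 2)) (B (E 3) (E 3)) (B (E 0) (E 1))
  (B (E 0) (E 2)) (B (E 0) (E 3)) (B (E 1) (E 2)) (B (E 1) (E 3)) (B (E 2) (E 3))
  k1 k2 k3 k4 k5 k6 k7 k8 k9 k10 => q00 q11 q22 q33 q01 q02 q03 q12 q13 q23.
clear; move=> k1 k2 k3 k4 k5 k6 k7 k8 k9 k10.
have {k1}k1 := k1 ltac:(ring) ltac:(ring); have {k2}k2 := k2 ltac:(ring) ltac:(ring).
have {k3}k3 := k3 ltac:(ring) ltac:(ring); have {k4}k4 := k4 ltac:(ring) ltac:(ring).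
have {k5}k5 := k5 ltac:(ring) ltac:(ring); have {k6}k6 := k6 ltac:(ring) ltac:(ring).
have {k7}k7 := k7 ltac:(ring) ltac:(ring); have {k8}k8 := k8 ltac:(ring) ltac:(ring).
have {k9}k9 := k9 ltac:(ring) ltac:(ring); have {k10}k10 := k10 ltac:(ring) ltac:(ring).
have e02 : q02 = 0 by lra.
have e03 : q03 = 0 by lra.
have e12 : q12 = 0 by lra.
have e13 : q13 = 0 by lra.
have e22 : q22 = - q00 by lra.
have e33 : q33 = - q00 by lra.
have e11 : q11 = q00 by lra.
have e01 : q01 = 0 by rewrite e02 e12 e22 e11 in k9; lra.
have e23 : q23 = 0 by rewrite e02 e03 e22 e33 in k10; lra.
by rewrite e02 e03 e12 e13 e22 e33 e11 e01 e23; ring.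
Qed.

(** A rotation carrying the Clifford torus into itself preserves its quadratic
    form up to sign: it multiplies the form by a scalar, and both the form and
    its inverse image are bounded by 1 on the unit sphere. *)
Lemma clifford_stabilizer x : qf (x *m g) (x *m g) ^+ 2 = qf x x ^+ 2.
Proof.
rewrite -/(B x x) proportional exprMn.
have uE : dot (E 0) (E 0) = 1 by rewrite /E dot_delta eqxx.
pose w := E 0 *m g^T; have uw : dot w w = 1 by rewrite /w (orthT og).
have h1 : `|B (E 0) (E 0)| <= 1 by apply: qf_bound; rewrite og.
have h2 : B (E 0) (E 0) * qf w w = 1.
  rewrite -proportional /B /w (mulmx_orthVK _ og) qfE /E !mxE -!(inj_eq val_inj) /= !inordK //=.
  by rewrite !(mulr1, mulr0, mul0r, addr0, subr0).
have h3 := qf_bound uw.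
have h4 : `|B (E 0) (E 0)| = 1.
  apply/eqP; rewrite eq_le h1 /= -[leLHS](normr1 R) -h2 normrM.
  by rewrite ler_piMr.
by rewrite -(real_normK (num_real (B (E 0) (E 0)))) h4 expr1n mul1r.
Qed.

End CliffordStabilizer.
Section SliceTheorem.
Variable R : realType.
Opaque iint.
Variables (y y1 y2 : nat -> R -> R -> 'rV[R]_4).
Hypotheses (Hy : forall k, C1V (y k) (y1 k) (y2 k))
  (sy : forall k a b, dot (y k a b) (y k a b) = 1).
Hypothesis ycvg : forall d : R, 0 < d -> \forall k \near \oo,
  forall a b j, `|y k a b 0 j - clif a b 0 j| <= d.

Let clif_unit (a b : R) : dot (clif a b) (clif a b) = 1.
Proof. by apply/S3E; exact: clifford_S3 (@clif_torus R _ _). Qed.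

Let C : R := 128 * (2 * pi) ^+ 2.
Let C0 : 0 < C. Proof. by rewrite mulr_gt0 // exprn_gt0 // tau_gt0. Qed.

(** Among all rotations, take one that minimizes the mean square of the quadratic
    form on the surface.  These rotations accumulate at one that carries the
    Clifford torus into itself; undoing the latter leaves rotations that
    are as close to the identity as desired and still minimize. *)
Theorem near_identity_minimizer (d : R) (P : nat -> Prop) : 0 < d -> (\forall k \near \oo, P k) ->
  exists k h, [/\ P k, orth h, forall i j, `|h i j - (i == j)%:R| <= d &
    forall r, orth r -> mean_qf (y k) h <= mean_qf (y k) (h *m r)].
Proof.
move=> d0 HP.
have /choice[v Hv] : forall k, exists v, @orth_set R v /\
    forall g, orth g -> mean_qf (y k) (mx16 v) <= mean_qf (y k) g.
  by move=> k; have [v Ov m] := @mean_qf_min R _ _ _ (Hy k) (sy k); exists v.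
have PF : ProperFilter (v @ \oo) by exact: fmap_proper_filter.
have [w [Ow cw]] : @orth_set R `&` cluster (v @ \oo) !=set0.
  by apply: (@orth_set_compact R (v @ \oo) PF); exists 0%N => // k _; by have [] := Hv k.
pose g := mx16 w.
have near (Q : nat -> Prop) (t : R) : 0 < t -> (\forall k \near \oo, Q k) ->
    exists2 k, Q k & forall i j, `|mx16 (v k) i j - g i j| <= t.
  move=> t0 HQ; have F1 : (v @ \oo) [set u | exists2 k, Q k & u = v k].
    by apply: filterS HQ => k Qk; exists k.
  have [u [[k Qk ->] [_ b]]] := cw _ _ F1 (nbhsx_ballx w _ t0).
  exists k => // i j; rewrite /g /mx16 !mxE distrC; apply: ltW.
  by have := b 0 (mxvec_index i j); rewrite /ball.
have og : orth g by exact: Ow.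
have M0 : mean_qf (@clif R) 1%:M = 0.
  rewrite /mean_qf (@iint_ext _ _ (fun _ _ => 0)) ?iint_cst ?mul0r // => a b.
  by rewrite mulmx1 (clif_qf a b).1 expr0n.
have Mg : mean_qf (@clif R) g = 0.
  apply/eqP; rewrite eq_le; apply/andP; split; last first.
    have Hz := C1V_mul g (@C1V_clif R).
    apply: iint_ge0 => [|a b]; last exact: sqr_ge0.
    exact: (@cont2X R _ 2 (C1T_cont (C1V_wdot (sgn4 R) Hz Hz))).
  apply/ler_addgt0Pr => e e0; rewrite add0r.
  pose t := e / (2 * C); have t0 : 0 < t by rewrite divr_gt0 // mulr_gt0.
  have [k yk gk] := near _ t t0 (ycvg t0).
  have [Ok mk] := Hv k.
  have a1 : mean_qf (@clif R) g - mean_qf (y k) (mx16 (v k)) <= t * C.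
    apply: le_trans (ler_norm _) _.
    have -> : t * C = 128 * t * (2 * pi) ^+ 2 by rewrite /C; ring.
    by apply: (mean_qf_close (@C1V_clif R) (Hy k)) => // *; rewrite distrC.
  have a2 : mean_qf (y k) 1%:M - mean_qf (@clif R) 1%:M <= t * C.
    apply: le_trans (ler_norm _) _.
    have -> : t * C = 128 * t * (2 * pi) ^+ 2 by rewrite /C; ring.
    apply: (mean_qf_close (Hy k) (@C1V_clif R)) => //; try exact: orth1.
    by move=> *; rewrite subrr normr0 ltW.
  have tC : t * C = e / 2 by rewrite /t; field; rewrite gt_eqF.
  have := mk _ (@orth1 R); rewrite M0 tC in a1 a2.
  by move: (mean_qf (@clif R) g) (mean_qf _ (mx16 _)) (mean_qf _ 1%:M) a1 a2 => *; lra.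
have g0 a b : qf (clif a b *m g) (clif a b *m g) = 0.
  have Hz := C1V_mul g (@C1V_clif R).
  apply/eqP; rewrite -sqrf_eq0; apply/eqP.
  apply: (iint_eq0 (F := fun a b => qf (clif a b *m g) (clif a b *m g) ^+ 2)) => //.
  - exact: (@cont2X R _ 2 (C1T_cont (C1V_wdot (sgn4 R) Hz Hz))).
  - by move=> *; exact: sqr_ge0.
  - by move=> *; congr (_ ^+ 2); exact: (C1T_per1 (C1V_wdot (sgn4 R) Hz Hz)).
  - by move=> *; congr (_ ^+ 2); exact: (C1T_per2 (C1V_wdot (sgn4 R) Hz Hz)).
have stab := clifford_stabilizer og g0.
have d4 : 0 < d / 4 by rewrite divr_gt0.
have [k Pk gk] := near _ _ d4 HP; have [Ok mk] := Hv k.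
exists k, (mx16 (v k) *m g^T); split; first exact: Pk.
- by apply: orthM => //; exact: orthT.
- move=> i j; have -> : (i == j)%:R = (g *m g^T) i j by rewrite (orthP _).1 // mxE.
  rewrite [(mx16 _ *m _) i j]mxE [(g *m _) i j]mxE -sumrB; apply: (le_trans (ler_norm_sum _ _ _)).
  have -> : d = \sum_(m < 4) (d / 4) by rewrite sumr_const card_ord; field.
  apply: ler_sum => m _; rewrite -mulrBl normrM -[leRHS]mulr1.
  by apply: ler_pM; [exact: normr_ge0|exact: normr_ge0|exact: gk|exact: (orth_entry _ _ (orthT og))].
- move=> r ro; have -> : mean_qf (y k) (mx16 (v k) *m g^T) = mean_qf (y k) (mx16 (v k)).
    apply: iint_ext => a b; rewrite mulmxA -stab.
    by rewrite (mulmx_orthVK _ og).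
  have -> : mean_qf (y k) (mx16 (v k) *m g^T *m r) = mean_qf (y k) (mx16 (v k) *m g^T *m r *m g).
    by apply: iint_ext => a b; rewrite !mulmxA stab.
  by apply: mk; do 3!apply: orthM => //; exact: orthT.
Qed.

End SliceTheorem.
Section RotatedSurface.
Variable R : realType.
Opaque iint.
Implicit Types (u v : 'rV[R]_4) (h : 'M[R]_4).

Lemma mulmx_near_identity u v h (d : R) k : (forall j, `|u 0 j| <= 1) -> `|u 0 k - v 0 k| <= d ->
  (forall i j, `|h i j - (i == j)%:R| <= d) -> `|(u *m h) 0 k - v 0 k| <= 5 * d.
Proof.
move=> u1 uv h1.
have -> : (u *m h) 0 k - v 0 k = \sum_j u 0 j * (h j k - (j == k)%:R) + (u 0 k - v 0 k).
  have -> : \sum_j u 0 j * (h j k - (j == k)%:R) = (u *m h) 0 k - (u *m 1%:M) 0 k.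
    by rewrite !mxE -sumrB; apply: eq_bigr => j _; rewrite mxE mulrBr.
  by rewrite mulmx1 addrA subrK.
apply: (le_trans (ler_normD _ _)).
have -> : 5 * d = \sum_(j < 4) d + d by rewrite sumr_const card_ord; ring.
apply: lerD => //; apply: (le_trans (ler_norm_sum _ _ _)); apply: ler_sum => j _.
by rewrite normrM -[leRHS]mul1r; apply: ler_pM.
Qed.

Lemma clifford_of_qf u : dot u u = 1 -> qf u u = 0 -> clifford_torus u.
Proof. by rewrite dot4E qfE => h1 h2; apply/clifford_torusE; rewrite !expr2; split; lra. Qed.

Variables (d : R) (y p q pp pq qq : R -> R -> 'rV[R]_4) (h : 'M[R]_4).
Hypotheses (d0 : 0 <= d) (ds : 60 * (5 * d) <= 1 / 2000).
Hypotheses (Hy : C1V y p q) (Hp : C1V p pp pq) (Hq : C1V q pq qq).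
Hypothesis sphere : forall a b, dot (y a b) (y a b) = 1.
Hypotheses (ny : forall a b k, `|y a b 0 k - clif a b 0 k| <= d)
  (np : forall a b k, `|p a b 0 k - clif1 a b 0 k| <= d)
  (nq : forall a b k, `|q a b 0 k - clif2 a b 0 k| <= d).
Hypothesis minimal_at : forall a b, exists N : 'rV[R]_4,
  [/\ dot N N != 0, dot N (y a b) = 0, dot N (p a b) = 0, dot N (q a b) = 0 &
      dot (q a b) (q a b) * dot N (pp a b) - 2 * dot (p a b) (q a b) * dot N (pq a b)
      + dot (p a b) (p a b) * dot N (qq a b) = 0].
Hypotheses (oh : orth h) (h1 : forall i j, `|h i j - (i == j)%:R| <= d).
Hypothesis hmin : forall r, orth r -> mean_qf y h <= mean_qf y (h *m r).

Let ds' : 60 * d <= 1 / 2000.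
Proof. by apply: le_trans ds; rewrite ler_pM2l // ler_peMl // ler1n. Qed.

Lemma rotated_close a b k : [/\ `|(y a b *m h) 0 k - clif a b 0 k| <= 5 * d,
  `|(p a b *m h) 0 k - clif1 a b 0 k| <= 5 * d & `|(q a b *m h) 0 k - clif2 a b 0 k| <= 5 * d].
Proof.
split; apply: mulmx_near_identity => // j.
- exact: (near_bounded d0 ds' (ny a b j) (clif_bound a b j)).
- exact: (near_bounded d0 ds' (np a b j) (clif1_bound a b j)).
- exact: (near_bounded d0 ds' (nq a b j) (clif2_bound a b j)).
Qed.

(** A further rotation of the rotated surface is a rotation of the original one,
    so the minimality of [h] gives the balancing condition. *)
Lemma rotated_in_clifford a b : clifford_torus (y a b *m h).
Proof.
apply: clifford_of_qf; first by rewrite oh.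
have e0 : 0 <= 5 * d by rewrite mulr_ge0.
have K i j : (i < 2)%N -> (j < 2)%N -> iint (fun a b =>
    qf (y a b *m h) (y a b *m h) * (y a b *m h) 0 (inord i) * (y a b *m h) 0 (inord (2 + j))) = 0.
  move=> i2 j2; apply: (balanced_of_min (C1V_mul h Hy)).
  - move=> i' j' t i2' j2'; have := hmin (@orth_rot R i' j' t _); rewrite /mean_qf.
    have ij : i' != j' by apply/eqP => ij; move: i2'; rewrite ij ltnNge j2'.
    move=> /(_ ij); rewrite (@iint_ext R (fun a b => qf (y a b *m (h *m rot i' j' t)) (y a b *m (h *m rot i' j' t)) ^+ 2)
      (fun a b => qf (y a b *m h *m rot i' j' t) (y a b *m h *m rot i' j' t) ^+ 2)) //.
    by move=> a' b'; rewrite mulmxA.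
  - by rewrite inordK // (ltn_trans i2).
  - by rewrite inordK // ltn_add2l (leq_trans j2).
apply: (@nearby_minimal_torus R (5 * d) (fun a b => y a b *m h) (fun a b => p a b *m h)
  (fun a b => q a b *m h) (fun a b => pp a b *m h) (fun a b => pq a b *m h)
  (fun a b => qq a b *m h) e0 ds (C1V_mul h Hy) (C1V_mul h Hp) (C1V_mul h Hq)) K a b.
- by move=> a' b'; rewrite oh.
- by move=> a' b' k; have [] := rotated_close a' b' k.
- by move=> a' b' k; have [] := rotated_close a' b' k.
- by move=> a' b' k; have [] := rotated_close a' b' k.
- move=> a' b'; have [N [N0 N1 N2 N3 N4]] := minimal_at a' b'.
  by exists (N *m h); rewrite !oh.
Qed.

End RotatedSurface.
(** * Covering the Clifford torus *)

Section SurjectiveOntoClifford.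
Variables (R : realType) (e : R) (z z1 z2 : R -> R -> 'rV[R]_4).

Let small (x : R) : 60 * x <= 1 / 2000 -> x <= 1 / 64. Proof. lra. Qed.
Let le34_1 : 3 / 4 <= 1 :> R. Proof. lra. Qed.

(** By the Lagrange identity the inner product is [1 / 2], the squared length. *)
Lemma circle_eq (u0 u1 w0 w1 : R) : u0 ^+ 2 + u1 ^+ 2 = 1 / 2 -> w0 ^+ 2 + w1 ^+ 2 = 1 / 2 ->
  u0 * w1 - u1 * w0 = 0 -> 0 < u0 * w0 + u1 * w1 -> u0 = w0 /\ u1 = w1.
Proof.
move=> hu hw c i.
have sq : (u0 * w0 + u1 * w1) ^+ 2 = (1 / 2) ^+ 2.
  have -> : (u0 * w0 + u1 * w1) ^+ 2 = (u0 ^+ 2 + u1 ^+ 2) * (w0 ^+ 2 + w1 ^+ 2) - (u0 * w1 - u1 * w0) ^+ 2 by ring.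
  by rewrite hu hw c; ring.
have {}sq : u0 * w0 + u1 * w1 = 1 / 2.
  by apply/eqP; rewrite -(@eqrXn2 _ 2) ?ltW // ?sq // mulr_ge0 // invr_ge0.
have s0 : (u0 - w0) ^+ 2 + (u1 - w1) ^+ 2 = 0.
  have -> : (u0 - w0) ^+ 2 + (u1 - w1) ^+ 2 = (u0 ^+ 2 + u1 ^+ 2) + (w0 ^+ 2 + w1 ^+ 2) - 2 * (u0 * w0 + u1 * w1) by ring.
  by rewrite hu hw sq; field.
move/eqP: s0; rewrite paddr_eq0 ?sqr_ge0 // !sqrf_eq0 !subr_eq0.
by case/andP => /eqP-> /eqP->.
Qed.

(** A vector orthogonal to [(u0, u1)] is a multiple of its quarter turn. *)
Lemma tangent_circle (u0 u1 t0 t1 w0 w1 : R) : u0 ^+ 2 + u1 ^+ 2 = 1 / 2 ->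
  u0 * t0 + u1 * t1 = 0 -> t0 * w0 + t1 * w1 = 2 * (u0 * t1 - u1 * t0) * (u0 * w1 - u1 * w0).
Proof.
move=> hu hp.
have -> : 2 * (u0 * t1 - u1 * t0) * (u0 * w1 - u1 * w0) =
  2 * (u0 ^+ 2 + u1 ^+ 2) * (t0 * w0 + t1 * w1) - 2 * (u0 * t0 + u1 * t1) * (u0 * w0 + u1 * w1) by ring.
by rewrite hu hp; field.
Qed.

Lemma cross_solve (A1 A2 B1 B2 x y : R) : `|A1 - 1 / 2| <= 1 / 8 -> `|A2| <= 1 / 8 ->
  `|B1| <= 1 / 8 -> `|B2 - 1 / 2| <= 1 / 8 -> A1 * x + B1 * y = 0 -> A2 * x + B2 * y = 0 ->
  x = 0 /\ y = 0.
Proof.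
move=> a1 a2 b1 b2 h1 h2.
have D0 : 0 < A1 * B2 - A2 * B1.
  have m : `|A2 * B1| <= 1 / 8 * (1 / 8) by rewrite normrM; apply: ler_pM.
  move: a1 b2 m; rewrite !ler_norml => /andP[a1 _] /andP[b2 _] /andP[_ m].
  have := @ler_pM R (3 / 8) A1 (3 / 8) B2; lra.
have D1 : A1 * B2 - A2 * B1 != 0 by rewrite gt_eqF.
split; apply: (mulIf D1); rewrite mul0r.
  have -> : x * (A1 * B2 - A2 * B1) = B2 * (A1 * x + B1 * y) - B1 * (A2 * x + B2 * y) by ring.
  by rewrite h1 h2; ring.
have -> : y * (A1 * B2 - A2 * B1) = A1 * (A2 * x + B2 * y) - A2 * (A1 * x + B1 * y) by ring.
by rewrite h1 h2; ring.
Qed.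

Lemma cross_close (x y x' y' a a' b b' c : R) : e <= 1 / 64 -> `|x - a| <= e -> `|y - b| <= e -> `|x' - a'| <= e -> `|y' - b'| <= e ->
  `|x| <= 1 -> `|x'| <= 1 -> `|b| <= 1 -> `|b'| <= 1 -> a * b - a' * b' = c ->
  `|x * y - x' * y' - c| <= 1 / 8.
Proof.
move=> es hx hy hx' hy' x1 x1' b1 b1' <-.
have m1 : `|y * x - b * a| <= 2 * e by apply: product_close.
have m2 : `|y' * x' - b' * a'| <= 2 * e by apply: product_close.
have -> : x * y - x' * y' - (a * b - a' * b') = (y * x - b * a) - (y' * x' - b' * a') by ring.
apply: (le_trans (ler_normB _ _)); lra.
Qed.

Lemma periodic_max (f : R -> R -> R) : cont2 f -> (forall a b, f (a + 2 * pi) b = f a b) ->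
  (forall a b, f a (b + 2 * pi) = f a b) -> exists a b, forall a' b', f a' b' <= f a b.
Proof.
move=> cf p1 p2; pose I := [set` `[0, 2 * pi : R]].
have cI : compact (I `*` I) by apply: compact_setX; exact: segment_compact.
have I0 : I `*` I !=set0.
  by exists (0, 0); split; rewrite /I /= in_itv /= lexx ltW // tau_gt0.
have [|c Ic m] := compact_EVT_max I0 cI (f := fun z => f z.1 z.2).
  exact: continuous_subspaceT.
exists c.1, c.2 => a' b'.
have [b'' b0 <-] := in_period (p2 a') b'.
have [a'' a0 <-] := @in_period _ (fun x => f x b'') (fun x => p1 x b'') a'.
by apply: (m (a'', b'')); rewrite inE; split; rewrite /I /= in_itv.
Qed.

Lemma der_max0 (f : R -> R) x d : der f x d -> (forall t, f t <= f x) -> d = 0.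
Proof.
move=> df m; apply/eqP; rewrite -oppr_eq0; apply/eqP.
have dx : der (fun t => - f (x + t)) 0 (- d).
  apply: derN; rewrite -[d]mulr1; apply: der_comp; first by rewrite addr0.
  by apply: (der_eq (derD (der_cst x 0) (der_id 0))) => //; rewrite add0r.
by apply: (der_min0 dx) => t; rewrite addr0 lerN2.
Qed.

Let clif_cross (a b : R) :
  clif a b 0 (inord 0) * clif1 a b 0 (inord 1) - clif a b 0 (inord 1) * clif1 a b 0 (inord 0) = 1 / 2 /\
  clif a b 0 (inord 0) * clif2 a b 0 (inord 1) - clif a b 0 (inord 1) * clif2 a b 0 (inord 0) = 0 /\
  clif a b 0 (inord 2) * clif1 a b 0 (inord 3) - clif a b 0 (inord 3) * clif1 a b 0 (inord 2) = 0 /\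
  clif a b 0 (inord 2) * clif2 a b 0 (inord 3) - clif a b 0 (inord 3) * clif2 a b 0 (inord 2) = 1 / 2.
Proof.
have K (x : R) : Num.sqrt 2 / 2 * cos x * (Num.sqrt 2 / 2 * cos x)
    - Num.sqrt 2 / 2 * sin x * (Num.sqrt 2 / 2 * - sin x) = 1 / 2.
  transitivity ((Num.sqrt 2 / 2) ^+ 2 * (cos x ^+ 2 + sin x ^+ 2)); first by ring.
  by rewrite half_sqrt2_sqr cos2Dsin2 mulr1.
by rewrite !mxE !inordK //= !mulr0 subr0 !K.
Qed.

Let half_sum (x y A B X Y : R) : y = 2 * B * Y -> x = 2 * A * X -> x + y = 0 -> A * X + B * Y = 0.
Proof. by move=> -> ->; lra. Qed.

Let both_positive (u0 u1 u2 u3 w0 w1 w2 w3 : R) : 60 * e <= 1 / 2000 ->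
  u0 ^+ 2 + u1 ^+ 2 = 1 / 2 -> u2 ^+ 2 + u3 ^+ 2 = 1 / 2 ->
  w0 ^+ 2 + w1 ^+ 2 = 1 / 2 -> w2 ^+ 2 + w3 ^+ 2 = 1 / 2 ->
  1 - 4 * e <= u0 * w0 + u1 * w1 + u2 * w2 + u3 * w3 ->
  0 < u0 * w0 + u1 * w1 /\ 0 < u2 * w2 + u3 * w3.
Proof.
move=> es hu hv ku kv.
have s0 := sqr_ge0 (u0 - w0); have s1 := sqr_ge0 (u1 - w1).
have s2 := sqr_ge0 (u2 - w2); have s3 := sqr_ge0 (u3 - w3).
by rewrite !sqrrB in s0 s1 s2 s3; split; lra.
Qed.

Hypotheses (es : 60 * e <= 1 / 2000) (Hz : C1V z z1 z2).
Hypotheses (nz : forall a b k, `|z a b 0 k - clif a b 0 k| <= e)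
  (nz1 : forall a b k, `|z1 a b 0 k - clif1 a b 0 k| <= e)
  (nz2 : forall a b k, `|z2 a b 0 k - clif2 a b 0 k| <= e).
Hypothesis zT : forall a b, clifford_torus (z a b).

Let z_unit a b : dot (z a b) (z a b) = 1. Proof. exact/S3E/clifford_S3. Qed.

Let z_coord a b k : `|z a b 0 k| <= 1. Proof. exact: unit_coord. Qed.

Let tangent a b (t : 'rV[R]_4) : t = z1 a b \/ t = z2 a b ->
  z a b 0 (inord 0) * t 0 (inord 0) + z a b 0 (inord 1) * t 0 (inord 1) = 0 /\
  z a b 0 (inord 2) * t 0 (inord 2) + z a b 0 (inord 3) * t 0 (inord 3) = 0.
Proof.
have [d1 d2] := sphere_tangent Hz z_unit a b.
have q0 a' b' : qf (z a' b') (z a' b') = 0 by exact/clifford_qf.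
have Q := C1V_wdot (sgn4 R) Hz Hz.
have q1 : qf (z a b) (z1 a b) = 0.
  have := C1T_unique1 Q (@C1T_cst R 0) q0 a b; rewrite (wdotC _ (z1 a b)) -/qf => h.
  by apply/eqP; move/eqP: h; rewrite -mulr2n mulrn_eq0.
have q2 : qf (z a b) (z2 a b) = 0.
  have := C1T_unique2 Q (@C1T_cst R 0) q0 a b; rewrite (wdotC _ (z2 a b)) -/qf => h.
  by apply/eqP; move/eqP: h; rewrite -mulr2n mulrn_eq0.
move=> t_; have {d1 d2} td : dot (z a b) t = 0 by case: t_ => ->.
have {q1 q2} tq : qf (z a b) t = 0 by case: t_ => ->.
by move: td tq; rewrite dot4E qfE => *; split; lra.
Qed.

(** Take the point of the surface closest to the given one.  The tangent vectors of
    the surface there span those of both circles, so the given point is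
    orthogonal to the latter: its two circle components are parallel to those of
    the closest point, and closeness excludes opposite signs. *)
Theorem surjective_onto_clifford a0 b0 : exists a b, z a b = clif a0 b0.
Proof.
have [c cE] : exists c, c = clif a0 b0 by eexists.
have Hc : C1V (fun _ _ : R => c) (fun _ _ => 0) (fun _ _ => 0).
  by move=> k; apply: (C1T_ext (@C1T_cst R (c 0 k))) => a b; rewrite ?mxE.
have Hf := C1V_dot Hz Hc.
have [a [b m]] := periodic_max (C1T_cont Hf) (C1T_per1 Hf) (C1T_per2 Hf).
exists a, b; rewrite -cE.
have g1 := der_max0 (C1T_der1 Hf a b) (fun t => m t b).
have g2 := der_max0 (C1T_der2 Hf a b) (fun t => m a t).
have d0 (u : 'rV[R]_4) : dot u 0 = 0 by rewrite -(scale0r (0 : 'rV[R]_4)) dotZr mul0r.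
rewrite d0 addr0 dot4E ?addrA in g1; rewrite d0 addr0 dot4E in g2.
have cc : clifford_torus c by rewrite cE; exact: clif_torus.
have c1 : dot c c = 1 by apply/S3E; exact: clifford_S3.
have near0 : 1 - 4 * e <= dot (z a b) c.
  apply: le_trans (m a0 b0).
  have -> : dot (z a0 b0) c = dot (z a0 b0 - c) c + 1 by rewrite dotBl c1 subrK.
  have : `|dot (z a0 b0 - c) c| <= 4 * e.
    apply: (le_trans (ler_norm_sum _ _ _)).
    have -> : 4 * e = \sum_(k < 4) e by rewrite sumr_const card_ord; ring.
    apply: ler_sum => k _; rewrite normrM -[leRHS]mulr1; apply: ler_pM => //.
      by rewrite !mxE cE; exact: nz.
    exact: unit_coord.
  by rewrite ler_norml => /andP[+ _]; move: (dot (z a0 b0 - c) c) => *; lra.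
have [t1 s1] := @tangent a b _ (or_introl erefl); have [t2 s2] := @tangent a b _ (or_intror erefl).
have /clifford_torusE[zu zv] := zT a b; have /clifford_torusE[cu cv] := cc.
have es' : e <= 1 / 64 by exact: small.
have C1 k : `|clif1 a b 0 k| <= 1 by exact: (le_trans (clif1_bound a b k) le34_1).
have C2 k : `|clif2 a b 0 k| <= 1 by exact: (le_trans (clif2_bound a b k) le34_1).
have K (t w : 'rV[R]_4) (i j : 'I_4) (r : R) : (forall k, `|t 0 k - w 0 k| <= e) -> (forall k, `|w 0 k| <= 1) ->
    clif a b 0 i * w 0 j - clif a b 0 j * w 0 i = r ->
    `|z a b 0 i * t 0 j - z a b 0 j * t 0 i - r| <= 1 / 8.
  by move=> tw w1; apply: cross_close => //; exact: nz.
have A1 := K _ _ (inord 0) (inord 1) (1 / 2) (nz1 a b) C1.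
have A2 := K _ _ (inord 0) (inord 1) 0 (nz2 a b) C2.
have B1 := K _ _ (inord 2) (inord 3) 0 (nz1 a b) C1.
have B2 := K _ _ (inord 2) (inord 3) (1 / 2) (nz2 a b) C2.
have {}A1 := A1 (clif_cross _ _).1; have {}A2 := A2 (clif_cross _ _).2.1.
have {}B1 := B1 (clif_cross _ _).2.2.1; have {}B2 := B2 (clif_cross _ _).2.2.2.
rewrite subr0 in A2; rewrite subr0 in B1.
have eqs (t : 'rV[R]_4) (h : t = z1 a b \/ t = z2 a b) :
    t 0 (inord 0) * c 0 (inord 0) + t 0 (inord 1) * c 0 (inord 1)
      + t 0 (inord 2) * c 0 (inord 2) + t 0 (inord 3) * c 0 (inord 3) = 0 ->
    (z a b 0 (inord 0) * t 0 (inord 1) - z a b 0 (inord 1) * t 0 (inord 0))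
      * (z a b 0 (inord 0) * c 0 (inord 1) - z a b 0 (inord 1) * c 0 (inord 0))
    + (z a b 0 (inord 2) * t 0 (inord 3) - z a b 0 (inord 3) * t 0 (inord 2))
      * (z a b 0 (inord 2) * c 0 (inord 3) - z a b 0 (inord 3) * c 0 (inord 2)) = 0.
  have [h1 h2] := @tangent a b t h.
  have T1 := tangent_circle (c 0 (inord 0)) (c 0 (inord 1)) zu h1.
  have T2 := tangent_circle (c 0 (inord 2)) (c 0 (inord 3)) zv h2.
  by move=> h0; apply: (half_sum T2 T1); rewrite addrA.
rewrite dot4E in near0; have [X0 Y0] := cross_solve A1 A2 B1 B2 (eqs _ (or_introl erefl) g1) (eqs _ (or_intror erefl) g2).
have [i1 i2] := both_positive es zu zv cu cv near0.
have [c0 c1'] := circle_eq zu cu X0 i1; have [c2 c3] := circle_eq zv cv Y0 i2.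
apply/rowP => k; have E' (n : nat) (kl : (n < 4)%N) : Ordinal kl = inord n.
  by apply: val_inj; rewrite /= inordK.
by case: k => -[|[|[|[|k]]]] kl //; rewrite !E'.
Qed.

End SurjectiveOntoClifford.
(** * Congruence with the Clifford torus *)

Section Conclusion.
Variables (R : realType) (alpha : R).

Lemma orth_S3_isometry (h : 'M[R]_4) : orth h -> S3_isometry (fun x => x *m h).
Proof.
move=> oh; split; last split.
- move=> x /S3E x1; exists (x *m h^T); last exact: mulmx_orthVK.
  by apply/S3E; rewrite (orthT oh).
- by move=> x /S3E x1; apply/S3E; rewrite oh.
- by move=> x w _ _; rewrite -mulmxBl /enorm oh.
Qed.

Lemma norm_near0 (X : nat -> 'rV[R]_4 -> 'rV[R]_4) (e : R) : 0 < e ->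
  (fun k => C2alpha_norm alpha A2 (fun x => X k x - x)) @ \oo --> 0%E ->
  \forall k \near \oo, (C2alpha_norm alpha A2 (fun x => (X k x - x)%R) < e%:E)%E.
Proof.
move=> e0 H; apply: (H [set x | (x < e%:E)%E]).
by apply: open_ereal_lt'; rewrite lte_fin.
Qed.

Lemma congruent_of_parametrization (X : 'rV[R]_4 -> 'rV[R]_4) (h : 'M[R]_4) : orth h ->
  (forall a b, clifford_torus (image_y X a b *m h)) ->
  (forall a b, exists a' b', image_y X a' b' *m h = clif a b) ->
  congruent (X @` clifford_torus) clifford_torus.
Proof.
move=> oh hT hS; exists (fun x => x *m h); first exact: orth_S3_isometry.
apply/seteqP; split=> [_ [_ [x Tx <-] <-]|x Tx].
  by have [a [b ->]] := clif_surj Tx; exact: hT.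
have [a [b ->]] := clif_surj Tx; have [a' [b' <-]] := hS a b.
by exists (X (clif a' b')) => //; exists (clif a' b') => //; exact: clif_torus.
Qed.

Let tiny (c : R) : 0 < c -> exists2 d : R, 60 * (5 * d) <= c & 0 < d.
Proof.
move=> c0; exists (c / 60 / 5); last by rewrite !divr_gt0.
by have -> : 60 * (5 * (c / 60 / 5)) = c by field.
Qed.

Theorem near_identity_congruent (X : nat -> 'rV[R]_4 -> 'rV[R]_4) :
  (forall k, canonically_extended_diffeo alpha (X k)) ->
  (forall k, minimally_embedded_torus alpha (X k @` clifford_torus)) ->
  (fun k => C2alpha_norm alpha A2 (fun x => X k x - x)) @ \oo --> 0%E ->
  exists k, congruent (X k @` clifford_torus) clifford_torus.
Proof.
move=> HX Hmin Hcv.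
have c0 : 0 < 1 / 2000 :> R by rewrite divr_gt0 ?ltr01 ?ltr0n.
have [d ds d0] := tiny c0.
have q4 (t : R) : 0 < t -> 0 < t / 4 by move=> t0; rewrite divr_gt0 // ltr0n.
have m4 (t : R) : 4 * (t / 4) = t by rewrite mulrC divfK // pnatr_eq0.
have close t k := @image_close R alpha (X k) (t / 4) (HX k).
have ycvg : forall t : R, 0 < t -> \forall k \near \oo,
    forall a b j, `|image_y (X k) a b 0 j - clif a b 0 j| <= t.
  move=> t t0; apply: filterS (norm_near0 (q4 _ t0) Hcv) => k hk a b j.
  by have [+ _] := close t k hk a b j; rewrite m4.
have [k [h [hk oh h1 hmin]]] := near_identity_minimizer (fun k => C1V_image (HX k))
  (fun k => image_sphere (HX k)) ycvg d0 (norm_near0 (q4 _ d0) Hcv).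
have {}close a b j := close d k hk a b j; rewrite m4 in close.
exists k; have [f [Hf imm _ min rng]] := Hmin k.
have [pp [pq [qq [Hp Hq minat]]]] := image_minimal (HX k) Hf imm min rng.
have n0 a b j : `|image_y (X k) a b 0 j - clif a b 0 j| <= d := (close a b j).1.
have n1 a b j : `|push (X k) (@clif1 R) a b 0 j - clif1 a b 0 j| <= d := (close a b j).2.1.
have n2 a b j : `|push (X k) (@clif2 R) a b 0 j - clif2 a b 0 j| <= d := (close a b j).2.2.
have Hy := C1V_image (HX k); have sy := image_sphere (HX k).
have zT := rotated_in_clifford (ltW d0) ds Hy Hp Hq sy n0 n1 n2 minat oh h1 hmin.
apply: (congruent_of_parametrization oh zT) => a b.
have nz := rotated_close (ltW d0) ds n0 n1 n2 h1.
have z0 a' b' j : `|(image_y (X k) a' b' *m h) 0 j - clif a' b' 0 j| <= 5 * d by have [] := nz a' b' j.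
have z1 a' b' j : `|(push (X k) (@clif1 R) a' b' *m h) 0 j - clif1 a' b' 0 j| <= 5 * d by have [] := nz a' b' j.
have z2 a' b' j : `|(push (X k) (@clif2 R) a' b' *m h) 0 j - clif2 a' b' 0 j| <= 5 * d by have [] := nz a' b' j.
exact: (@surjective_onto_clifford R (5 * d) _ _ _ ds (C1V_mul h Hy) z0 z1 z2 zT a b).
Qed.

End Conclusion.
Theorem lemma5p1 (R : realType) (alpha : R) (halpha : 0 < alpha < 1) :
  ~ exists X : nat -> 'rV[R]_4 -> 'rV[R]_4,
      [/\ forall k, canonically_extended_diffeo alpha (X k),
          forall k, minimally_embedded_torus alpha (X k @` clifford_torus),
          forall k, ~ congruent (X k @` clifford_torus) clifford_torus &
          (fun k => C2alpha_norm alpha A2 (fun x => X k x - x)) @ \oo --> 0%E].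
Proof.
move=> [X [HX Hmin Hnc Hcv]].
by have [k /Hnc] := near_identity_congruent HX Hmin Hcv.
Qed.
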